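(* Let $u(x)$ be a Gaussian random function with law $\mu_0$, mean $\langle u(x)\rangle$ and covariance $\mathrm{Cov}[u(x),u(y)]=a^{-1}(x,y)$. Let $g_1,\dots,g_N$ be kernels, let $U_\alpha[u(\cdot)]=\int g_\alpha(x)u(x)\,dx$ for $\alpha=1,\dots,N$, and let $M$ be the $N\times N$ matrix, assumed invertible, with entries $$m_{\beta\alpha}=\mathrm{Cov}\big[U_\beta[u(\cdot)],U_\alpha[u(\cdot)]\big]=\iint g_\beta(x)\,a^{-1}(x,y)\,g_\alpha(y)\,dx\,dy .$$ Denote the entries of $M^{-1}$ by $m^{-1}_{\beta\alpha}$. Then for every vector of values $V=(V_1,\dots,V_N)^T\in\mathbb{R}^N$, the conditional expectation of $u(x)$ given $U_\alpha[u(\cdot)]=V_\alpha$, $\alpha=1,\dots,N$, is the following linear form in the conditioning data $V$: $$\langle u(x)\rangle_V=\langle u(x)\rangle+\sum_{\alpha=1}^N c_\alpha(x)\,\big\{V_\alpha-\langle U_\alpha[u(\cdot)]\rangle\big\},$$ where $$c_\alpha(x)=\sum_{\beta=1}^N\Big(\int a^{-1}(x,y)\,g_\beta(y)\,dy\Big)\,m^{-1}_{\beta\alpha}.$$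
   Context: A random real-valued function $u(x)$ is Gaussian with law $\mu_0$ if it has (formal) probability density $$f_0[u(\cdot)]=Z^{-1}\exp\Big(-\tfrac12\iint u(x)a(x,y)u(y)\,dx\,dy+\int b(x)u(x)\,dx\Big),$$ with $a(x,y)$, $b(x)$ (generalized) functions and $Z$ a normalizing constant. Averages with respect to $\mu_0$ are denoted $\langle\cdot\rangle$. The mean and covariance are $\langle u(x)\rangle=\int a^{-1}(x,y)b(y)\,dy$ and $$\mathrm{Cov}[u(x),u(y)]=\langle u(x)u(y)\rangle-\langle u(x)\rangle\langle u(y)\rangle=a^{-1}(x,y),$$ where $a^{-1}$ is the integral-kernel inverse of $a$, defined by $\int a(x,z)a^{-1}(z,y)\,dz=\int a^{-1}(x,z)a(z,y)\,dz=\delta(x-y)$. The kernels $g_\alpha$ are (generalized) functions such that the integrals written are meaningful. The linear functionals $U_\alpha[u(\cdot)]=\int g_\alpha(x)u(x)\,dx$ (called collective variables) are then jointly Gaussian together with the values $u(x)$, and $\mathrm{Cov}[u(x),U_\alpha]=\int a^{-1}(x,y)g_\alpha(y)\,dy$. For $V\in\mathbb{R}^N$, the conditional measure $\mu_V$ is the prior conditioned on $U_\alpha[u(\cdot)]=V_\alpha$ for all $\alpha$. Formally it has density $f_V[u(\cdot)]=c\,f_0[u(\cdot)]\prod_{\alpha=1}^N\delta(U_\alpha[u(\cdot)]-V_\alpha)$ with $c$ a normalization factor. Averages with respect to $\mu_V$ are denoted $\langle\cdot\rangle_V$; equivalently, $\langle O\rangle_V$ is the value at $V$ of the version, continuous in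 $V$, of the conditional expectation of $O[u(\cdot)]$ given $(U_1,\dots,U_N)=V$. *)

(* Defs.v *)
From HB Require Import structures.
From mathcomp Require Import all_boot all_order all_algebra.
From mathcomp Require Import all_classical all_reals all_analysis.

Set Implicit Arguments.
Unset Strict Implicit.
Unset Printing Implicit Defensive.

Import Order.TTheory GRing.Theory Num.Theory.
Import numFieldNormedType.Exports.

Local Open Scope classical_set_scope.
Local Open Scope ring_scope.

(* Normal law with mean m and standard deviation s.  The library's
   [normal_prob m 0] is a uniform law, so the degenerate case is separate. *)
Definition gaussian_law {R : realType} (m s : R) (A : set R) : \bar R :=
  if s == 0 then \d_m A else normal_prob m s A.

Definition gaussian_rv {d} {T : measurableType d} {R : realType}
    (P : probability T R) (Y : T -> R) : Prop :=
  measurable_fun setT Y /\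
  exists m s : R, 0 <= s /\
    forall A : set R, measurable A -> P (Y @^-1` A) = gaussian_law m s A.

(* The formal density exp(-1/2 uau + bu) is read as: all finite linear
   combinations of values of u are Gaussian.  Joint measurability is what makes
   integrals of u over the space variable random variables. *)
Definition gaussian_random_function {dX} {X : measurableType dX}
    {d} {T : measurableType d} {R : realType}
    (P : probability T R) (u : X -> T -> R) : Prop :=
  measurable_fun setT (fun z : X * T => u z.1 z.2) /\
  forall (n : nat) (x : 'I_n -> X) (t : 'I_n -> R),
    gaussian_rv P (fun w => \sum_(i < n) t i * u (x i) w).

(* A generalized function is given, as in the sequential theory of
   distributions, by ordinary functions g 0, g 1, ..., with
     int g(x) f(x) dx := lim_n int (g n)(x) f(x) dx;
   an ordinary function is a constant sequence, and the Dirac mass and its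
   derivatives are limits of mollifiers and of their derivatives. *)
Definition gen_fun (X : Type) (R : realType) := nat -> X -> R.

Definition gen_int {dX} {X : measurableType dX} {R : realType}
    (dx : {measure set X -> \bar R}) (g : gen_fun X R) (f : X -> R) : R :=
  limn (fun n => \int[dx]_x (g n x * f x)).

Definition gen_integrable {dX} {X : measurableType dX} {R : realType}
    (dx : {measure set X -> \bar R}) (g : gen_fun X R) (f : X -> R) : Prop :=
  (forall n, dx.-integrable setT (fun x => (g n x * f x)%:E)) /\
  cvgn (fun n => \int[dx]_x (g n x * f x)).

(* The integral of g(x) u(x) dx is meaningful for almost every realization. *)
Definition admissible_kernel {dX} {X : measurableType dX}
    {d} {T : measurableType d} {R : realType}
    (dx : {measure set X -> \bar R}) (P : probability T R)
    (u : X -> T -> R) (g : gen_fun X R) : Prop :=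
  (forall n, measurable_fun setT (g n)) /\
  {ae P, forall w, gen_integrable dx g (u^~ w)}.

(* phi is a version, continuous in V, of V |-> E[O | U = V]; the sets
   <<s open >> are the Borel sets of R^N. *)
Definition continuous_cond_version {d} {T : measurableType d} {R : realType}
    {N : nat} (P : probability T R) (U : T -> 'rV[R]_N) (O : T -> R)
    (phi : 'rV[R]_N -> R) : Prop :=
  [/\ continuous phi,
      P.-integrable setT (fun w => (phi (U w))%:E) &
      forall B : set 'rV[R]_N, <<s open >> B ->
        (\int[P]_(w in U @^-1` B) (O w)%:E =
         \int[P]_(w in U @^-1` B) (phi (U w))%:E)%E].

(* <O>_V ; a junk value if there is no continuous version. *)
Definition cond_avg {d} {T : measurableType d} {R : realType} {N : nat}
    (P : probability T R) (U : T -> 'rV[R]_N) (O : T -> R) :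
    'rV[R]_N -> R :=
  xget (fun=> 0) [set phi | continuous_cond_version P U O phi].

(* Main.v *)
Require Import Defs.
From HB Require Import structures.
From mathcomp Require Import all_boot all_order all_algebra.
From mathcomp Require Import all_classical all_reals all_analysis.
From mathcomp Require Import measurable_realfun ring lra.


(* Let H be the closure in L2(P) of the finite linear combinations of the values
   u(x).  Every Y in H satisfies
     E cos (Y + th) = exp (- Var Y / 2) cos (E Y + th),
   so a Gaussian anticoncentration bound holds on H; it upgrades almost sure
   convergence to L2 convergence, and almost sure integrability of g(x) u(x) to
   integrability of |g(x)| ||u(x)||.  Hence the collective variables U belong to
   H, and Fubini's theorem turns covariances with U into integrals of a^-1.

   The coefficients c are chosen so that the residual Z = u(x) - sum c U is
   uncorrelated with every U.  By the formula above E[cos (sZ + eta) cos (t.U +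
   th)] factorizes, hence Z is independent of U and E[u(x) | U] = E Z + sum c U.

   The continuous version is unique because U charges every nonempty open set:
   by induction on N, the last coordinate is a linear form in the others plus an
   independent nondegenerate Gaussian residual. *)

Set Implicit Arguments.
Unset Strict Implicit.
Unset Printing Implicit Defensive.

Import Order.TTheory GRing.Theory Num.Theory.
Import numFieldNormedType.Exports.

Local Open Scope classical_set_scope.
Local Open Scope ring_scope.

(** * Normal laws *)

Section normal_moments.
Context {R : realType}.
Notation mu := (@lebesgue_measure R).
Let TR := measurableTypeR R.

(** The kernels are only assumed meaningful for almost every realization: no moment of the
    collective variables is given, so at the outset neither Fubini's theorem nor an L2 limit is
    available, and all quantitative control has to come from Gaussianity. What passes to L2 limits
    without effort is the cosine identity, so it, and not normality of the law, is the property
    carried to the closure [gspace]; the phase [th] lets one real identity cover cosine and sine.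
    The price is that independence and positivity of events must be recovered from this identity and
    from the approximating finite combinations. The numerical constants serve one threshold: the
    anticoncentration bound wants an event of probability at most 1/8, and each of its two uses
    supplies two contributions of at most 1/16. *)

Lemma ge0_integral_normal_prob (m s : R) (f : TR -> \bar R) :
  (forall x, 0 <= f x)%E -> measurable_fun setT f ->
  (\int[normal_prob m s]_x f x = \int[mu]_x (f x * (normal_pdf m s x)%:E))%E.
Proof.
move=> f0 mf.
have dom := @normal_prob_dominates R m s.
have mp : measurable_fun setT (fun x : TR => (normal_pdf m s x)%:E).
  by apply/measurable_EFinP; exact: measurable_normal_pdf.
rewrite -(Radon_Nikodym_SigmaFinite.change_of_variables dom f0 measurableT mf).
have mRN := measurable_int _ (Radon_Nikodym_SigmaFinite.f_integrable dom).
apply: ae_eq_integral => //.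
- exact: emeasurable_funM.
- exact: emeasurable_funM.
(* The Radon-Nikodym derivative agrees almost everywhere with the explicit density, because both
   integrate to [normal_prob m s] over every measurable set. *)
- have : ae_eq mu setT (Radon_Nikodym_SigmaFinite.f (normal_prob m s) mu)
      (fun x : TR => (normal_pdf m s x)%:E).
    apply: integral_ae_eq => //.
      exact: Radon_Nikodym_SigmaFinite.f_integrable.
    by move=> E _ mE; rewrite -Radon_Nikodym_SigmaFinite.f_integral.
  by apply: filterS => x /= h _; rewrite h.
Qed.

(** With y = (x - m)^2 / (4 s^2) the density is a multiple of exp(-y) exp(-y). One factor absorbs
    the square through y exp(-y) <= 1; the other is a normal density with doubled variance. *)
Lemma normal_pdf_sqr_le (m s x : R) : s != 0 ->
  (x - m) ^+ 2 * normal_pdf m s x <=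
  (4 * s ^+ 2 * normal_peak s / normal_peak (s * Num.sqrt 2)) *
    normal_pdf m (s * Num.sqrt 2) x.
Proof.
move=> s0.
have r20 : Num.sqrt 2 != 0 :> R by rewrite sqrtr_eq0 -ltNge.
have s20 : s * Num.sqrt 2 != 0 by rewrite mulf_neq0.
rewrite !normal_pdfE//.
have p1 := normal_peak_gt0 s0; have p2 := normal_peak_gt0 s20.
rewrite [leRHS]mulrA divfK ?gt_eqF// mulrCA [4 * _ * _]mulrC -[leRHS]mulrA.
rewrite ler_pM2l// /normal_fun exprMn sqr_sqrtr//.
have -> : - (x - m) ^+ 2 / (s ^+ 2 *+ 2) =
  - (x - m) ^+ 2 / (s ^+ 2 * 2 *+ 2) + - (x - m) ^+ 2 / (s ^+ 2 * 2 *+ 2).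
  by field.
rewrite expRD mulrA ler_pM2r ?expR_gt0//.
set y := (x - m) ^+ 2 / (s ^+ 2 * 2 *+ 2).
have -> : - (x - m) ^+ 2 / (s ^+ 2 * 2 *+ 2) = - y by rewrite mulNr.
have -> : (x - m) ^+ 2 = 4 * s ^+ 2 * y by rewrite /y; field.
rewrite -[leLHS]mulrA ler_piMr//; first by rewrite mulr_ge0// sqr_ge0.
rewrite expRN ler_pdivrMr ?expR_gt0// mul1r.
apply: le_trans (expR_ge1Dx y); lra.
Qed.

Lemma integrable_normal_pdf_sqr (m s : R) : s != 0 ->
  mu.-integrable setT (fun x => ((1 + (x - m) ^+ 2) * normal_pdf m s x)%:E).
Proof.
move=> s0; set k := 4 * s ^+ 2 * normal_peak s / normal_peak (s * Num.sqrt 2).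
have h : mu.-integrable setT (fun x => (normal_pdf m s x)%:E +
    k%:E * (normal_pdf m (s * Num.sqrt 2) x)%:E)%E.
  apply: integrableD => //; first exact: integrable_normal_pdf.
  by apply: integrableZl => //; exact: integrable_normal_pdf.
apply: (le_integrable measurableT _ _ h).
  apply/measurable_EFinP; apply: measurable_funM;
    last exact: measurable_normal_pdf.
  apply: measurable_funD => //; apply: measurable_funX; exact: measurable_funB.
move=> x _; rewrite -EFinM -EFinD !abse_EFin lee_fin.
have p0 t := normal_pdf_ge0 m t x.
rewrite ger0_norm ?mulr_ge0//; last by rewrite addr_ge0// sqr_ge0.
apply: le_trans (ler_norm _).
by rewrite mulrDl mul1r lerD2l normal_pdf_sqr_le.
Qed.

End normal_moments.

(** * Stein's identity for the normal density *)

Section normal_stein.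
Context {R : realType}.
Notation mu := (@lebesgue_measure R).

(** The fundamental theorem of calculus on [-n, n] and dominated convergence of the truncations
    [hn]; the boundary terms are needed along the integers only. *)
Lemma integral_derivative_eq0 (F h : R -> R) :
  (forall x : R, is_derive x 1 F (h x)) -> continuous h ->
  mu.-integrable setT (EFin \o h) ->
  F n%:R @[n --> \oo] --> 0 -> F (- n%:R) @[n --> \oo] --> 0 ->
  \int[mu]_x h x = 0.
Proof.
move=> dF ch ih Fp Fm.
have cF : continuous F.
  by move=> x; apply: differentiable_continuous; apply/derivable1_diffP;
     have [] := dF x.
pose hn n := (fun x => (h x)%:E) \_ `[- n%:R, n%:R].
have mh : measurable_fun setT (fun x => (h x)%:E).
  by apply/measurable_EFinP; exact: continuous_measurable_fun.
have [_ _ lim1] : [/\ mu.-integrable setT (fun x => (h x)%:E),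
  [sequence (\int[mu]_x (`|hn n x - (h x)%:E|))%E]_n @ \oo --> 0%E &
  [sequence (\int[mu]_x hn n x)%E]_n @ \oo --> (\int[mu]_x (h x)%:E)%E].
  apply: (@dominated_convergence _ _ _ mu setT measurableT hn _ (fun x => `|(h
    x)%:E|%E)) => //.
  - by move=> n; apply/(measurable_restrictT _ _).1 => //;
    exact: measurable_funTS.
  - apply: aeW => x _; apply: (@cvg_near_cst _ _ _ _ _ _).
    near=> n.
    rewrite /hn patchE ifT// inE/= in_itv/= -ler_norml.
    by near: n; exact: nbhs_infty_ger.
  - exact: integrable_abse.
  - apply: aeW => x n _; rewrite /hn patchE; case: ifPn => //.
    by rewrite abse0.
have lim2 : [sequence (\int[mu]_x hn n x)%E]_n @ \oo --> 0%E.
  have : (F n%:R - F (- n%:R))%:E @[n --> \oo] --> 0%E.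
    apply: cvg_EFin; first exact: nearW.
    by rewrite -[X in _ --> X](subrr 0); exact: cvgB.
  apply: cvg_trans; apply: near_eq_cvg; near=> n.
  rewrite /= /hn -integral_mkcond (@continuous_FTC2 _ h F) //.
  - by rewrite gtrN // ltr0n; near: n; exact: nbhs_infty_gt.
  - exact: continuous_subspaceT.
  - split=> [x _| |]; first by have [] := dF x.
    + exact/cvg_at_right_filter/cF.
    + exact/cvg_at_left_filter/cF.
  - by move=> x _; rewrite derive1E; have [_ ->] := dF x.
rewrite /Rintegral; suff -> : (\int[mu]_x (h x)%:E)%E = 0%E by [].
exact: (cvg_unique _ lim1 lim2).
Unshelve. all: end_near. Qed.

Lemma is_derive_normal_pdf (m s x : R) : s != 0 ->
  is_derive x 1 (normal_pdf m s) (- (x - m) / s ^+ 2 * normal_pdf m s x).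
Proof.
move=> s0; rewrite normal_pdfE// /normal_fun.
apply: is_derive_eq.
rewrite /GRing.scale/=; field.
by rewrite s0.
Qed.

Lemma integrable_mul_normal_pdf (m s C : R) (f : R -> R) : s != 0 ->
  measurable_fun setT f -> (forall x, `|f x| <= C * (1 + (x - m) ^+ 2)) ->
  mu.-integrable setT (fun x => (f x * normal_pdf m s x)%:E).
Proof.
move=> s0 mf fC.
have h : mu.-integrable setT
    (fun x => C%:E * ((1 + (x - m) ^+ 2) * normal_pdf m s x)%:E)%E.
  by apply: integrableZl => //; exact: integrable_normal_pdf_sqr.
apply: (le_integrable measurableT _ _ h).
  by apply/measurable_EFinP; apply: measurable_funM => //;
    exact: measurable_normal_pdf.
move=> x _; rewrite -EFinM !abse_EFin lee_fin mulrA !normrM.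
rewrite ler_wpM2r// -normrM; exact: le_trans (fC x) (ler_norm _).
Qed.

(** Kills the boundary terms in [normal_stein]. With y = |x - m| and p the density, (1 + y) y p <= 2
    (p + y^2 p), and both p and y^2 p are bounded, the latter by [normal_pdf_sqr_le]. *)
Lemma normal_pdf_decay (m s : R) : s != 0 ->
  exists C, forall x, x != m -> (1 + `|x - m|) * normal_pdf m s x <= C / `|x -
    m|.
Proof.
move=> s0.
pose k := 4 * s ^+ 2 * normal_peak s / normal_peak (s * Num.sqrt 2).
have s20 : s * Num.sqrt 2 != 0 by rewrite mulf_neq0// sqrtr_eq0 -ltNge.
have k0 : 0 <= k.
  rewrite /k; apply: mulr_ge0; last by rewrite invr_ge0 normal_peak_ge0.
  by rewrite mulr_ge0 ?normal_peak_ge0// mulr_ge0// sqr_ge0.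
exists (2 * (normal_peak s + k * normal_peak (s * Num.sqrt 2))) => x xm.
have xm0 : 0 < `|x - m| by rewrite normr_gt0 subr_eq0.
rewrite ler_pdivlMr//.
have h1 := normal_pdf_ub m x s0.
have h2 := normal_pdf_ub m x s20.
have h3 := normal_pdf_sqr_le m x s0.
rewrite -/k -real_normK ?num_real// in h3.
have h4 := normal_pdf_ge0 m s x.
have h5 : k * normal_pdf m (s * Num.sqrt 2) x <= k * normal_peak (s * Num.sqrt
  2).
  exact: ler_wpM2l.
move: h1 h3 h4 h5 xm0;
  move: (`|x - m|) (normal_pdf m s x) => y p h1 h3 h4 h5 y0.
have : 0 <= p * (1 - y) ^+ 2 by rewrite mulr_ge0// sqr_ge0.
nra.
Qed.

(** Gaussian integration by parts: f times the density has derivative (f' - (x - m) f / s^2) times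
    the density, whose integral vanishes. The choices f = 1, f = x - m and f = sin (t (x - m) + th)
    give the mean, the variance and the characteristic function. *)
Lemma normal_stein (m s K : R) (f f' : R -> R) : s != 0 ->
  (forall x : R, is_derive x 1 f (f' x)) -> continuous f' ->
  (forall x, `|f x| <= 1 + `|x - m|) -> (forall x, `|f' x| <= K) ->
  \int[mu]_x ((x - m) * f x * normal_pdf m s x) =
  s ^+ 2 * \int[mu]_x (f' x * normal_pdf m s x).
Proof.
move=> s0 df cf' fb f'b.
have cf : continuous f.
  by move=> x; apply: differentiable_continuous; apply/derivable1_diffP;
     have [] := df x.
have cp : continuous (normal_pdf m s) by exact: continuous_normal_pdf.
pose h x := (f' x - (x - m) * f x / s ^+ 2) * normal_pdf m s x.
have i1 : mu.-integrable setT (EFin \o (fun x => (x - m) * f x * normal_pdf m s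
  x)).
  apply: (@integrable_mul_normal_pdf _ _ 2 (fun x => (x - m) * f x)) => //.
    apply: measurable_funM; first exact: measurable_funB.
    exact: continuous_measurable_fun.
  move=> x; rewrite normrM.
  apply: le_trans (ler_wpM2l (normr_ge0 _) (fb x)) _.
  rewrite -[(x - m) ^+ 2]real_normK ?num_real//.
  have : 0 <= (1 - `|x - m|) ^+ 2 by exact: sqr_ge0.
  nra.
have i2 : mu.-integrable setT (EFin \o (fun x => f' x * normal_pdf m s x)).
  apply: (@integrable_mul_normal_pdf _ _ K) => //.
    exact: continuous_measurable_fun.
  move=> x; apply: le_trans (f'b x) _.
  have K0 : 0 <= K by exact: le_trans (f'b x).
  by rewrite ler_peMr// lerDl sqr_ge0.
have i3 : mu.-integrable setT (EFin \o (fun x => s ^- 2 * ((x - m) * f x *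
  normal_pdf m s x))).
  rewrite /comp; under eq_fun do rewrite EFinM.
  exact: integrableZl.
have : \int[mu]_x h x = 0.
  have [C decay] := normal_pdf_decay m s0.
  have bound x : x != m -> `|f x * normal_pdf m s x| <= C / `|x - m|.
    move=> xm; rewrite normrM (ger0_norm (normal_pdf_ge0 _ _ _)).
    apply: le_trans (decay x xm); rewrite ler_wpM2r//; exact: normal_pdf_ge0.
  have lim (z : R^nat) : (forall n, `|z n| = n%:R) ->
      f (z n) * normal_pdf m s (z n) @[n --> \oo] --> 0.
    move=> zn; apply/cvgr0Pnorm_le => e e0; near=> n.
    have zm : `|m| + `|C| / e < `|z n|.
      by rewrite zn; near: n; exact: nbhs_infty_gtr.
    have zm' : `|C| / e < `|z n - m|.
      by rewrite -(ltrD2l `|m|) (lt_le_trans zm)// -{1}(subrK m (z n))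
        [leRHS]addrC ler_normD.
    have zm0 : 0 < `|z n - m| by apply: le_lt_trans zm'; rewrite divr_ge0// ltW.
    apply: le_trans (bound _ _) _; first by rewrite -subr_eq0 -normr_gt0.
    rewrite ler_pdivrMr//; apply: le_trans (ler_norm C) _.
    by rewrite mulrC -ler_pdivrMr// ltW.
  apply: (@integral_derivative_eq0 (fun x => f x * normal_pdf m s x)).
  - move=> x; rewrite /h; have dfx := df x;
    have dp := is_derive_normal_pdf m x s0.
    apply: is_derive_eq; rewrite /GRing.scale/=; field; exact: s0.
  - move=> x; apply: cvgM; last exact: cp.
    apply: cvgB; first exact: cf'.
    apply: cvgM; last exact: cvg_cst.
    apply: cvgM; last exact: cf.
    by apply: cvgB; [exact: cvg_id|exact: cvg_cst].
  - rewrite /comp /h.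
    rewrite (_ : (fun x => _) = (fun x => (f' x * normal_pdf m s x)%:E -
       (s ^- 2 * ((x - m) * f x * normal_pdf m s x))%:E)%E); last first.
      by apply/funext => x; rewrite -EFinB; congr EFin; field; exact: s0.
    exact: integrableB.
  - by apply: lim => n; rewrite ger0_norm.
  - by apply: lim => n; rewrite normrN ger0_norm.
rewrite /h.
under eq_Rintegral => x _.
  rewrite (_ : _ * _ = f' x * normal_pdf m s x -
       s ^- 2 * ((x - m) * f x * normal_pdf m s x)); last by field; exact: s0.
  over.
rewrite RintegralB// RintegralZl// => /eqP; rewrite subr_eq0 => /eqP ->.
by rewrite mulrA divff ?mul1r// expf_neq0.
Unshelve. all: end_near. Qed.

End normal_stein.

(** * Mean, variance and characteristic function of the normal density *)

Section normal_characteristic.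
Context {R : realType}.
Notation mu := (@lebesgue_measure R).
Variables (m s : R).
Hypothesis s0 : s != 0.

Lemma normal_mass : \int[mu]_x (normal_pdf m s x) = 1.
Proof. by rewrite /Rintegral integral_normal_pdf. Qed.

Lemma normal_mean : \int[mu]_x ((x - m) * normal_pdf m s x) = 0.
Proof.
have := @normal_stein R m s 1 (cst 1) (cst 0) s0.
rewrite /cst /=; under eq_Rintegral do rewrite mulr1.
move=> -> //.
- under eq_Rintegral do rewrite mul0r.
  by rewrite Rintegral_cst// mul0r mulr0.
- by move=> x; exact: cvg_cst.
- by move=> x; rewrite normr1 lerDl.
- by move=> x; rewrite normr0.
Qed.

Lemma normal_variance :
  \int[mu]_x ((x - m) ^+ 2 * normal_pdf m s x) = s ^+ 2.
Proof.
have d (x : R) : is_derive x 1 (fun x => x - m) (cst 1 x).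
  by apply: is_derive_eq; rewrite subr0.
have := @normal_stein R m s 1 (fun x => x - m) (cst 1) s0 d.
rewrite /cst /=; under eq_Rintegral do rewrite -expr2.
move=> -> //.
- by under eq_Rintegral do rewrite mul1r; rewrite normal_mass mulr1.
- by move=> x; exact: cvg_cst.
- by move=> x; rewrite lerDr.
- by move=> x; rewrite normr1.
Qed.

Let psi th t := \int[mu]_x (cos (t * (x - m) + th) * normal_pdf m s x).

(** Differentiation under the integral, dominated through |x - m| <= 1 + (x - m)^2, produces the
    integral of (x - m) sin; Stein's identity turns it into t s^2 times a cosine integral, so [psi]
    solves a linear differential equation. *)
Lemma is_derive_normal_cos (th t : R) :
  is_derive t 1 (psi th) (- s ^+ 2 * t * psi th t).
Proof.
pose f t x := cos (t * (x - m) + th) * normal_pdf m s x.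
have df x (r : R) : is_derive r 1 (f ^~ x) (- (x - m) * sin (r * (x - m) + th) *
  normal_pdf m s x).
  rewrite /f; apply: is_derive_eq; rewrite /GRing.scale/=; ring.
have trig r (g : R -> R) : continuous g -> continuous (fun x => g (r * (x - m) +
  th)).
  move=> cg x; apply: (@continuous_comp _ _ _ (fun x => r * (x - m) + th) g);
    last exact: cg.
  apply: cvgD; last exact: cvg_cst.
  by apply: cvgMr; apply: cvgB; [exact: cvg_id|exact: cvg_cst].
have int x : mu.-integrable setT (EFin \o f x).
  apply: (@integrable_mul_normal_pdf _ _ _ 1) => //.
    apply: continuous_measurable_fun; apply: trig; exact: continuous_cos.
  by move=> y; rewrite mul1r (le_trans (cos_max _))// lerDl sqr_ge0.
have Itt : `]t - 1, t + 1[%classic t by rewrite /= in_itv/= gtrBl ltrDl ltr01.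
have dfT (x y : R) : `]t - 1, t + 1[%classic x -> setT y -> derivable (f^~ y) x
  1.
  by move=> _ _; have [] := df y x.
pose G y : R := (1 + (y - m) ^+ 2) * normal_pdf m s y.
have G0 y : 0 <= G y by rewrite mulr_ge0 ?normal_pdf_ge0// addr_ge0// sqr_ge0.
have iG : mu.-integrable setT (EFin \o G) by exact: integrable_normal_pdf_sqr.
have Gub (x y : R) : `]t - 1, t + 1[%classic x -> setT y ->
    `|partial1of2 f x y| <= G y.
  move=> _ _; rewrite partial1of2E; have [_ ->] := df y x.
  rewrite normrM (ger0_norm (normal_pdf_ge0 _ _ _)) ler_wpM2r ?normal_pdf_ge0//.
  rewrite mulNr normrN normrM.
  apply: (@le_trans _ _ (`|y - m| * 1)); first by rewrite ler_wpM2l// sin_max.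
  rewrite -[(y - m) ^+ 2]real_normK ?num_real//.
  have : 0 <= (1 - `|y - m|) ^+ 2 by exact: sqr_ge0.
  nra.
have D := derivable_under_integral measurableT Itt (fun x _ => int x) dfT G0 iG
  Gub.
have E := differentiation_under_integral measurableT Itt (fun x _ => int x) dfT
  G0 iG Gub.
apply: (@DeriveDef _ _ _ _ _ _ _ D).
rewrite -derive1E E.
rewrite (@eq_Rintegral _ _ _ mu setT (fun x =>
    -1 * ((x - m) * sin (t * (x - m) + th) * normal_pdf m s x))); last first.
  by move=> x _ /=; rewrite partial1of2E; have [_ ->] := df x t; ring.
rewrite RintegralZl//; last first.
  apply: (@integrable_mul_normal_pdf _ _ _ 1 (fun x => (x - m) * sin (t * (x -
    m) + th))) => //.
    apply: measurable_funM; first exact: measurable_funB.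
    apply: continuous_measurable_fun; apply: trig; exact: continuous_sin.
  move=> y; rewrite mul1r normrM.
  apply: (@le_trans _ _ (`|y - m| * 1)); first by rewrite ler_wpM2l// sin_max.
  rewrite -[(y - m) ^+ 2]real_normK ?num_real//.
  have : 0 <= (1 - `|y - m|) ^+ 2 by exact: sqr_ge0.
  nra.
have d (x : R) : is_derive x 1 (fun x => sin (t * (x - m) + th)) (t * cos (t *
  (x - m) + th)).
  by apply: is_derive_eq; rewrite /GRing.scale/=; ring.
rewrite (@normal_stein _ _ _ `|t| _ (fun x => t * cos (t * (x - m) + th)) s0
  d)//.
- have -> : \int[mu]_x (t * cos (t * (x - m) + th) * normal_pdf m s x) = t * psi
  th t.
    rewrite /psi -RintegralZl//; last exact: int.
    by apply: eq_Rintegral => x _; rewrite mulrA.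
  by ring.
- by move=> x; apply: cvgMr; apply: trig; exact: continuous_cos.
- by move=> x; rewrite (le_trans (sin_max _))// lerDl.
- by move=> x; rewrite normrM ler_piMr// cos_max.
Qed.

(** The product of [psi] with exp ((t s)^2 / 2) has zero derivative and equals cos th at t = 0. *)
Lemma normal_cos (th t : R) : psi th t = expR (- (t * s) ^+ 2 / 2) * cos th.
Proof.
have h (x : R) : is_derive x 1 (fun t => psi th t * expR ((t * s) ^+ 2 / 2)) 0.
  have d := is_derive_normal_cos th x.
  by apply: is_derive_eq; rewrite /GRing.scale/=; field.
have := is_derive_0_is_cst t 0 h.
rewrite mul0r expr0n mul0r expR0 mulr1 /psi.
under [X in _ = X -> _]eq_Rintegral do rewrite mul0r add0r.
rewrite RintegralZl ?normal_mass ?mulr1 // => [<-|];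
  last exact: integrable_normal_pdf.
by rewrite mulNr mulrC -mulrA -expRD subrr expR0 mulr1.
Qed.

End normal_characteristic.

(** * Square integrable random variables *)

Definition square_integrable {d} {T : measurableType d} {R : realType}
    (P : probability T R) (Y : T -> R) : Prop :=
  measurable_fun setT Y /\ P.-integrable setT (fun w => (Y w ^+ 2)%:E).

(** The algebraic core of the Cauchy-Schwarz inequality. It is also applied with a = eta^2 to a
    near-minimizer of a distance, where it yields near-orthogonality. *)
Lemma discriminant_le (R : realFieldType) (a b c : R) :
  (forall t, 0 <= a + 2 * t * b + t ^+ 2 * c) -> b ^+ 2 <= a * c.
Proof.
move=> h.
have [c0|c0] := eqVneq c 0.
  have [->|b0] := eqVneq b 0; first by rewrite c0 mulr0 expr0n.
  (* For c = 0 the form is affine in t and takes the value -1 at this point. *)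
  have := h (- (a + 1) / (2 * b)); rewrite c0 mulr0 addr0.
  have -> : a + 2 * (- (a + 1) / (2 * b)) * b = - 1 by field.
  by rewrite oppr_ge0 ler10.
have cp : 0 < c.
  rewrite lt_def c0 /=; apply: contraT; rewrite -ltNge => cn.
  have := h 0; rewrite mulr0 mul0r addr0 expr0n mul0r addr0 => a0.
  (* For c < 0 this t is at least 1 and so large that 2 b + t c <= - 2 (a + 1), which makes the form
     negative. *)
  have := h ((`|b| + a + 1) / - c * 2 + 1).
  set t := (`|b| + a + 1) / - c * 2 + 1.
  have hc : t * c = c - 2 * (`|b| + a + 1) by rewrite /t; field.
  have t1 : 1 <= t.
    rewrite lerDr mulr_ge0// divr_ge0//; last by rewrite oppr_ge0 ltW.
    by rewrite !addr_ge0.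
  have bb : b <= `|b| by exact: ler_norm.
  have -> : a + 2 * t * b + t ^+ 2 * c = a + t * (2 * b + t * c) by ring.
  rewrite hc; have : 0 <= (t - 1) * (2 * (`|b| + a + 1) - c - 2 * b).
    by apply: mulr_ge0; lra.
  lra.
have := h (- b / c).
have -> : a + 2 * (- b / c) * b + (- b / c) ^+ 2 * c = (a * c - b ^+ 2) / c by
  field.
by rewrite pmulr_lge0 ?invr_gt0// subr_ge0.
Qed.

Section expectation_calculus.
Context {d} {T : measurableType d} {R : realType} (P : probability T R).
Local Notation Ex := (Rintegral P setT).
Local Notation ig Y := (P.-integrable setT (EFin \o Y)).
Implicit Types X Y Z : T -> R.

Lemma integrable_measurable Y : ig Y -> measurable_fun setT Y.
Proof. by move/measurable_int/measurable_EFinP. Qed.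

Lemma integrable_le Y Z : measurable_fun setT Y -> ig Z ->
  (forall w, `|Y w| <= Z w) -> ig Y.
Proof.
move=> mY iZ YZ; apply: le_integrable iZ => //; first exact/measurable_EFinP.
by move=> w _; rewrite /= lee_fin (le_trans (YZ w))// ler_norm.
Qed.

Lemma integrable_cst (k : R) : ig (fun _ : T => k).
Proof. exact: finite_measure_integrable_cst. Qed.

Lemma integrable_bounded Y (K : R) : measurable_fun setT Y ->
  (forall w, `|Y w| <= K) -> ig Y.
Proof. by move=> mY YK; apply: (integrable_le mY (integrable_cst K)). Qed.

Lemma integrable_add X Y : ig X -> ig Y -> ig (fun w => X w + Y w).
Proof. by move=> iX iY; have := integrableD measurableT iX iY. Qed.

Lemma integrable_sub X Y : ig X -> ig Y -> ig (fun w => X w - Y w).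
Proof. by move=> iX iY; have := integrableB measurableT iX iY. Qed.

Lemma integrable_scale (k : R) Y : ig Y -> ig (fun w => k * Y w).
Proof. by move=> iY; have := integrableZl measurableT k iY. Qed.

Lemma integrable_normr Y : ig Y -> ig (fun w => `|Y w|).
Proof. by move=> iY; have := integrable_abse iY. Qed.

Lemma integrable_fun_sum (I : Type) (r : seq I) (F : I -> T -> R) :
  (forall i, ig (F i)) -> ig (fun w => \sum_(i <- r) F i w).
Proof.
move=> iF; elim: r => [|a r IH].
  by under [X in integrable _ _ (EFin \o X)]eq_fun do rewrite big_nil;
     exact: integrable_cst.
under [X in integrable _ _ (EFin \o X)]eq_fun do rewrite big_cons.
exact: integrable_add.
Qed.

Lemma Ex_add X Y : ig X -> ig Y -> Ex (fun w => X w + Y w) = Ex X + Ex Y.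
Proof. exact: RintegralD. Qed.

Lemma Ex_sub X Y : ig X -> ig Y -> Ex (fun w => X w - Y w) = Ex X - Ex Y.
Proof. exact: RintegralB. Qed.

Lemma Ex_scale (k : R) Y : ig Y -> Ex (fun w => k * Y w) = k * Ex Y.
Proof. exact: RintegralZl. Qed.

Lemma Ex_cst (k : R) : Ex (fun=> k) = k.
Proof. by rewrite Rintegral_cst//= probability_setT mulr1. Qed.

Lemma Ex_sum (I : Type) (r : seq I) (F : I -> T -> R) :
  (forall i, ig (F i)) ->
  Ex (fun w => \sum_(i <- r) F i w) = \sum_(i <- r) Ex (F i).
Proof.
move=> iF; elim: r => [|a r IH].
  by under [in LHS]eq_fun do rewrite big_nil; rewrite Ex_cst big_nil.
under [in LHS]eq_fun do rewrite big_cons.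
by rewrite Ex_add// ?IH ?big_cons//; exact: integrable_fun_sum.
Qed.

Lemma le_Ex X Y : ig X -> ig Y -> (forall w, X w <= Y w) -> Ex X <= Ex Y.
Proof. by move=> iX iY XY; exact: le_Rintegral. Qed.

Lemma Ex_ge0 X : (forall w, 0 <= X w) -> 0 <= Ex X.
Proof. by move=> X0; exact: Rintegral_ge0. Qed.

Lemma le_normr_Ex X : ig X -> `|Ex X| <= Ex (fun w => `|X w|).
Proof. by move=> iX; exact: le_normr_Rintegral. Qed.

Lemma EFin_Ex X : ig X -> (Ex X)%:E = (\int[P]_w (X w)%:E)%E.
Proof. by move=> iX; rewrite /Rintegral fineK//; exact: integrable_fin_num. Qed.

Lemma Ex_indic (A : set T) : measurable A -> Ex (\1_A) = fine (P A).
Proof. by move=> mA; rewrite /Rintegral integral_indic// setIT. Qed.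

Local Notation sq := (square_integrable P).

Lemma square_integrable_mul X Y : sq X -> sq Y -> ig (fun w => X w * Y w).
Proof.
move=> [mX iX] [mY iY].
have i := integrable_add iX iY.
apply: (integrable_le _ i); first exact: measurable_funM.
move=> w; rewrite normrM -(real_normK (num_real (X w))) -(real_normK (num_real
  (Y w))).
have : 0 <= (`|X w| - `|Y w|) ^+ 2 by exact: sqr_ge0.
have := normr_ge0 (X w); have := normr_ge0 (Y w).
nra.
Qed.

Lemma square_integrable_cst (k : R) : sq (fun=> k).
Proof. by split=> //; exact: integrable_cst. Qed.

Lemma square_integrable_integrable X : sq X -> ig X.
Proof.
move=> sX; have := square_integrable_mul sX (square_integrable_cst 1).
by under [X in integrable _ _ (EFin \o X)]eq_fun do rewrite mulr1.
Qed.

Lemma square_integrable_add X Y : sq X -> sq Y -> sq (fun w => X w + Y w).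
Proof.
move=> sX sY; have [[mX iX] [mY iY]] := (sX, sY).
split; first exact: measurable_funD.
have i := integrable_add (integrable_add iX iY)
  (integrable_scale 2 (square_integrable_mul sX sY)).
by apply: eq_integrable i => // w _ /=; congr EFin; ring.
Qed.

Lemma square_integrable_scale (k : R) X : sq X -> sq (fun w => k * X w).
Proof.
move=> [mX iX]; split; first exact: measurable_funM.
have i := integrable_scale (k ^+ 2) iX.
by apply: eq_integrable i => // w _ /=; congr EFin; ring.
Qed.

Lemma square_integrable_sub X Y : sq X -> sq Y -> sq (fun w => X w - Y w).
Proof.
move=> sX sY; have := square_integrable_add sX (square_integrable_scale (-1)
  sY).
by congr (sq _); apply/funext => w; rewrite mulN1r.
Qed.

Lemma square_integrable_sum (I : Type) (r : seq I) (F : I -> T -> R) :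
  (forall i, sq (F i)) -> sq (fun w => \sum_(i <- r) F i w).
Proof.
move=> iF; elim: r => [|a r IH].
  have := square_integrable_cst 0; congr (sq _).
  by apply/funext => w; rewrite big_nil.
have := square_integrable_add (iF a) IH; congr (sq _).
by apply/funext => w; rewrite big_cons.
Qed.

(** L2 is not quotiented by almost sure equality: on square integrable functions [inner] is only
    semidefinite and [norm2] is a seminorm. *)
Definition inner X Y := Ex (fun w => X w * Y w).
Definition norm2 X := Num.sqrt (inner X X).

Lemma innerC X Y : inner X Y = inner Y X.
Proof. by apply: eq_Rintegral => w _; rewrite mulrC. Qed.

Lemma innerDl X Y Z : sq X -> sq Y -> sq Z ->
  inner (fun w => X w + Y w) Z = inner X Z + inner Y Z.
Proof.
move=> sX sY sZ; rewrite -Ex_add; [|exact: square_integrable_mul..].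
by apply: eq_Rintegral => w _; rewrite mulrDl.
Qed.

Lemma innerZl k X Z : sq X -> sq Z -> inner (fun w => k * X w) Z = k * inner X
  Z.
Proof.
move=> sX sZ; rewrite -Ex_scale; last exact: square_integrable_mul.
by apply: eq_Rintegral => w _; rewrite mulrA.
Qed.

Lemma innerBl X Y Z : sq X -> sq Y -> sq Z ->
  inner (fun w => X w - Y w) Z = inner X Z - inner Y Z.
Proof.
move=> sX sY sZ; rewrite -Ex_sub; [|exact: square_integrable_mul..].
by apply: eq_Rintegral => w _; rewrite mulrBl.
Qed.

Lemma innerDr X Y Z : sq X -> sq Y -> sq Z ->
  inner Z (fun w => X w + Y w) = inner Z X + inner Z Y.
Proof. by move=> sX sY sZ; rewrite !(innerC Z) innerDl. Qed.

Lemma innerBr X Y Z : sq X -> sq Y -> sq Z ->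
  inner Z (fun w => X w - Y w) = inner Z X - inner Z Y.
Proof. by move=> sX sY sZ; rewrite !(innerC Z) innerBl. Qed.

Lemma innerZr k X Z : sq X -> sq Z -> inner Z (fun w => k * X w) = k * inner Z
  X.
Proof. by move=> sX sZ; rewrite !(innerC Z) innerZl. Qed.

Lemma inner_sqrB X Y : sq X -> sq Y ->
  inner (fun w => X w - Y w) (fun w => X w - Y w) =
  inner X X - 2 * inner X Y + inner Y Y.
Proof.
move=> sX sY; have sXY := square_integrable_sub sX sY.
by rewrite innerBl// !innerBr// (innerC Y X); ring.
Qed.

Lemma inner_suml (I : Type) (r : seq I) (F : I -> T -> R) Z :
  (forall i, sq (F i)) -> sq Z ->
  inner (fun w => \sum_(i <- r) F i w) Z = \sum_(i <- r) inner (F i) Z.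
Proof.
move=> sF sZ; rewrite -Ex_sum; last by move=> i; exact: square_integrable_mul.
by apply: eq_Rintegral => w _; rewrite big_distrl.
Qed.

Lemma inner1r X : inner X (fun=> 1) = Ex X.
Proof. by apply: eq_Rintegral => w _; rewrite mulr1. Qed.

Lemma inner_ge0 X : 0 <= inner X X.
Proof. by apply: Ex_ge0 => w; rewrite -expr2 sqr_ge0. Qed.

Lemma norm2_ge0 X : 0 <= norm2 X. Proof. exact: sqrtr_ge0. Qed.

Lemma sqr_norm2 X : norm2 X ^+ 2 = inner X X.
Proof. by rewrite sqr_sqrtr// inner_ge0. Qed.

Lemma inner_sqr_le X Y : sq X -> sq Y -> inner X Y ^+ 2 <= inner X X * inner Y
  Y.
Proof.
move=> sX sY; apply: discriminant_le => t.
have sZ := square_integrable_add sX (square_integrable_scale t sY).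
suff -> : inner X X + 2 * t * inner X Y + t ^+ 2 * inner Y Y =
    inner (fun w => X w + t * Y w) (fun w => X w + t * Y w) by exact: inner_ge0.
rewrite innerDl ?[inner X (fun w => _ + _)]innerC
  ?innerZl ?[inner Y (fun w => _ + _)]innerC ?innerDl ?innerZl//;
  rewrite ?innerDl ?innerZl//; try exact: square_integrable_scale.
by rewrite (innerC Y X); ring.
Qed.

Lemma norm_inner_le X Y : sq X -> sq Y -> `|inner X Y| <= norm2 X * norm2 Y.
Proof.
move=> sX sY; rewrite -ler_sqr ?nnegrE ?mulr_ge0 ?norm2_ge0//.
by rewrite real_normK ?num_real// exprMn !sqr_norm2 inner_sqr_le.
Qed.

Lemma Ex_norm_le X : sq X -> Ex (fun w => `|X w|) <= norm2 X.
Proof.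
move=> sX.
have sA : sq (fun w => `|X w|).
  have [mX iX] := sX; split; first exact: measurableT_comp.
  by apply: eq_integrable iX => // w _ /=; rewrite real_normK ?num_real.
have := norm_inner_le sA (square_integrable_cst 1).
rewrite inner1r => /(le_trans (ler_norm _)) /le_trans; apply.
rewrite /norm2 inner1r Ex_cst sqrtr1 mulr1 ler_wsqrtr//.
rewrite le_eqVlt (_ : inner _ _ = inner X X) ?eqxx//.
by apply: eq_Rintegral => w _; rewrite -!expr2 real_normK ?num_real.
Qed.

Lemma norm2_triangle X Y : sq X -> sq Y ->
  norm2 (fun w => X w + Y w) <= norm2 X + norm2 Y.
Proof.
move=> sX sY; rewrite -ler_sqr ?nnegrE ?addr_ge0 ?norm2_ge0//.
rewrite sqr_norm2 sqrrD !sqr_norm2.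
have sXY := square_integrable_add sX sY.
rewrite innerDl// (innerC X) (innerC Y) !innerDl// (innerC Y X).
have := norm_inner_le sX sY; rewrite ler_norml => /andP[_].
rewrite mulr2n; lra.
Qed.

Lemma norm2Z k X : sq X -> norm2 (fun w => k * X w) = `|k| * norm2 X.
Proof.
move=> sX; rewrite /norm2 innerZl ?[inner X _]innerC ?innerZl//;
  try exact: square_integrable_scale.
by rewrite mulrA -expr2 sqrtrM ?sqr_ge0// sqrtr_sqr.
Qed.

Lemma covariance_inner X Y : sq X -> sq Y ->
  covariance P X Y = (inner X Y - Ex X * Ex Y)%:E.
Proof.
move=> sX sY.
have EE Z : ('E_P[Z] = \int[P]_w (Z w)%:E)%E by rewrite unlock.
rewrite unlock !EE -/(Ex X) -/(Ex Y).
pose a : R := Ex X; pose b : R := Ex Y.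
have iX := square_integrable_integrable sX.
have iY := square_integrable_integrable sY.
have i1 := square_integrable_mul sX sY.
have i2 := integrable_scale b iX.
have i3 := integrable_scale a iY.
have i4 := integrable_cst (a * b).
have i : ig (fun w => X w * Y w - b * X w - (a * Y w - a * b)).
  by apply: integrable_sub; exact: integrable_sub.
transitivity (Ex (fun w => X w * Y w - b * X w - (a * Y w - a * b)))%:E.
  rewrite EFin_Ex//; apply: eq_integral => w _ /=; congr EFin.
  rewrite [LHS](_ : _ = (X w - a) * (Y w - b))//.
  by ring.
congr EFin; rewrite Ex_sub; [|exact: integrable_sub..].
rewrite (Ex_sub i1 i2) (Ex_sub i3 i4) Ex_cst !Ex_scale// /inner -/a -/b.
by ring.
Qed.

End expectation_calculus.

(** * Moments and cosine identity of a Gaussian random variable *)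

Section gaussian_law_moments.
Context {d} {T : measurableType d} {R : realType} (P : probability T R).
Notation mu := (@lebesgue_measure R).
Let TR := measurableTypeR R.
Local Notation Ex := (Rintegral P setT).
Local Notation ig Y := (P.-integrable setT (EFin \o Y)).

Lemma ge0_integral_law (Y : T -> R) (nu : {measure set TR -> \bar R})
    (f : TR -> \bar R) :
  measurable_fun setT Y -> (forall A : set R, measurable A -> P (Y @^-1` A) = nu
    A) ->
  measurable_fun setT f -> (forall x, 0 <= f x)%E ->
  (\int[P]_w f (Y w) = \int[nu]_x f x)%E.
Proof.
move=> mY law mf f0.
have mY' : measurable_fun setT (Y : T -> TR) by [].
have := @ge0_integral_pushforward _ _ T TR R Y mY' P setT f measurableT mf (fun
  y _ => f0 y).
rewrite preimage_setT => <-; apply: eq_measure_integral => A mA _.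
exact: law.
Qed.

(** Transfer of integrals to the law is done for nonnegative functions; writing f = (f + |f|) - |f|
    extends it to signed ones, and finiteness of the integral of |f| gives integrability. *)
Lemma Ex_split_ge0 (Y : T -> R) (f : R -> R) (a b : R) :
  measurable_fun setT Y -> measurable_fun setT f ->
  (\int[P]_w (`|f (Y w)|)%:E = a%:E)%E ->
  (\int[P]_w (f (Y w) + `|f (Y w)|)%:E = b%:E)%E ->
  ig (fun w => f (Y w)) /\ Ex (fun w => f (Y w)) = b - a.
Proof.
move=> mY mf ha hb.
have mfY : measurable_fun setT (fun w => f (Y w)) by exact: measurableT_comp.
have i : ig (fun w => f (Y w)).
  apply/integrableP; split; first exact/measurable_EFinP.
  by rewrite /= ha ltry.
split=> //; have := Ex_add i (integrable_normr i).
by rewrite {1 3}/Rintegral ha hb/= => ->; ring.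
Qed.

Lemma normal_rv_Ex (Y : T -> R) (m s C : R) (f : R -> R) : s != 0 ->
  measurable_fun setT Y ->
  (forall A : set R, measurable A -> P (Y @^-1` A) = normal_prob m s A) ->
  measurable_fun setT f -> (forall x, `|f x| <= C * (1 + (x - m) ^+ 2)) ->
  ig (fun w => f (Y w)) /\
  Ex (fun w => f (Y w)) = \int[mu]_x (f x * normal_pdf m s x).
Proof.
move=> s0 mY law mf fC.
have ge0 (h : R -> R) K : measurable_fun setT h -> (forall x, 0 <= h x) ->
    (forall x, `|h x| <= K * (1 + (x - m) ^+ 2)) ->
    (\int[P]_w (h (Y w))%:E = (\int[mu]_x (h x * normal_pdf m s x))%R%:E)%E.
  move=> mh h0 hK.
  rewrite (@ge0_integral_law Y (normal_prob m s) (fun x => (h x)%:E))//;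
    last exact/measurable_EFinP.
  rewrite ge0_integral_normal_prob//; last exact/measurable_EFinP.
  rewrite /Rintegral fineK//; apply: integrable_fin_num => //.
  exact: integrable_mul_normal_pdf hK.
have mf1 : measurable_fun setT (fun x => `|f x|) by exact: measurableT_comp.
have i1 := integrable_mul_normal_pdf s0 mf fC.
have i2 : mu.-integrable setT (fun x => (`|f x| * normal_pdf m s x)%:E).
  by apply: (integrable_mul_normal_pdf (C := C)) => // x; rewrite normr_id.
have [||i ->] := @Ex_split_ge0 Y f (\int[mu]_x (`|f x| * normal_pdf m s x))
   (\int[mu]_x ((f x + `|f x|) * normal_pdf m s x)) mY mf.
- by apply: (ge0 (fun x => `|f x|) C) => // x; rewrite normr_id.
- apply: (ge0 (fun x => f x + `|f x|) (C + C)) => //.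
  + exact: measurable_funD.
  + by move=> x; rewrite -lerBlDl sub0r -normrN ler_norm.
  + by move=> x; rewrite (le_trans (ler_normD _ _))// mulrDl normr_id lerD.
split=> //.
under eq_Rintegral do rewrite mulrDl.
by rewrite RintegralD// addrK.
Qed.

Lemma dirac_rv_Ex (Y : T -> R) (m : R) (f : R -> R) :
  measurable_fun setT Y ->
  (forall A : set R, measurable A -> P (Y @^-1` A) = \d_m A) ->
  measurable_fun setT f ->
  ig (fun w => f (Y w)) /\ Ex (fun w => f (Y w)) = f m.
Proof.
move=> mY law mf.
have ge0 (h : R -> R) : measurable_fun setT h -> (forall x, 0 <= h x) ->
    (\int[P]_w (h (Y w))%:E = (h m)%:E)%E.
  move=> mh h0.
  rewrite (@ge0_integral_law Y (\d_(m : TR)) (fun x => (h x)%:E))//; last first.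
    exact/measurable_EFinP.
  rewrite integral_dirac//; last exact/measurable_EFinP.
  by rewrite diracT mul1e.
have mf1 : measurable_fun setT (fun x => `|f x|) by exact: measurableT_comp.
have [||i ->] := @Ex_split_ge0 Y f (`|f m|) (f m + `|f m|) mY mf.
- by rewrite (ge0 (fun x => `|f x|)).
- rewrite (ge0 (fun x => f x + `|f x|)) //.
  + exact: measurable_funD.
  + by move=> x; rewrite -lerBlDl sub0r -normrN ler_norm.
by rewrite addrK.
Qed.

(** Identifies the parameters of the law with the mean and the standard deviation; the point mass at
    s = 0 obeys the same formulas. No frequency appears in the cosine identity, since multiples of a
    combination of values of [u] are again such combinations. *)
Lemma gaussian_rv_moments (Y : T -> R) : gaussian_rv P Y ->
  square_integrable P Y /\
  exists m s : R, [/\ 0 <= s,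
    forall A : set R, measurable A -> P (Y @^-1` A) = gaussian_law m s A,
    Ex Y = m, inner P Y Y = m ^+ 2 + s ^+ 2 &
    forall th, Ex (fun w => cos (Y w + th)) = expR (- s ^+ 2 / 2) * cos (m +
      th)].
Proof.
move=> [mY [m [s [s0 law]]]].
have mcos th : measurable_fun setT (fun x : R => cos (x + th)).
  apply: (measurableT_comp (continuous_measurable_fun (@continuous_cos R))).
  exact: measurable_funD.
have [s00|sn0] := eqVneq s 0.
  have law' A : measurable A -> P (Y @^-1` A) = \d_m A.
    by move=> mA; rewrite law// /gaussian_law s00 eqxx.
  have [i2 e2] := @dirac_rv_Ex Y m (fun x => x ^+ 2) mY law' (exprn_measurable
    2).
  have [i1 e1] := @dirac_rv_Ex Y m id mY law' (@measurable_id _ _ _).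
  split=> //; exists m, s; split=> //.
  - by rewrite /inner; under eq_Rintegral do rewrite -expr2;
    rewrite e2 s00 expr0n addr0.
  - move=> th; have [_ ->] := @dirac_rv_Ex Y m (fun x => cos (x + th)) mY law'
    (mcos th).
    by rewrite s00 expr0n oppr0 mul0r expR0 mul1r.
have law' A : measurable A -> P (Y @^-1` A) = normal_prob m s A.
  by move=> mA; rewrite law// /gaussian_law (negbTE sn0).
have b1 x : `|x - m| <= 1 * (1 + (x - m) ^+ 2).
  rewrite mul1r -[(x - m) ^+ 2]real_normK ?num_real//.
  have : 0 <= (1 - `|x - m|) ^+ 2 by exact: sqr_ge0.
  by nra.
have b2 x : `|(x - m) ^+ 2| <= 1 * (1 + (x - m) ^+ 2).
  by rewrite mul1r ger0_norm ?sqr_ge0// lerDr.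
have mB : measurable_fun setT (fun x : R => x - m) by exact: measurable_funB.
have [i1] := normal_rv_Ex sn0 mY law' mB b1.
rewrite normal_mean// => e1.
have [i2] := normal_rv_Ex sn0 mY law' (measurable_funX 2 mB) b2.
rewrite normal_variance// => e2.
have im := integrable_cst P m.
have iY : ig Y.
  by apply: eq_integrable (integrable_add i1 im) => // w _ /=; rewrite subrK.
have EY : Ex Y = m.
  by move: e1; rewrite Ex_sub// Ex_cst => /eqP; rewrite subr_eq0 => /eqP.
have iYY : ig (fun w => Y w ^+ 2).
  have i := integrable_add i2 (integrable_sub (integrable_scale (2 * m) iY)
    (integrable_cst P (m ^+ 2))).
  by apply: eq_integrable i => // w _ /=; congr EFin; ring.
split=> //; exists m, s; split=> //.
  rewrite /inner; under eq_Rintegral do rewrite -expr2.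
  transitivity (Ex (fun w => (Y w - m) ^+ 2 + (2 * m * Y w - m ^+ 2))).
    by apply: eq_Rintegral => w _; ring.
  rewrite Ex_add//; last first.
    by apply: integrable_sub; [exact: integrable_scale|exact: integrable_cst].
  rewrite e2 Ex_sub ?Ex_scale ?Ex_cst ?EY//; first by ring.
  - exact: integrable_scale.
  - exact: integrable_cst.
move=> th.
have bc x : `|cos (x + th)| <= 1 * (1 + (x - m) ^+ 2).
  by rewrite mul1r (le_trans (cos_max _))// lerDl sqr_ge0.
have [_ ->] := normal_rv_Ex sn0 mY law' (mcos th) bc.
have := normal_cos m sn0 (m + th) 1.
rewrite mul1r => <-; apply: eq_Rintegral => x _.
by rewrite mul1r addrA subrK.
Qed.

End gaussian_law_moments.

(** * Uniqueness from trigonometric moments *)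

Section dominated.
Context {d} {T : measurableType d} {R : realType} (P : probability T R).
Local Notation Ex := (Rintegral P setT).
Local Notation ig Y := (P.-integrable setT (EFin \o Y)).

Lemma Ex_dominated (f_ : nat -> T -> R) (f g : T -> R) :
  (forall k, measurable_fun setT (f_ k)) ->
  (forall w, f_ k w @[k --> \oo] --> f w) ->
  ig g -> (forall k w, `|f_ k w| <= g w) ->
  ig f /\ Ex (f_ k) @[k --> \oo] --> Ex f.
Proof.
move=> mf_ ff ig_ fg.
have mf : measurable_fun setT f.
  by apply: (measurable_fun_cvg (h := f_)) => // w _; exact: ff.
have [i1 _ lim] : [/\ P.-integrable setT (EFin \o f),
  [sequence (\int[P]_x (`|(EFin \o f_ n) x - (EFin \o f) x|))%E]_n @ \oo --> 0%E
    &
  [sequence (\int[P]_x (EFin \o f_ n) x)%E]_n @ \oo --> (\int[P]_x (EFin \o f)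
    x)%E].
  apply: (@dominated_convergence _ _ _ P setT measurableT _ _ (EFin \o g)) =>
    //.
  - by move=> n; exact/measurable_EFinP.
  - exact/measurable_EFinP.
  - by apply: aeW => w _; apply: cvg_EFin; [exact: nearW|exact: ff].
  - by apply: aeW => w n _ /=; rewrite lee_fin.
split=> //; apply: fine_cvg; rewrite fineK//; exact: integrable_fin_num.
Qed.

End dominated.

Section trig_uniqueness.
Context {d} {T : measurableType d} {R : realType} (P : probability T R).
Local Notation Ex := (Rintegral P setT).
Local Notation ig Y := (P.-integrable setT (EFin \o Y)).
Variables (n : nat) (U : 'I_n -> T -> R) (W : T -> R).
Hypothesis mU : forall i, measurable_fun setT (U i).
Hypothesis iW : ig W.

Definition lincomb (t : 'I_n -> R) (w : T) : R := \sum_(i < n) t i * U i w.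

Lemma measurable_lincomb t : measurable_fun setT (lincomb t).
Proof.
by apply: measurable_sum => i; apply: measurable_funM.
Qed.

Definition bounded_measurable (f : T -> R) : Prop :=
  measurable_fun setT f /\ exists K, forall w, `|f w| <= K.

Lemma bounded_measurable_mul f g : bounded_measurable f ->
  bounded_measurable g -> bounded_measurable (fun w => f w * g w).
Proof.
move=> [mf [K fK]] [mg [L gL]]; split; first exact: measurable_funM.
by exists (K * L) => w; rewrite normrM ler_pM.
Qed.

Lemma bounded_measurable_indic (A : set T) : measurable A ->
  bounded_measurable (\1_A).
Proof.
move=> mA; split; first exact: measurable_indic.
by exists 1 => w; rewrite indicE; case: (_ \in _); rewrite ?normr1 ?normr0.
Qed.

Lemma bounded_measurable_cos t th :
  bounded_measurable (fun w => cos (lincomb t w + th)).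
Proof.
split; last by exists 1 => w; exact: cos_max.
apply: (measurableT_comp (continuous_measurable_fun (@continuous_cos R))).
by apply: measurable_funD => //; exact: measurable_lincomb.
Qed.

Lemma integrable_mul_bounded Y f : ig Y -> bounded_measurable f ->
  ig (fun w => Y w * f w).
Proof.
move=> iY [mf [K fK]].
have mY := integrable_measurable iY.
apply: (integrable_le _ (integrable_scale K (integrable_normr iY))).
  exact: measurable_funM.
by move=> w; rewrite normrM mulrC ler_wpM2r.
Qed.

(** [W f] is orthogonal to every character of [U], the phase covering sine and cosine together. The
    known case is f = 1, the wanted one f = [\1_A]. *)
Definition annihilated (f : T -> R) : Prop :=
  bounded_measurable f /\
  forall t th, Ex (fun w => W w * f w * cos (lincomb t w + th)) = 0.

(* The multipliers form an algebra that contains the characters and is closed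
   under bounded pointwise limits, hence contains sgn (sin (t.U + a)), half
   spaces, and finally the indicators of all events generated by [U]. *)
Definition multiplier (m : T -> R) : Prop :=
  bounded_measurable m /\
  forall f, annihilated f -> annihilated (fun w => f w * m w).

Let iWf f t th : bounded_measurable f ->
  ig (fun w => W w * f w * cos (lincomb t w + th)).
Proof.
move=> bf; apply: integrable_mul_bounded; last exact: bounded_measurable_cos.
exact: integrable_mul_bounded.
Qed.

Lemma multiplier_cst k : multiplier (fun=> k).
Proof.
have bk : bounded_measurable (fun=> k) by split=> //; exists `|k|.
split=> // f [bf f0]; split; first exact: bounded_measurable_mul.
move=> t th; rewrite -[RHS](mulr0 k) -(f0 t th) -Ex_scale; last exact: iWf.
by apply: eq_Rintegral => w _; ring.
Qed.

Lemma multiplier_add m1 m2 : multiplier m1 -> multiplier m2 ->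
  multiplier (fun w => m1 w + m2 w).
Proof.
move=> [b1 h1] [b2 h2]; split.
  have [[? [K1 k1]] [? [K2 k2]]] := (b1, b2); split;
    first exact: measurable_funD.
  by exists (K1 + K2) => w; rewrite (le_trans (ler_normD _ _))// lerD.
move=> f Gf; have [bf1 f1] := h1 f Gf; have [bf2 f2] := h2 f Gf.
split.
  have [[? [K1 k1]] [? [K2 k2]]] := (bf1, bf2).
  split; first by under eq_fun do rewrite mulrDr; exact: measurable_funD.
  by exists (K1 + K2) => w; rewrite mulrDr (le_trans (ler_normD _ _))// lerD.
move=> t th; rewrite -[RHS](addr0 0) -{1}(f1 t th) -(f2 t th) -Ex_add;
  [|exact: iWf..].
by apply: eq_Rintegral => w _; ring.
Qed.

Lemma multiplier_mul m1 m2 : multiplier m1 -> multiplier m2 ->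
  multiplier (fun w => m1 w * m2 w).
Proof.
move=> [b1 h1] [b2 h2]; split; first exact: bounded_measurable_mul.
by move=> f /h1/h2; under eq_fun do rewrite -mulrA.
Qed.

Lemma multiplier_eq m1 m2 : m1 =1 m2 -> multiplier m1 -> multiplier m2.
Proof. by move=> /funext ->. Qed.

Lemma multiplier_lim (m_ : nat -> T -> R) m K :
  (forall k, multiplier (m_ k)) -> (forall k w, `|m_ k w| <= K) ->
  (forall w, m_ k w @[k --> \oo] --> m w) -> multiplier m.
Proof.
move=> mm mK cm.
have bm : bounded_measurable m.
  split.
    apply: (measurable_fun_cvg (h := m_)) => //.
    by move=> k; have [[]] := mm k.
  exists K => w; apply: (@cvgr_to_le _ \oo _ _ (fun k => `|m_ k w|)).
    exact: cvg_norm (cm w).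
  by apply: nearW => k; exact: mK.
split=> // f Gf; have [bf _] := Gf; split; first exact: bounded_measurable_mul.
move=> t th; have bc := bounded_measurable_cos t th.
have ig0 : ig (fun w => K * `|W w * f w * cos (lincomb t w + th)|).
  by apply: integrable_scale; apply: integrable_normr; exact: iWf.
have mk k : measurable_fun setT
    (fun w => W w * (f w * m_ k w) * cos (lincomb t w + th)).
  apply: integrable_measurable; apply: iWf.
  by apply: bounded_measurable_mul => //; have [] := mm k.
have ck w : W w * (f w * m_ k w) * cos (lincomb t w + th) @[k --> \oo] -->
    W w * (f w * m w) * cos (lincomb t w + th).
  by apply: cvgMl; apply: cvgMr; apply: cvgMr; exact: cm.
have dk k w : `|W w * (f w * m_ k w) * cos (lincomb t w + th)| <=
    K * `|W w * f w * cos (lincomb t w + th)|.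
  rewrite (_ : _ * _ = m_ k w * (W w * f w * cos (lincomb t w + th))).
    by rewrite normrM ler_wpM2r.
  by ring.
have [_] := Ex_dominated mk ck ig0 dk.
have h k : Ex (fun w => W w * (f w * m_ k w) * cos (lincomb t w + th)) = 0.
  by have [_ h] := mm k; have [_ ->] := h f Gf.
under eq_fun do rewrite h.
by move/cvg_lim => <- //; rewrite lim_cst.
Qed.

(** The product-to-sum formula: a product of two characters is half the sum of the characters with
    frequencies t + s and t - s, both covered by the hypothesis on f. *)
Lemma multiplier_cos t th : multiplier (fun w => cos (lincomb t w + th)).
Proof.
split; first exact: bounded_measurable_cos.
move=> f [bf f0]; split.
  by apply: bounded_measurable_mul => //; exact: bounded_measurable_cos.
move=> s eta.
have lD w : lincomb (fun i => t i + s i) w = lincomb t w + lincomb s w.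
  by rewrite /lincomb -big_split/=; apply: eq_bigr => i _; rewrite mulrDl.
have lB w : lincomb (fun i => t i - s i) w = lincomb t w - lincomb s w.
  by rewrite /lincomb -sumrB; apply: eq_bigr => i _; rewrite mulrBl.
have := f0 (fun i => t i + s i) (th + eta).
have := f0 (fun i => t i - s i) (th - eta).
move=> h1 h2; transitivity (2^-1 * (0 + 0) : R); last by rewrite addr0 mulr0.
rewrite -{1}h1 -h2 -Ex_add; [|exact: iWf..].
rewrite -Ex_scale; last by apply: integrable_add; exact: iWf.
apply: eq_Rintegral => w _; rewrite lD lB.
rewrite (_ : lincomb t w - lincomb s w + (th - eta) =
  (lincomb t w + th) - (lincomb s w + eta)); last by ring.
rewrite (_ : lincomb t w + lincomb s w + (th + eta) =
  (lincomb t w + th) + (lincomb s w + eta)); last by ring.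
by move: (_ + th) (_ + eta) => A B; rewrite cosB cosD; field.
Qed.

End trig_uniqueness.

(** * The sign and the half-line as limits of elementary functions *)

Section sign_iteration.
Context {R : realType}.

(* A polynomial, so that iterating it stays inside an algebra of functions. *)
Definition sgn_step (s : R) : R := 2^-1 * (3 * s - s * (s * s)).

Lemma sgn_stepN s : sgn_step (- s) = - sgn_step s.
Proof. by rewrite /sgn_step; ring. Qed.

Lemma iter_sgn_stepN k s : iter k sgn_step (- s) = - iter k sgn_step s.
Proof. by elim: k => //= k ->; exact: sgn_stepN. Qed.

Lemma sgn_step_itv s : 0 <= s <= 1 -> s <= sgn_step s <= 1.
Proof.
move=> /andP[s0 s1]; rewrite /sgn_step.
have h1 : 0 <= s * ((1 - s) * (1 + s)) by rewrite !mulr_ge0//; lra.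
have h2 : 0 <= (1 - s) * (1 - s) * (s + 2).
  by rewrite mulr_ge0//; [rewrite -expr2 sqr_ge0|lra].
apply/andP; split; nra.
Qed.

Lemma iter_sgn_step_itv k s : 0 <= s <= 1 -> s <= iter k sgn_step s <= 1.
Proof.
move=> /andP[s0 s1]; elim: k => [|k /andP[h1 h2]] /=; first by rewrite lexx.
have : 0 <= iter k sgn_step s <= 1 by rewrite h2 (le_trans s0).
by move/sgn_step_itv => /andP[h3 ->]; rewrite (le_trans h1 h3).
Qed.

(** By oddness s may be taken in [0, 1], where the iterates increase to a fixed point of (3 s - s^3)
    / 2. The fixed points are -1, 0 and 1, and a limit above s > 0 can only be 1. *)
Lemma cvg_iter_sgn_step s : `|s| <= 1 ->
  iter k sgn_step s @[k --> \oo] --> Num.sg s.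
Proof.
wlog s0 : s / 0 <= s.
  move=> h; have [/h//|/ltW sn] := lerP 0 s.
  rewrite -normrN => /h; rewrite oppr_ge0 => /(_ sn).
  under eq_fun do rewrite iter_sgn_stepN.
  by rewrite sgrN => /cvgN; rewrite !opprK.
rewrite ger0_norm// => s1.
have s01 : 0 <= s <= 1 by rewrite s0.
have nd : nondecreasing_seq (fun k => iter k sgn_step s).
  apply/nondecreasing_seqP => k /=.
  have /andP[h1 h2] := iter_sgn_step_itv k s01.
  have : 0 <= iter k sgn_step s <= 1 by rewrite h2 (le_trans s0).
  by move/sgn_step_itv => /andP[].
have cv : cvgn (fun k => iter k sgn_step s).
  apply: nondecreasing_is_cvgn => //; exists 1 => _ [k _ <-].
  by have /andP[] := iter_sgn_step_itv k s01.
set l := limn (fun k => iter k sgn_step s) in cv *.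
have cl : iter k sgn_step s @[k --> \oo] --> l by [].
have [->|s_neq0] := eqVneq s 0.
  rewrite sgr0 (_ : (fun k => _) = cst 0); first exact: cvg_cst.
  apply/funext; elim=> //= k ->.
  by rewrite /sgn_step /cst/=; ring.
have sp : 0 < s by rewrite lt_def s_neq0.
have sl : s <= l.
  by apply: limr_ge => //; apply: nearW => k;
    have /andP[] := iter_sgn_step_itv k s01.
have : iter k.+1 sgn_step s @[k --> \oo] --> sgn_step l.
  rewrite /= /sgn_step; apply: cvgMr; apply: cvgB; first exact: cvgMr.
  by apply: cvgM => //; exact: cvgM.
have : iter k.+1 sgn_step s @[k --> \oo] --> l by rewrite (cvg_shiftS (fun k =>
  iter k sgn_step s)).
move=> c1 /(cvg_unique _ c1) => /(_ (@norm_hausdorff _ _)) lE.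
suff -> : Num.sg s = l by [].
rewrite gtr0_sg//.
have l0 : 0 < l by exact: lt_le_trans sl.
have : l * ((1 - l) * (1 + l)) = 0 by move: lE; rewrite /sgn_step; nra.
move/eqP; rewrite !mulf_eq0 gt_eqF//= => /orP[]/eqP; lra.
Qed.

Lemma iter_sgn_step_le1 k s : `|s| <= 1 -> `|iter k sgn_step s| <= 1.
Proof.
wlog s0 : s / 0 <= s.
  move=> h; have [/h//|/ltW sn] := lerP 0 s.
  by rewrite -normrN => /h; rewrite oppr_ge0 iter_sgn_stepN normrN => /(_ sn).
rewrite ger0_norm// => s1; have /andP[h1 h2] : s <= iter k sgn_step s <= 1.
  by apply: iter_sgn_step_itv; rewrite s0.
by rewrite ger0_norm// (le_trans s0).
Qed.

(** Rescaling defeats periodicity: for large k the argument lies in (-pi, pi), where sine has the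
    sign of its argument. *)
Lemma cvg_sg_sin (x : R) : Num.sg (sin (x / k.+1%:R)) @[k --> \oo] --> Num.sg x.
Proof.
wlog x0 : x / 0 <= x.
  move=> h; have [/h//|/ltW xn] := lerP 0 x.
  have := h (- x); rewrite oppr_ge0 => /(_ xn).
  under eq_fun do rewrite mulNr sinN sgrN.
  by rewrite sgrN => /cvgN; rewrite !opprK.
have [->|x_neq0] := eqVneq x 0.
  by under eq_fun do rewrite mul0r sin0; exact: cvg_cst.
have xp : 0 < x by rewrite lt_def x_neq0.
rewrite gtr0_sg//; apply: (@cvg_near_cst _ _ _ _ _ _).
near=> k; rewrite gtr0_sg// sin_gt0_pi// divr_gt0//=.
rewrite ltr_pdivrMr// mulrC -ltr_pdivrMr ?pi_gt0//.
apply: (@lt_le_trans _ _ k%:R); last by rewrite ler_nat.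
by near: k; exact: nbhs_infty_gtr.
Unshelve. all: end_near. Qed.

(** Without the shift, (1 + sg x) / 2 is 1/2 at x = 0; moving the argument slightly to the left
    gives the indicator of the open half-line. *)
Lemma cvg_sg_shift (x : R) :
  2^-1 * (1 + Num.sg (x - k.+1%:R^-1)) @[k --> \oo] --> ((0 < x)%R%:R : R).
Proof.
apply: (@cvg_near_cst _ _ _ _ _ _).
have [x0|x0] := ltP 0 x; near=> k.
  rewrite gtr0_sg; first by rewrite -[1 + 1]/2 mulVf.
  rewrite subr_gt0 invf_plt ?posrE//.
  apply: (@lt_le_trans _ _ k%:R); last by rewrite ler_nat.
  by near: k; exact: nbhs_infty_gtr.
rewrite ltr0_sg ?subrr ?mulr0//.
by rewrite subr_lt0 (le_lt_trans x0)// invr_gt0.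
Unshelve. all: end_near. Qed.

End sign_iteration.

(** * From characters to events generated by the variables *)

Section trig_uniqueness_sets.
Context {d} {T : measurableType d} {R : realType} (P : probability T R).
Local Notation Ex := (Rintegral P setT).
Local Notation ig Y := (P.-integrable setT (EFin \o Y)).
Variables (n : nat) (U : 'I_n -> T -> R) (W : T -> R).
Hypothesis mU : forall i, measurable_fun setT (U i).
Hypothesis iW : ig W.
Let mult := multiplier P U W.
Let lin := lincomb U.

Let mult_add := multiplier_add mU iW.
Let mult_mul := @multiplier_mul _ T R P n U W.
Let mult_cst := multiplier_cst mU iW.

Lemma multiplier_sgn m : mult m -> (forall w, `|m w| <= 1) ->
  mult (fun w => Num.sg (m w)).
Proof.
move=> mm m1; apply: (@multiplier_lim _ _ _ _ _ _ _ mU iW (fun k w => iter k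
  (@sgn_step R) (m w)) _ 1).
- elim=> [|k IH] //=.
  have h : mult (fun w => 2^-1 * (3 * iter k (@sgn_step R) (m w) + -1 *
     (iter k (@sgn_step R) (m w) * (iter k (@sgn_step R) (m w) * iter k
       (@sgn_step R) (m w))))).
    apply: mult_mul => //; apply: mult_add; first exact: mult_mul.
    by apply: mult_mul => //; apply: mult_mul => //; exact: mult_mul.
  by apply: multiplier_eq h => w; rewrite /sgn_step mulN1r.
- by move=> k w; exact: iter_sgn_step_le1.
- by move=> w; exact: cvg_iter_sgn_step.
Qed.

Lemma multiplier_sgn_lincomb t a : mult (fun w => Num.sg (lin t w + a)).
Proof.
apply: (@multiplier_lim _ _ _ _ _ _ _ mU iW (fun k w => Num.sg (sin ((lin t w +
  a) / k.+1%:R))) _ 1).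
- move=> k; apply: multiplier_sgn; last by move=> w; exact: sin_max.
  have h := multiplier_cos mU iW (fun i => t i / k.+1%:R) (a / k.+1%:R - pi /
    2).
  apply: multiplier_eq h => w.
  rewrite (_ : lincomb _ _ _ = lin t w / k.+1%:R); last first.
    by rewrite /lin /lincomb mulr_suml; apply: eq_bigr => i _; rewrite mulrAC.
  by rewrite addrA -mulrDl cosBpihalf.
- by move=> k w; rewrite normr_sg; case: (_ != 0); rewrite ?normr1 ?normr0.
- by move=> w; exact: cvg_sg_sin.
Qed.

Definition multiplier_set (A : set T) : Prop :=
  measurable A /\ mult (\1_A).

Lemma multiplier_set_gt i a : multiplier_set [set w | a < U i w].
Proof.
split.
  rewrite (_ : [set w | _] = U i @^-1` `]a, +oo[%classic); last first.
    by apply/seteqP; split=> w /=; rewrite in_itv/= andbT.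
  by rewrite -[X in measurable X]setTI; apply: mU.
apply: (@multiplier_lim _ _ _ _ _ _ _ mU iW
   (fun k w => 2^-1 * (1 + Num.sg (lin (fun j => (j == i)%:R) w + (- a -
     k.+1%:R^-1)))) _ 1).
- move=> k; apply: mult_mul => //; apply: mult_add => //.
  exact: multiplier_sgn_lincomb.
- move=> k w; case: sgrP => _; rewrite ?addr0 ?subrr ?mulr0 ?normr0//.
    by rewrite mulr1 ger0_norm ?invr_ge0// invf_le1// ler1n.
  by rewrite -[1 + 1]/2 mulVf// normr1.
- move=> w; have := @cvg_sg_shift R (U i w - a).
  rewrite subr_gt0 indicE mem_setE/= /in_mem/=.
  rewrite (_ : (fun k => 2^-1 * _) = (fun k =>
    2^-1 * (1 + Num.sg (lin (fun j => (j == i)%:R) w + (- a - k.+1%:R^-1)))))//.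
  apply/funext => k; congr (_ * (_ + Num.sg _)); rewrite addrA;
    congr (_ - _ - _).
  rewrite /lin /lincomb (bigD1 i)//= eqxx mul1r big1 ?addr0// => j /negbTE ->.
  by rewrite mul0r.
Qed.

(** Countable unions go through complements: the indicator of a countable intersection is the
    bounded pointwise limit of finite products of indicators. *)
Lemma sigma_algebra_multiplier_set : sigma_algebra setT multiplier_set.
Proof.
have setC A : multiplier_set A -> multiplier_set (~` A).
  move=> [mA hA]; split; first exact: measurableC.
  have h : mult (fun w => 1 + -1 * \1_A w) by apply: mult_add => //;
    exact: mult_mul.
  apply: multiplier_eq h => w; rewrite !indicE in_setC mulN1r.
  by case: (w \in A); rewrite ?subrr ?subr0.
split.
- by split=> //; apply: multiplier_eq (mult_cst 0) => w; rewrite indic0.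
- by move=> A /setC; rewrite setTD.
move=> F hF; split; first by apply: bigcup_measurable => k _; have [] := hF k.
rewrite -[\bigcup_k _]setCK setC_bigcup.
have [] // := setC (\bigcap_k ~` F k).
split; first by apply: bigcap_measurable => //= k _;
  have [/measurableC] := hF k.
pose p k w := \prod_(i < k) \1_(~` F i) w : R.
apply: (@multiplier_lim _ _ _ _ _ _ _ mU iW p _ 1).
- elim=> [|k IH].
    by apply: multiplier_eq (mult_cst 1) => w; rewrite /p big_ord0.
  have h : mult (fun w => p k w * \1_(~` F k) w).
    by apply: mult_mul => //; have [] := setC _ (hF k).
  by apply: multiplier_eq h => w; rewrite /p big_ord_recr.
- move=> k w; rewrite /p; elim: k => [|k IH]; first by rewrite big_ord0 normr1.
  rewrite big_ord_recr/= normrM mulr_ile1// indicE.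
  by case: (_ \in _); rewrite ?normr1 ?normr0.
- move=> w; rewrite indicE; have [wI|wI] := boolP (w \in \bigcap_k ~` F k).
    rewrite (_ : (fun k => p k w) = cst 1); first exact: cvg_cst.
    apply/funext => k; rewrite /p big1// => i _; rewrite indicE.
    by rewrite mem_set//; move/set_mem: wI; exact.
  have [k Fk] : exists k, F k w.
    apply: contrapT => nF; move/negP: wI; apply; apply/mem_set => k _ Fk.
    by apply: nF; exists k.
  apply: (@cvg_near_cst _ _ _ _ _ _); near=> j.
  have kj : (k < j)%N by near: j; exact: nbhs_infty_gt.
  rewrite /p (bigD1 (Ordinal kj))//= indicE memNset ?mul0r//.
Unshelve. all: end_near. Qed.

Lemma Ex_mul_indic_eq0 (A : set T) :
  (forall t th, Ex (fun w => W w * cos (lincomb U t w + th)) = 0) ->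
  multiplier_set A -> Ex (fun w => W w * \1_A w) = 0.
Proof.
move=> h [_ [_ hA]].
have G1 : annihilated P U W (fun=> 1).
  split; first by split=> //; exists 1 => w; rewrite normr1.
  by move=> t th; rewrite -[RHS](h t th); apply: eq_Rintegral => w _;
    rewrite mulr1.
(* At frequency 0 and phase 0 the remaining character is the constant 1. *)
have [_ /(_ (fun=> 0) 0)] := hA _ G1.
move=> <-; apply: eq_Rintegral => w _.
rewrite /lincomb big1 ?addr0 ?cos0 ?mulr1 ?mul1r// => i _.
by rewrite mul0r.
Qed.

End trig_uniqueness_sets.

(** * Gaussian spaces *)

Lemma cos_lipschitz (R : realType) (x y : R) : `|cos x - cos y| <= `|x - y|.
Proof.
wlog xy : x y / y <= x.
  move=> h; case: (leP y x) => [yx|/ltW xy]; first exact: h.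
  by rewrite distrC [leRHS]distrC; exact: h.
have [->|/eqP yx] := eqVneq x y; first by rewrite !subrr.
have lt_yx : y < x by rewrite lt_def xy andbT; exact/eqP.
have [c _ ->] := @MVT R cos (fun z => - sin z) y x lt_yx
  (fun z _ => is_derive_cos z) (continuous_subspaceT (@continuous_cos R)).
by rewrite normrM normrN ler_piMl// sin_max.
Qed.

Section gaussian_space.
Context {d} {T : measurableType d} {R : realType} (P : probability T R).
Local Notation Ex := (Rintegral P setT).
Local Notation ig Y := (P.-integrable setT (EFin \o Y)).
Local Notation sq := (square_integrable P).
Local Notation nrm := (norm2 P).
Local Notation ip := (inner P).
Variables (X : Type) (u : X -> T -> R).
Hypothesis hu : forall (n : nat) (x : 'I_n -> X) (t : 'I_n -> R),
    gaussian_rv P (fun w => \sum_(i < n) t i * u (x i) w).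

Definition finite_span (S : T -> R) : Prop :=
  exists n (x : 'I_n -> X) (t : 'I_n -> R),
    S = fun w => \sum_(i < n) t i * u (x i) w.

Lemma finite_span_add S1 S2 : finite_span S1 -> finite_span S2 ->
  finite_span (fun w => S1 w + S2 w).
Proof.
move=> [n1 [x1 [t1 ->]]] [n2 [x2 [t2 ->]]].
exists (n1 + n2)%N,
  (fun i => match fintype.split i with inl j => x1 j | inr j => x2 j end),
  (fun i => match fintype.split i with inl j => t1 j | inr j => t2 j end).
apply/funext => w; rewrite big_split_ord/=; congr (_ + _);
  apply: eq_bigr => i _.
  by rewrite (unsplitK (inl _ i)).
by rewrite (unsplitK (inr _ i)).
Qed.

Lemma finite_span_scale k S : finite_span S -> finite_span (fun w => k * S w).
Proof.
move=> [n [x [t ->]]]; exists n, x, (fun i => k * t i).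
by apply/funext => w; rewrite mulr_sumr; apply: eq_bigr => i _; rewrite mulrA.
Qed.

Lemma finite_span0 : finite_span (fun=> 0).
Proof.
exists 0%N, (fun i : 'I_0 => False_rect X (notF (valP i))), (fun=> 0).
by apply/funext => w; rewrite big_ord0.
Qed.

Lemma finite_span_gen x : finite_span (u x).
Proof.
exists 1%N, (fun=> x), (fun=> 1).
by apply/funext => w; rewrite big_ord1 mul1r.
Qed.

Lemma finite_span_gaussian S : finite_span S -> gaussian_rv P S.
Proof. by move=> [n [x [t ->]]]; exact: hu. Qed.

Lemma finite_span_sq S : finite_span S -> sq S.
Proof. by move/finite_span_gaussian/gaussian_rv_moments => []. Qed.

Definition gspace (Y : T -> R) : Prop :=
  sq Y /\ forall e, 0 < e -> exists2 S, finite_span S & nrm (fun w => Y w - S w)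
    < e.

Lemma gspace_sq Y : gspace Y -> sq Y. Proof. by case. Qed.

Lemma gspace_span S : finite_span S -> gspace S.
Proof.
move=> sS; split; first exact: finite_span_sq.
move=> e e0; exists S => //.
under [X in nrm X]eq_fun do rewrite subrr.
by rewrite /norm2 /inner; under eq_Rintegral do rewrite mul0r;
  rewrite Ex_cst sqrtr0.
Qed.

Lemma gspace_closed Y : sq Y ->
  (forall e, 0 < e -> exists2 Z, gspace Z & nrm (fun w => Y w - Z w) < e) ->
    gspace Y.
Proof.
move=> sY h; split=> // e e0; have e20 : 0 < e / 2 by rewrite divr_gt0.
have [Z [sZ hZ] YZ] := h _ e20; have [S sS ZS] := hZ _ e20.
exists S => //; have := norm2_triangle (square_integrable_sub sY sZ)
  (square_integrable_sub sZ (finite_span_sq sS)).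
under [X in nrm X]eq_fun do rewrite addrA subrK.
by move=> /le_lt_trans; apply; rewrite [ltRHS](splitr e) ltrD.
Qed.

Lemma gspace_add Y Z : gspace Y -> gspace Z -> gspace (fun w => Y w + Z w).
Proof.
move=> [sY hY] [sZ hZ]; split; first exact: square_integrable_add.
move=> e e0; have e20 : 0 < e / 2 by rewrite divr_gt0.
have [S1 sS1 YS1] := hY _ e20; have [S2 sS2 ZS2] := hZ _ e20.
exists (fun w => S1 w + S2 w); first exact: finite_span_add.
have := norm2_triangle (square_integrable_sub sY (finite_span_sq sS1))
  (square_integrable_sub sZ (finite_span_sq sS2)).
under [X in nrm X]eq_fun do rewrite addrACA -opprD.
by move=> /le_lt_trans; apply; rewrite [ltRHS](splitr e) ltrD.
Qed.

Lemma gspace_scale k Y : gspace Y -> gspace (fun w => k * Y w).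
Proof.
move=> [sY hY]; split; first exact: square_integrable_scale.
move=> e e0; have ek : 0 < e / (`|k| + 1) by rewrite divr_gt0// ltr_wpDl.
have [S sS YS] := hY _ ek.
exists (fun w => k * S w); first exact: finite_span_scale.
under [X in nrm X]eq_fun do rewrite -mulrBr.
rewrite norm2Z; last exact: square_integrable_sub (finite_span_sq sS).
move: YS; rewrite ltr_pdivlMr ?ltr_wpDl// => YS.
apply: le_lt_trans YS; rewrite mulrC ler_wpM2l ?norm2_ge0//.
by rewrite lerDl.
Qed.

Lemma gspace_sub Y Z : gspace Y -> gspace Z -> gspace (fun w => Y w - Z w).
Proof.
move=> gY gZ; have := gspace_add gY (gspace_scale (-1) gZ).
by congr gspace; apply/funext => w; rewrite mulN1r.
Qed.

Lemma gspace_sum (I : Type) (r : seq I) (F : I -> T -> R) :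
  (forall i, gspace (F i)) -> gspace (fun w => \sum_(i <- r) F i w).
Proof.
move=> iF; elim: r => [|a r IH].
  have := gspace_span finite_span0; congr gspace.
  by apply/funext => w; rewrite big_nil.
have := gspace_add (iF a) IH; congr gspace.
by apply/funext => w; rewrite big_cons.
Qed.

Definition var (Y : T -> R) := ip Y Y - Ex Y ^+ 2.

(** L2 continuity of every quantity in the cosine identity. Each follows from an estimate by a
    multiple of ||Y - S_k||, except the square norm, which is read off from the expansion of ||Y -
    S_k||^2. *)
Lemma norm2_cvg0 (S_ : nat -> T -> R) Y : sq Y -> (forall k, sq (S_ k)) ->
  nrm (fun w => Y w - S_ k w) @[k --> \oo] --> 0 ->
  [/\ Ex (S_ k) @[k --> \oo] --> Ex Y,
      (forall Z, sq Z -> ip (S_ k) Z @[k --> \oo] --> ip Y Z),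
      ip (S_ k) (S_ k) @[k --> \oo] --> ip Y Y &
      forall th, Ex (fun w => cos (S_ k w + th)) @[k --> \oo] -->
        Ex (fun w => cos (Y w + th))].
Proof.
move=> sY sS cv.
have sD k : sq (fun w => Y w - S_ k w) by exact: square_integrable_sub.
have squeeze (a_ : nat -> R) a C : (forall k, `|a - a_ k| <= nrm (fun w => Y w -
  S_ k w) * C) ->
    a_ k @[k --> \oo] --> a.
  move=> h; suff : `|a_ k - a| @[k --> \oo] --> (0 : R) by
    move/norm_cvg0/subr_cvg0.
  have cvC : nrm (fun w => Y w - S_ k w) * C @[k --> \oo] --> 0.
    by rewrite -[X in _ --> X](mul0r C); exact: cvgMl.
  apply: (@squeeze_cvgr _ _ _ _ (cst 0) _ _ _ _ _ cvC); last exact: cvg_cst.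
  by apply: nearW => k; rewrite normr_ge0 -normrN opprB h.
have cvip Z : sq Z -> ip (S_ k) Z @[k --> \oo] --> ip Y Z.
  move=> sZ; apply: (squeeze _ _ (nrm Z)) => k.
  by rewrite -innerBl//; exact: norm_inner_le.
have cvE : Ex (S_ k) @[k --> \oo] --> Ex Y.
  have := cvip _ (square_integrable_cst P 1).
  by rewrite inner1r; under eq_fun do rewrite inner1r.
have iD k := square_integrable_integrable (sD k).
split=> //.
- have : 2 * ip (S_ k) Y - ip Y Y + nrm (fun w => Y w - S_ k w) ^+ 2 @[k -->
  \oo] -->
      2 * ip Y Y - ip Y Y + 0 ^+ 2.
    apply: cvgD; first by apply: cvgB; [apply: cvgMr;
      exact: cvip|exact: cvg_cst].
    exact: cvgM.
  rewrite expr0n addr0 mulr2n mulrDl mul1r addrK.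
  apply: cvg_trans; apply: near_eq_cvg; apply: nearW => k.
  by rewrite sqr_norm2 inner_sqrB// (innerC _ Y); ring.
- move=> th; apply: (squeeze _ _ 1) => k.
  have ic (Z : T -> R) : measurable_fun setT Z -> ig (fun w => cos (Z w + th)).
    move=> mZ; apply: (@integrable_bounded _ _ _ _ _ 1); last by move=> w;
      exact: cos_max.
    apply: (measurableT_comp (continuous_measurable_fun (@continuous_cos R))).
    exact: measurable_funD.
  have [mY _] := sY; have [mS _] := sS k.
  rewrite -Ex_sub; [|exact: ic..].
  have i := integrable_sub (ic _ mY) (ic _ mS).
  rewrite mulr1; apply: le_trans (le_normr_Ex i) _.
  apply: le_trans (Ex_norm_le (sD k)).
  apply: le_Ex; [exact: integrable_normr|exact: integrable_normr|].
  by move=> w; rewrite (le_trans (cos_lipschitz _ _))// opprD addrACA subrr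
    addr0.
Qed.

Lemma gspace_seq Y : gspace Y -> exists S_ : nat -> T -> R,
  (forall k, finite_span (S_ k)) /\
  nrm (fun w => Y w - S_ k w) @[k --> \oo] --> 0.
Proof.
move=> [sY hY].
have h k : exists S, finite_span S /\ nrm (fun w => Y w - S w) < k.+1%:R^-1.
  have [|S ? ?] := hY k.+1%:R^-1; first by rewrite invr_gt0.
  by exists S.
have [S_ hS] := choice h.
exists S_; split; first by move=> k; have [] := hS k.
apply: (@squeeze_cvgr _ _ _ _ (cst 0) _ _ _ _ _ cvg_harmonic);
  last exact: cvg_cst.
by apply: nearW => k; rewrite norm2_ge0/= ltW//; have [] := hS k.
Qed.

(** The identity holds on finite combinations and both of its sides are L2 continuous. *)
Lemma gspace_cos Y th : gspace Y ->
  Ex (fun w => cos (Y w + th)) = expR (- var Y / 2) * cos (Ex Y + th).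
Proof.
move=> gY; have [S_ [sS cv]] := gspace_seq gY.
have sq_S k := finite_span_sq (sS k).
have [cE _ cip ccos] := norm2_cvg0 (gspace_sq gY) sq_S cv.
apply: (cvg_unique _ (ccos th)) => //.
have h k : Ex (fun w => cos (S_ k w + th)) =
    expR (- (ip (S_ k) (S_ k) - Ex (S_ k) * Ex (S_ k)) / 2) * cos (Ex (S_ k) +
      th).
  have [_ [m [s [_ _ -> -> ->]]]] := gaussian_rv_moments (finite_span_gaussian
    (sS k)).
  by rewrite -expr2 addrAC subrr add0r.
rewrite (funext h); apply: cvgM.
  apply: (@continuous_cvg _ _ _ _ _ _ expR); first exact: continuous_expR.
  apply: cvgMl; apply: cvgN; apply: cvgB => //.
  by rewrite expr2; exact: cvgM.
apply: (@continuous_cvg _ _ _ _ _ _ (@cos R)); first exact: continuous_cos.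
by apply: cvgD => //; exact: cvg_cst.
Qed.

End gaussian_space.

(** * Anticoncentration and a weak criterion for membership *)

Section gaussian_space_theory.
Context {d} {T : measurableType d} {R : realType} (P : probability T R).
Local Notation Ex := (Rintegral P setT).
Local Notation ig Y := (P.-integrable setT (EFin \o Y)).
Local Notation sq := (square_integrable P).
Local Notation nrm := (norm2 P).
Local Notation ip := (inner P).
Variables (X : Type) (u : X -> T -> R).
Hypothesis hu : forall (n : nat) (x : 'I_n -> X) (t : 'I_n -> R),
    gaussian_rv P (fun w => \sum_(i < n) t i * u (x i) w).
Local Notation gspace := (gspace P u).
Local Notation var := (var P).

Lemma measurable_gt_set (Y : T -> R) a : measurable_fun setT Y ->
  measurable [set w | a < Y w].
Proof.
move=> mY; rewrite (_ : [set w | _] = Y @^-1` `]a, +oo[%classic); last first.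
  by apply/seteqP; split=> w /=; rewrite in_itv/= andbT.
by rewrite -[X in measurable X]setTI; apply: mY.
Qed.

Lemma varE Y : sq Y -> var Y = ip (fun w => Y w - Ex Y) (fun w => Y w - Ex Y).
Proof.
move=> sY; rewrite inner_sqrB//; last exact: square_integrable_cst.
rewrite (_ : (fun=> Ex Y) = (fun w => Ex Y * (fun=> 1) w)); last first.
  by apply/funext => w; rewrite mulr1.
have s1 := square_integrable_cst P 1.
rewrite innerZr// inner1r innerZl ?innerZr//;
  last exact: square_integrable_scale.
by rewrite inner1r Ex_cst /var; ring.
Qed.

Lemma var_ge0 Y : sq Y -> 0 <= var Y.
Proof. by move=> sY; rewrite varE// inner_ge0. Qed.

Lemma varZ k Y : sq Y -> var (fun w => k * Y w) = k ^+ 2 * var Y.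
Proof.
move=> sY; rewrite /var innerZl ?innerZr//; last exact: square_integrable_scale.
by rewrite Ex_scale; [ring|exact: square_integrable_integrable].
Qed.

(* |E exp(itY)| = exp(- t^2 var Y / 2) is close to 1 at the scale [1 / dl] if
  [Y]
   is mostly below [dl]; this replaces Fernique's theorem. *)
Lemma gspace_anticoncentration Y dl : gspace Y -> 0 < dl ->
  fine (P [set w | dl < `|Y w|]) <= 8^-1 -> nrm Y <= 10 * dl.
Proof.
move=> gY dl0 hA; set A := [set w | dl < `|Y w|] in hA.
have sY := gspace_sq gY; have [mY _] := sY.
have mA : measurable A by apply: measurable_gt_set; exact: measurableT_comp.
(* For t <= t0 one has |t Y| <= 1/4 off [A], hence cos (t Y) >= 3/4 there; on [A] the loss is at
   most 2, so in expectation 3/4 - 2/8 = 1/2 remains. *)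
pose t0 := (4 * dl)^-1.
have t00 : 0 < t0 by rewrite invr_gt0 mulr_gt0.
have t0dl : t0 * dl = 4^-1 by rewrite /t0; field; rewrite gt_eqF.
have h t : 0 <= t <= t0 ->
    2^-1 <= expR (- (t ^+ 2 * var Y) / 2) * cos (t * Ex Y).
  move=> /andP[tp tt].
  have gt := gspace_scale (P := P) hu t gY; have st := gspace_sq gt;
    have [mt _] := st.
  have := gspace_cos hu 0 gt.
  rewrite varZ// Ex_scale; last exact: square_integrable_integrable.
  rewrite addr0 => <-.
  have ic : ig (fun w => cos (t * Y w + 0)).
    apply: (@integrable_bounded _ _ _ _ _ 1); last by move=> w; exact: cos_max.
    apply: (measurableT_comp (continuous_measurable_fun (@continuous_cos R))).
    exact: measurable_funD.
  have iA : ig (\1_A : T -> R).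
    apply: (@integrable_bounded _ _ _ _ _ 1); first exact: measurable_indic.
    by move=> w; rewrite indicE; case: (_ \in _); rewrite ?normr1 ?normr0.
  have i2 := integrable_sub (integrable_cst P (1 - 4^-1)) (integrable_scale 2
    iA).
  have : Ex (fun w => (1 - 4^-1) - 2 * \1_A w) <= Ex (fun w => cos (t * Y w +
    0)).
    apply: le_Ex => // w; rewrite addr0.
    have [wA|wA] := boolP (w \in A).
      rewrite indicE wA mulr1; have := cos_geN1 (t * Y w); lra.
    rewrite indicE (negbTE wA) mulr0 subr0.
    have := cos_lipschitz 0 (t * Y w); rewrite cos0 sub0r normrN => hc.
    have hY : `|Y w| <= dl by rewrite leNgt; apply/negP => hY; move/negP: wA;
      apply; rewrite inE.
    have : `|t * Y w| <= 4^-1.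
      by rewrite normrM (ger0_norm tp) -t0dl ler_pM.
    move: hc; rewrite ler_norml; lra.
  rewrite Ex_sub//; last by exact: integrable_scale.
    rewrite Ex_cst Ex_scale// Ex_indic//; lra.
  exact: integrable_cst.
have cos_le1' t : expR (- (t ^+ 2 * var Y) / 2) <= 1.
  rewrite -expR0 ler_expR mulNr oppr_le0 divr_ge0// mulr_ge0 ?sqr_ge0//.
  exact: var_ge0.
(* For v = t0^2 var Y / 2, the bound 1/2 <= exp (-v) gives 1 + v <= exp v <= 2. Hence var Y <= 32
   dl^2. *)
have hv : t0 ^+ 2 * var Y / 2 <= 1.
  have := h t0; rewrite lexx ltW//= => /(_ isT) h0.
  have h1 : 2^-1 <= expR (- (t0 ^+ 2 * var Y / 2)).
    rewrite -mulNr; apply: le_trans h0 _.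
    by rewrite ler_piMr ?expR_ge0// cos_le1.
  have h2 := expR_ge1Dx (t0 ^+ 2 * var Y / 2).
  by move: h1; rewrite expRN lef_pV2 ?posrE ?expR_gt0//; lra.
have hm : `|Ex Y| <= 8 * dl.
  rewrite leNgt; apply/negP => m8.
  have mp : 0 < `|Ex Y| by apply: le_lt_trans m8; rewrite mulr_ge0// ltW.
  (* A mean above 8 dl would put this frequency below t0, since pi / 2 <= 2; there the cosine of t E
     Y vanishes, against the lower bound 1/2. *)
  pose t := pi / 2 / `|Ex Y|.
  have tp : 0 <= t <= t0.
    rewrite divr_ge0 ?divr_ge0 ?pi_ge0//= ler_pdivrMr//.
    apply: (@le_trans _ _ 2); first exact/ltW/pihalf_lt2.
    by rewrite /t0 mulrC ler_pdivlMr ?mulr_gt0//; lra.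
  have := h t tp.
  suff -> : cos (t * Ex Y) = 0 by rewrite mulr0 leNgt invr_gt0 ltr0n.
  have [E0|E0] := leP 0 (Ex Y).
    by rewrite /t ger0_norm// divfK ?cos_pihalf// -normr_gt0.
  rewrite -cosN -mulrN /t ltr0_norm// divfK ?cos_pihalf//.
  by rewrite oppr_eq0 lt_eqF.
(* The second moment is at most (32 + 64) dl^2 <= (10 dl)^2. *)
rewrite -ler_sqr ?nnegrE ?norm2_ge0 ?mulr_ge0 ?(ltW dl0)// sqr_norm2.
have -> : ip Y Y = var Y + Ex Y ^+ 2 by rewrite /var subrK.
have v32 : var Y <= 32 * dl ^+ 2.
  move: hv; rewrite /t0 exprVn ler_pdivrMr// mul1r mulrC ler_pdivrMr ?exprn_gt0
    ?mulr_gt0//.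
  by rewrite exprMn; lra.
have m64 : Ex Y ^+ 2 <= 64 * dl ^+ 2.
  rewrite -[Ex Y ^+ 2]real_normK ?num_real// (_ : 64 = 8 ^+ 2); last by ring.
  by rewrite -exprMn ler_sqr ?nnegrE ?mulr_ge0 ?(ltW dl0).
rewrite exprMn; have := sqr_ge0 dl; lra.
Qed.

(* For [e = Y - S] with [S] nearly minimizing the distance from [Y] to the span,
   [e] is nearly orthogonal to the span; the hypothesis makes it nearly
   orthogonal to [Y], hence to itself. *)
Lemma gspace_weakly_closed Y C : sq Y -> 0 <= C ->
  (forall e eta, sq e -> 0 <= eta -> (forall x, `|ip e (u x)| <= eta * nrm (u
    x)) ->
     `|ip e Y| <= C * eta) -> gspace Y.
Proof.
move=> sY C0 hY; split=> // e e0.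
pose E := [set ip (fun w => Y w - S w) (fun w => Y w - S w) | S in finite_span
  u].
have Elb : lbound E 0 by move=> _ [S _ <-]; exact: inner_ge0.
have E0 : E (ip Y Y).
  exists (fun=> 0); first exact: finite_span0.
  by under eq_fun do rewrite subr0.
have hE : has_inf E by split; [exists (ip Y Y)|exists 0].
(* The final estimate is ||e'||^2 = <e', Y> - <e', S> <= C eta + eta ||S|| with ||S|| <= 2 ||Y|| +
   1, that is, at most eta K; [eta] is chosen to make this smaller than e^2. *)
pose K := C + 2 * nrm Y + 1.
have K0 : 0 < K by rewrite ltr_wpDl// addr_ge0// mulr_ge0// norm2_ge0.
pose eta := Num.min 1 (e ^+ 2 / (2 * K)).
have eta0 : 0 < eta by rewrite lt_min ltr01 divr_gt0 ?exprn_gt0// mulr_gt0.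
have eta1 : eta <= 1 by rewrite ge_min lexx.
have etaK : eta * K <= e ^+ 2 / 2.
  apply: (@le_trans _ _ (e ^+ 2 / (2 * K) * K)).
    by rewrite ler_wpM2r ?(ltW K0)// ge_min lexx orbT.
  by rewrite le_eqVlt; apply/orP; left; apply/eqP; field; rewrite gt_eqF.
have [_ [S sS <-]] := inf_adherent (exprn_gt0 2 eta0) hE.
set e' := (fun w => Y w - S w) => eS.
have sqS := finite_span_sq hu sS.
have se' : sq e' by exact: square_integrable_sub.
have orth v : finite_span u v -> `|ip e' v| <= eta * nrm v.
  move=> sv; have sqv := finite_span_sq hu sv.
  rewrite -ler_sqr ?nnegrE ?mulr_ge0 ?norm2_ge0 ?(ltW eta0)//.
  rewrite real_normK ?num_real// exprMn sqr_norm2 -sqrrN.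
  (* Replacing S by S + t v lowers the squared distance by at most eta^2, so eta^2 - 2 t <e', v> +
     t^2 ||v||^2 >= 0 for every t. *)
  apply: discriminant_le => t.
  have : E (ip (fun w => e' w - t * v w) (fun w => e' w - t * v w)).
    exists (fun w => S w + t * v w).
      by apply: finite_span_add => //; exact: finite_span_scale.
    by under eq_fun do rewrite opprD addrA.
  move/(ge_inf (ex_intro _ 0 Elb)).
  have stv := square_integrable_scale t sqv.
  rewrite inner_sqrB// innerZr// innerZl// innerZr//.
  move: eS; set i := inf E; lra.
have h1 : `|ip e' Y| <= C * eta.
  apply: hY => //; first exact: ltW.
  by move=> x; apply: orth; exact: finite_span_gen.
have h2 := orth _ sS.
have Ne : ip e' e' = ip e' Y - ip e' S by rewrite -innerBr.
have iE : inf E <= ip Y Y by apply: ge_inf => //; exists 0.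
have ne : nrm e' <= nrm Y + eta.
  rewrite -ler_sqr ?nnegrE ?addr_ge0 ?norm2_ge0 ?(ltW eta0)//.
  rewrite sqr_norm2 sqrrD sqr_norm2 mulr2n.
  have : 0 <= nrm Y * eta by rewrite mulr_ge0 ?norm2_ge0 ?(ltW eta0).
  by move: eS iE; lra.
have nS : nrm S <= nrm Y + nrm e'.
  have := norm2_triangle sY (square_integrable_scale (-1) se').
  rewrite norm2Z// normrN normr1 mul1r.
  by under [X in nrm X <= _ -> _]eq_fun do rewrite mulN1r /e' opprB addrC subrK.
exists S => //; rewrite -/e'.
rewrite -ltr_sqr ?nnegrE ?norm2_ge0 ?(ltW e0)// sqr_norm2.
apply: (@le_lt_trans _ _ (eta * K)); last first.
  by apply: le_lt_trans etaK _; have := exprn_gt0 2 e0; lra.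
rewrite Ne; move: h1 h2; rewrite !ler_norml => /andP[_ h1] /andP[h2 _].
have : eta * nrm S <= eta * (2 * nrm Y + 1) by rewrite ler_wpM2l ?(ltW eta0)//;
  lra.
rewrite /K; lra.
Qed.

End gaussian_space_theory.

(** The sigma-algebra generated by the variables, presented by the half-spaces that trigonometric
    multipliers reach; [generated_sigma_preimage] relates it to the Borel sets of R^N. *)
Definition generated_sigma {T : Type} {R : realType} {n : nat} (U : 'I_n -> T ->
  R) :
    set (set T) :=
  <<s [set A | exists i a, A = [set w | a < U i w]] >>.

Lemma sin_lipschitz0 (R : realType) (x : R) : `|sin x| <= `|x|.
Proof.
have := cos_lipschitz (x - pi / 2) (0 - pi / 2).
by rewrite !cosBpihalf sin0 subr0 opprB addrA subrK subr0.
Qed.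

(** The difference quotient of sine at 0 along x / (k + 1), which is a nonzero increment only when x
    is nonzero. *)
Lemma cvg_mul_sin_div (R : realType) (x : R) :
  k.+1%:R * sin (x / k.+1%:R) @[k --> \oo] --> x.
Proof.
have [->|x0] := eqVneq x 0.
  under eq_fun do rewrite mul0r sin0 mulr0; exact: cvg_cst.
have [D E] := is_derive_sin (0 : R).
have c : h^-1 *: (sin (h + 0) - sin 0) @[h --> 0^'] --> (1 : R).
  rewrite -cos0 -E; have := D; rewrite /derivable => /cvg_ex[l hl].
  rewrite /derive; have -> : (fun h : R => h^-1 *: (sin (h + 0) - sin 0)) =
    (fun h : R => h^-1 *: ((sin \o shift 0) (h *: 1) - sin 0)).
    by apply/funext => h /=; rewrite /GRing.scale/= mulr1.
  exact: D.
have xk : (forall k, x / k.+1%:R != 0) /\ x / k.+1%:R @[k --> \oo] --> (0 : R).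
  split; first by move=> k; rewrite mulf_neq0.
  rewrite -[X in _ --> X](mulr0 x); apply: cvgMr; exact: cvg_harmonic.
have c1 := (cvgr_dnbhsP _ _ _).1 c _ xk.
rewrite -[X in _ --> X](mulr1 x).
rewrite (_ : (fun k => _) = (fun k : nat => x * ((x / k.+1%:R)^-1 *:
    (sin (x / k.+1%:R + 0) - sin 0)))); first exact: cvgMr.
apply/funext => k.
by rewrite /GRing.scale/= addr0 sin0 subr0 invf_div -mulrA mulrCA mulVKf.
Qed.

(** * Uncorrelated elements of the Gaussian space are independent *)

Section independence.
Context {d} {T : measurableType d} {R : realType} (P : probability T R).
Local Notation Ex := (Rintegral P setT).
Local Notation ig Y := (P.-integrable setT (EFin \o Y)).
Local Notation sq := (square_integrable P).
Local Notation ip := (inner P).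
Variables (X : Type) (u : X -> T -> R).
Hypothesis hu : forall (n : nat) (x : 'I_n -> X) (t : 'I_n -> R),
    gaussian_rv P (fun w => \sum_(i < n) t i * u (x i) w).
Local Notation gspace := (gspace P u).
Local Notation var := (var P).

Definition cov (Y Z : T -> R) := ip Y Z - Ex Y * Ex Z.

Lemma generated_sigma_multiplier n (U : 'I_n -> T -> R) W A :
  (forall i, measurable_fun setT (U i)) -> ig W ->
  generated_sigma U A -> multiplier_set P U W A.
Proof.
move=> mU iW; apply: smallest_sub; first exact: sigma_algebra_multiplier_set.
by move=> _ [i [a ->]]; exact: multiplier_set_gt.
Qed.

Lemma generated_sigma_measurable n (U : 'I_n -> T -> R) A :
  (forall i, measurable_fun setT (U i)) -> generated_sigma U A -> measurable A.
Proof.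
move=> mU hA; have := generated_sigma_multiplier mU (integrable_cst P 0) hA.
by case.
Qed.

Lemma integrable_indicator (A : set T) : measurable A -> ig (\1_A : T -> R).
Proof.
by move=> mA; have [m [K hK]] := bounded_measurable_indic (R := R) mA;
   exact: integrable_bounded m hK.
Qed.

Lemma integrable_cos (Y : T -> R) th : measurable_fun setT Y -> ig (fun w => cos
  (Y w + th)).
Proof.
move=> mY; apply: (@integrable_bounded _ _ _ _ _ 1); last by move=> w;
  exact: cos_max.
apply: (measurableT_comp (continuous_measurable_fun (@continuous_cos R))).
exact: measurable_funD.
Qed.

Lemma gspace_lincomb n (U : 'I_n -> T -> R) t : (forall i, gspace (U i)) ->
  gspace (lincomb U t).
Proof. by move=> gU; apply: gspace_sum => // i; exact: gspace_scale. Qed.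

Lemma covZr Z Y k : sq Z -> sq Y -> cov Z (fun w => k * Y w) = k * cov Z Y.
Proof.
move=> sZ sY; rewrite /cov innerZr// Ex_scale; first by ring.
exact: square_integrable_integrable.
Qed.

Lemma cov_lincomb n (U : 'I_n -> T -> R) t Z : sq Z -> (forall i, sq (U i)) ->
  cov Z (lincomb U t) = \sum_(i < n) t i * cov Z (U i).
Proof.
move=> sZ sU; have stU i := square_integrable_scale (t i) (sU i).
rewrite /cov innerC /lincomb inner_suml// Ex_sum; last first.
  by move=> i; exact: square_integrable_integrable.
rewrite big_distrr/= -sumrB; apply: eq_bigr => i _.
rewrite innerZl// (innerC _ (U i)) Ex_scale; first by ring.
exact: square_integrable_integrable.
Qed.

Lemma varD Y Z : sq Y -> sq Z -> var (fun w => Y w + Z w) = var Y + var Z + 2 *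
  cov Y Z.
Proof.
move=> sY sZ; have sYZ := square_integrable_add sY sZ.
rewrite /var innerDl// !innerDr// (innerC _ Z Y) Ex_add; last 2 first.
- exact: square_integrable_integrable.
- exact: square_integrable_integrable.
by rewrite /cov; ring.
Qed.

(** Both s Z + L and s Z - L lie in the Gaussian space and, the covariance being zero, have the same
    variance var (s Z) + var L. After product-to-sum the exponentials factor out and the two cosines
    of the means recombine into a product. *)
Lemma gspace_cos_mul Z L s eta th : gspace Z -> gspace L -> cov Z L = 0 ->
  Ex (fun w => cos (s * Z w + eta) * cos (L w + th)) =
  Ex (fun w => cos (s * Z w + eta)) * Ex (fun w => cos (L w + th)).
Proof.
move=> gZ gL c0; have sZ := gspace_sq gZ; have sL := gspace_sq gL.
have gsZ := gspace_scale hu s gZ; have gL' := gspace_scale hu (-1) gL.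
have ssZ := gspace_sq gsZ; have sL' := gspace_sq gL'.
have gp := gspace_add hu gsZ gL; have gm := gspace_add hu gsZ gL'.
have [mp _] := gspace_sq gp; have [mm _] := gspace_sq gm.
have iZ := square_integrable_integrable sZ;
  have iL := square_integrable_integrable sL.
have i1 := square_integrable_integrable ssZ;
  have i2 := square_integrable_integrable sL'.
transitivity (Ex (fun w => 2^-1 * (cos (s * Z w + L w + (eta + th)) +
                             cos (s * Z w + -1 * L w + (eta - th))))).
  apply: eq_Rintegral => w _.
  rewrite (_ : s * Z w + L w + (eta + th) = (s * Z w + eta) + (L w + th));
    last by ring.
  rewrite (_ : s * Z w + -1 * L w + (eta - th) = (s * Z w + eta) - (L w + th));
    last by ring.
  by move: (s * _ + eta) (L w + th) => a b; rewrite cosB cosD; field.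
rewrite Ex_scale; last by apply: integrable_add; exact: integrable_cos.
rewrite Ex_add; [|exact: integrable_cos..].
rewrite (gspace_cos hu _ gp) (gspace_cos hu _ gm) (gspace_cos hu _ gsZ)
  (gspace_cos hu _ gL).
rewrite (varD ssZ sL) (varD ssZ sL') !Ex_add// !Ex_scale// !varZ//.
have csL : cov (fun w => s * Z w) L = 0.
  by have := covZr s sL sZ; rewrite /cov !(innerC _ L) !(mulrC (Ex L)) => ->;
    rewrite -/(cov Z L) c0 mulr0.
rewrite covZr// csL !mulr0 !addr0.
rewrite (_ : s * Ex Z + Ex L + (eta + th) = (s * Ex Z + eta) + (Ex L + th));
  last by ring.
rewrite (_ : s * Ex Z + -1 * Ex L + (eta - th) = (s * Ex Z + eta) - (Ex L +
  th)); last by ring.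
rewrite sqrrN expr1n mul1r opprD mulrDl expRD.
by move: (s * _ + eta) (Ex L + th) => a b; rewrite cosB cosD; field.
Qed.

(** The centred variable W = cos (s Z + eta) - k is orthogonal to every character of [U] by the
    product formula, hence to the indicators of all events generated by [U]. *)
Lemma gspace_indep_cos n (U : 'I_n -> T -> R) Z s eta A :
  gspace Z -> (forall i, gspace (U i)) -> (forall i, cov Z (U i) = 0) ->
  generated_sigma U A ->
  Ex (fun w => cos (s * Z w + eta) * \1_A w) =
  Ex (fun w => cos (s * Z w + eta)) * Ex (\1_A).
Proof.
move=> gZ gU cU hA; have sZ := gspace_sq gZ; have sU i := gspace_sq (gU i).
have mU i : measurable_fun setT (U i) by have [] := sU i.
have mA := generated_sigma_measurable mU hA.
set k := Ex (fun w => cos (s * Z w + eta)).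
have [mZ _] := square_integrable_scale s sZ.
have ic : ig (fun w => cos (s * Z w + eta)) by exact: integrable_cos.
have ik := integrable_cst P k.
have iW := integrable_sub ic ik.
have iA := integrable_indicator mA.
have bA : bounded_measurable (\1_A : T -> R)
  by exact: bounded_measurable_indic.
have := Ex_mul_indic_eq0 (P := P) (U := U) (W := fun w => cos (s * Z w + eta) -
  k) (A := A).
move=> H; have {}H := H _ (generated_sigma_multiplier mU iW hA).
apply/eqP; rewrite -subr_eq0 -Ex_scale// -Ex_sub; last 2 first.
- exact: integrable_mul_bounded.
- exact: integrable_scale.
apply/eqP; rewrite -[RHS]H.
  by apply: eq_Rintegral => w _; rewrite mulrBl.
move=> t th; have gL := gspace_lincomb t gU.
have bc := bounded_measurable_cos mU t th.
have [mL _] := gspace_sq gL.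
transitivity (Ex (fun w => cos (s * Z w + eta) * cos (lincomb U t w + th) -
    k * cos (lincomb U t w + th))).
  by apply: eq_Rintegral => w _; rewrite mulrBl.
rewrite Ex_sub; last 2 first.
- exact: integrable_mul_bounded.
- by apply: integrable_scale; exact: integrable_cos.
rewrite gspace_cos_mul//; last first.
  by rewrite cov_lincomb// big1// => i _; rewrite cU mulr0.
by rewrite Ex_scale ?subrr//; exact: integrable_cos.
Qed.

(* [cos] at phase [- pi / 2] is odd, so the product formula forces these
   integrals to vanish; the centred variable is recovered from k sin (Y / k) *)
Lemma gspace_indep_mean n (U : 'I_n -> T -> R) Z A :
  gspace Z -> (forall i, gspace (U i)) -> (forall i, cov Z (U i) = 0) ->
  generated_sigma U A ->
  Ex (fun w => (Z w - Ex Z) * \1_A w) = 0.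
Proof.
move=> gZ gU cU hA; have sZ := gspace_sq gZ; have [mZ _] := sZ.
have mU i : measurable_fun setT (U i) by have [[]] := gU i.
have mA := generated_sigma_measurable mU hA.
set m := Ex Z.
have iZ : ig (fun w => `|Z w - m|).
  apply: integrable_normr; apply: integrable_sub; last exact: integrable_cst.
  exact: square_integrable_integrable.
have mZm : measurable_fun setT (fun w => Z w - m) by exact: measurable_funB.
have m1A : measurable_fun setT (\1_A : T -> R) by exact: measurable_indic.
have sin0' s : Ex (fun w => sin (s * (Z w - m)) * \1_A w) = 0.
  have e w : sin (s * (Z w - m)) = cos (s * Z w + (- s * m - pi / 2)).
    by rewrite addrA cosBpihalf; congr sin; ring.
  under eq_Rintegral do rewrite e.
  rewrite (gspace_indep_cos s _ gZ gU cU hA) (gspace_cos hu _ (gspace_scale hu s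
    gZ)).
  rewrite Ex_scale; last exact: square_integrable_integrable.
  by rewrite -/m addrA cosBpihalf [- s * m]mulNr subrr sin0 mulr0 mul0r.
pose f k w := k.+1%:R * sin ((Z w - m) / k.+1%:R) * \1_A w.
have mf k : measurable_fun setT (f k).
  apply: measurable_funM => //; apply: measurable_funM => //.
  apply: (measurableT_comp (continuous_measurable_fun (@continuous_sin R))).
  exact: measurable_funM.
have cf w : f k w @[k --> \oo] --> (Z w - m) * \1_A w.
  by apply: cvgMl; exact: cvg_mul_sin_div.
have df k w : `|f k w| <= `|Z w - m|.
  rewrite /f normrM -[leRHS]mulr1; apply: ler_pM => //.
    rewrite normrM ger0_norm//.
    apply: le_trans (ler_wpM2l _ (sin_lipschitz0 _)) _ => //.
    by rewrite normrM (ger0_norm (x := _^-1)) ?invr_ge0// mulrCA divff ?mulr1.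
  by rewrite indicE; case: (_ \in _); rewrite ?normr1 ?normr0.
have [_ lim] := Ex_dominated mf cf iZ df.
have f0 k : Ex (f k) = 0.
  rewrite -(mulr0 k.+1%:R) -(sin0' k.+1%:R^-1) -Ex_scale.
    by apply: eq_Rintegral => w _; rewrite /f mulrA (mulrC _^-1).
  apply: (@integrable_bounded _ _ _ _ _ 1).
    apply: measurable_funM => //.
    apply: (measurableT_comp (continuous_measurable_fun (@continuous_sin R))).
    exact: measurable_funM.
  move=> w; rewrite normrM mulr_ile1// ?sin_max// indicE.
  by case: (_ \in _); rewrite ?normr1 ?normr0.
by move: lim; rewrite (funext f0) => /cvg_lim <- //; rewrite lim_cst.
Qed.

(** Trigonometric uniqueness once more, with the roles exchanged: now W = [\1_A] - P(A) is tested
    against the characters of the single variable [Z]. *)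
Lemma gspace_indep_event n (U : 'I_n -> T -> R) Z A B :
  gspace Z -> (forall i, gspace (U i)) -> (forall i, cov Z (U i) = 0) ->
  generated_sigma U A -> generated_sigma (fun _ : 'I_1 => Z) B ->
  Ex (fun w => \1_A w * \1_B w) = Ex (\1_A) * Ex (\1_B).
Proof.
move=> gZ gU cU hA hB; have sZ := gspace_sq gZ; have [mZ _] := sZ.
have mU i : measurable_fun setT (U i) by have [[]] := gU i.
have mA := generated_sigma_measurable mU hA.
have mB := generated_sigma_measurable (fun _ => mZ) hB.
have iA := integrable_indicator mA; have iB := integrable_indicator mB.
set k := Ex (\1_A).
have iW := integrable_sub iA (integrable_cst P k).
have bB : bounded_measurable (\1_B : T -> R)
  by exact: bounded_measurable_indic.
have := Ex_mul_indic_eq0 (P := P) (U := fun _ : 'I_1 => Z) (W := fun w => \1_A w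
  - k) (A := B).
move=> H; have {}H := H _ (generated_sigma_multiplier (fun _ => mZ) iW hB).
apply/eqP; rewrite -subr_eq0 -Ex_scale// -Ex_sub; last 2 first.
- exact: integrable_mul_bounded.
- exact: integrable_scale.
apply/eqP; rewrite -[RHS]H.
  by apply: eq_Rintegral => w _; rewrite mulrBl.
move=> t th.
have [mtZ _] := square_integrable_scale (t ord0) sZ.
have ic : ig (fun w => cos (t ord0 * Z w + th)) by exact: integrable_cos.
transitivity (Ex (fun w => cos (t ord0 * Z w + th) * \1_A w - k * cos (t ord0 *
  Z w + th))).
  by apply: eq_Rintegral => w _; rewrite /lincomb big_ord1 mulrBl mulrC.
have bA : bounded_measurable (\1_A : T -> R)
  by exact: bounded_measurable_indic.
rewrite Ex_sub; last 2 first.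
- exact: integrable_mul_bounded.
- exact: integrable_scale.
by rewrite (gspace_indep_cos _ _ gZ gU cU hA) Ex_scale// mulrC subrr.
Qed.

End independence.

(** * Full support *)

Section interval_positivity.
Context {d} {T : measurableType d} {R : realType} (P : probability T R).
Notation mu := (@lebesgue_measure R).
Local Notation Ex := (Rintegral P setT).
Local Notation nrm := (norm2 P).
Local Notation ip := (inner P).
Variables (X : Type) (u : X -> T -> R).
Hypothesis hu : forall (n : nat) (x : 'I_n -> X) (t : 'I_n -> R),
    gaussian_rv P (fun w => \sum_(i < n) t i * u (x i) w).
Local Notation gspace := (gspace P u).
Local Notation var := (var P).

(** Half the length of the ball times a lower bound on it for the density of mean [m] and variance
    [v]. The parameters are those that converge along L2 approximations. *)
Definition normal_lower_bound (y r m v : R) : R :=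
  r * (Num.sqrt (v * pi *+ 2))^-1 * expR (- (`|y - m| + r) ^+ 2 / (v *+ 2)).

Lemma normal_prob_ball_ge (y r m s : R) : s != 0 -> 0 < r ->
  ((normal_lower_bound y r m (s ^+ 2))%:E <= normal_prob m s (ball y r))%E.
Proof.
move=> s0 r0; rewrite ball_itv /normal_prob.
pose k := (Num.sqrt (s ^+ 2 * pi *+ 2))^-1 * expR (- (`|y - m| + r) ^+ 2 / (s ^+
  2 *+ 2)).
have k0 : 0 <= k by rewrite mulr_ge0 ?expR_ge0// invr_ge0 sqrtr_ge0.
apply: (@le_trans _ _ (\int[mu]_(x in `](y - r)%R, (y + r)%R[) k%:E)%E).
  rewrite integral_cst//= lebesgue_measure_itv/= lte_fin.
  rewrite ltrD2l gtrN// -EFinB -EFinM lee_fin /normal_lower_bound -mulrA -/k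
    mulrC.
  rewrite ler_wpM2l//; lra.
apply: ge0_le_integral => //.
  by apply/measurable_funTS/measurable_EFinP; exact: measurable_normal_pdf.
move=> x; rewrite /= in_itv/= => /andP[x1 x2].
rewrite lee_fin normal_pdfE// /k /normal_peak ler_wpM2l ?invr_ge0 ?sqrtr_ge0//.
rewrite /normal_fun ler_expR !mulNr lerN2 ler_wpM2r//.
  by rewrite invr_ge0 mulrn_wge0// sqr_ge0.
rewrite -[(x - m) ^+ 2]real_normK ?num_real// ler_sqr ?nnegrE ?addr_ge0 ?(ltW
  r0)//.
have -> : x - m = (y - m) + (x - y) by ring.
apply: le_trans (ler_normD _ _) _.
by rewrite lerD2l ler_norml; apply/andP; split; lra.
Qed.

(** The law of the L2 limit [Y] is not at hand, so the mass is bounded from below along finite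
    combinations [S_ k], whose normal laws give a bound continuous in mean and variance. *)
Lemma gspace_interval_gt0 (Y : T -> R) (y r : R) : gspace Y -> 0 < var Y -> 0 <
  r ->
  0 < Ex (\1_[set w | `|Y w - y| < r]).
Proof.
move=> gY vY r0; have sY := gspace_sq gY; have [mY _] := sY.
have mball (Z : T -> R) (e : R) : measurable_fun setT Z -> measurable [set w |
  `|Z w - y| < e].
  move=> mZ; rewrite (_ : [set w | _] = Z @^-1` ball y e); last first.
    by apply/seteqP; split=> w /=; rewrite /ball/= distrC.
  by rewrite -[X in measurable X]setTI; apply: mZ => //; rewrite ball_itv.
have [S_ [sS cv]] := gspace_seq gY.
have sqS k := finite_span_sq hu (sS k).
have [cE _ cip _] := norm2_cvg0 sY sqS cv.
pose v k := ip (S_ k) (S_ k) - Ex (S_ k) * Ex (S_ k).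
have cvv : v k @[k --> \oo] --> var Y.
  by apply: cvgB => //; rewrite expr2; exact: cvgM.
pose r2 := r / 2; have r20 : 0 < r2 by rewrite divr_gt0.
pose b k := normal_lower_bound y r2 (Ex (S_ k)) (v k).
have cb : b k @[k --> \oo] --> normal_lower_bound y r2 (Ex Y) (var Y).
  apply: cvgM.
    apply: cvgMr; apply: cvgV.
      by rewrite sqrtr_eq0 -ltNge pmulrn_lgt0// mulr_gt0 ?pi_gt0.
    apply: (@continuous_cvg _ _ _ _ _ _ Num.sqrt); first exact: sqrt_continuous.
    rewrite -mulr_natr; under eq_fun do rewrite -mulr_natr.
    by apply: cvgMl; exact: cvgMl.
  apply: (@continuous_cvg _ _ _ _ _ _ expR); first exact: continuous_expR.
  apply: cvgM.
    apply: cvgN; rewrite expr2; under eq_fun do rewrite expr2.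
    by apply: cvgM; apply: cvgD; [|exact: cvg_cst| |exact: cvg_cst];
      apply: cvg_norm; apply: cvgB => //; exact: cvg_cst.
  apply: cvgV; first by rewrite gt_eqF// pmulrn_lgt0.
  by rewrite -mulr_natr; under eq_fun do rewrite -mulr_natr; exact: cvgMl.
have b0 : 0 < normal_lower_bound y r2 (Ex Y) (var Y).
  rewrite !mulr_gt0 ?expR_gt0// invr_gt0 sqrtr_gt0 pmulrn_lgt0//.
  by rewrite mulr_gt0 ?pi_gt0.
(* Chebyshev's inequality: if S_k is within r/2 of y but Y is not within r, then |Y - S_k| >= r/2,
   and the second term pays for this event. *)
have key : \forall k \near \oo,
    b k <= Ex (\1_[set w | `|Y w - y| < r]) + r2 ^- 2 * nrm (fun w => Y w - S_ k
      w) ^+ 2.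
  near=> k; have vk : 0 < v k by near: k; exact: (cvgr_gt (var Y)).
  have [mS _] := sqS k.
  have sD := square_integrable_sub sY (sqS k); have [mD iD] := sD.
  have iB := integrable_indicator P (mball _ r mY).
  apply: (@le_trans _ _ (Ex (\1_[set w | `|S_ k w - y| < r2]))).
    have [_ [m [s [_ law Em Es _]]]] := gaussian_rv_moments
      (finite_span_gaussian hu (sS k)).
    have vs : v k = s ^+ 2 by rewrite /v Es Em; ring.
    have s0 : s != 0 by apply/eqP => s0; move: vk; rewrite vs s0 expr0n ltxx.
    rewrite Ex_indic; last exact: mball.
    rewrite (_ : [set w | _] = S_ k @^-1` ball y r2); last first.
      by apply/seteqP; split=> w /=; rewrite /ball/= distrC.
    have mb : measurable (ball y r2) by rewrite ball_itv.
    rewrite law//= /gaussian_law (negbTE s0) -lee_fin fineK.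
      by rewrite /b Em vs; exact: normal_prob_ball_ge.
    by rewrite fin_num_measure.
  have -> : nrm (fun w => Y w - S_ k w) ^+ 2 = Ex (fun w => (Y w - S_ k w) ^+
    2).
    by rewrite sqr_norm2; apply: eq_Rintegral => w _; rewrite expr2.
  rewrite -Ex_scale// -Ex_add//; last exact: integrable_scale.
  apply: le_Ex; first exact/integrable_indicator/mball.
    by apply: integrable_add => //; exact: integrable_scale.
  move=> w; rewrite !indicE.
  have p0 : 0 <= r2 ^- 2 * (Y w - S_ k w) ^+ 2.
    by rewrite mulr_ge0 ?sqr_ge0// invr_ge0 exprn_ge0// ltW.
  have [/set_mem/= h1|_] := boolP (w \in [set w | `|S_ k w - y| < r2]);
    last first.
    by rewrite addr_ge0.
  have [|/negP h2] := boolP (w \in [set w | `|Y w - y| < r]);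
    first by rewrite lerDl.
  rewrite add0r mulrC ler_pdivlMr ?exprn_gt0// mul1r.
  have h3 : r <= `|Y w - y| by rewrite leNgt; apply/negP => h; apply: h2;
    rewrite inE.
  have h4 : `|Y w - y| <= `|Y w - S_ k w| + `|S_ k w - y|.
    by apply: le_trans (ler_normD _ _); rewrite addrA subrK.
  rewrite -[leRHS]real_normK ?num_real// ler_sqr ?nnegrE ?(ltW r20)//.
  by move: h1 h3 h4; rewrite /r2; lra.
rewrite ltNge; apply/negP => E0.
have : normal_lower_bound y r2 (Ex Y) (var Y) <= Ex (\1_[set w | `|Y w - y| <
  r]) + r2 ^- 2 * 0 ^+ 2.
  apply: (ler_cvg_to cb _ key).
  apply: cvgD; first exact: cvg_cst.
  by apply: cvgMr; exact: cvgM.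
rewrite expr0n mulr0 addr0 => h; by have := lt_le_trans b0 (le_trans h E0);
  rewrite ltxx.
Unshelve. all: end_near. Qed.

End interval_positivity.

(** * Boxes and Borel sets in the generated sigma-algebra *)

Section generated_sigma_theory.
Context {T : Type} {R : realType} {n : nat} (U : 'I_n -> T -> R).
Local Notation gen := (generated_sigma U).

Lemma generated_sigma_setC A : gen A -> gen (~` A).
Proof. by move=> hA; rewrite -setTD; exact: sigma_algebraCD. Qed.

Lemma generated_sigma_bigcup (F : nat -> set T) : (forall k, gen (F k)) -> gen
  (\bigcup_k F k).
Proof. by move=> hF; exact: sigma_algebra_bigcup. Qed.

Lemma generated_sigma_setT : gen setT.
Proof. by rewrite -setC0; apply: generated_sigma_setC;
  exact: sigma_algebra0. Qed.

Lemma generated_sigma_setI A B : gen A -> gen B -> gen (A `&` B).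
Proof.
move=> hA hB; rewrite -[A `&` B]setCK setCI -bigcup2E.
apply: generated_sigma_setC; apply: generated_sigma_bigcup.
by move=> [|[|k]] /=;
  [exact: generated_sigma_setC|exact: generated_sigma_setC|exact:
    sigma_algebra0].
Qed.

Lemma generated_sigma_ball i (y r : R) : gen [set w | `|U i w - y| < r].
Proof.
have gt a : gen [set w | a < U i w] by apply: sub_gen_smallest; exists i, a.
have lt a : gen [set w | U i w < a].
  rewrite (_ : [set w | _] = \bigcup_k ~` [set w | a - k.+1%:R^-1 < U i w]).
    by apply: generated_sigma_bigcup => k; exact: generated_sigma_setC.
  apply/seteqP; split=> w /=.
    move=> wa; have d0 : 0 < a - U i w by rewrite subr_gt0.
    exists (Num.truncn (a - U i w)^-1) => //=; apply/negP; rewrite -leNgt.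
    rewrite lerBrDr -lerBrDl invf_ple ?posrE//.
    by apply/ltW; rewrite truncnS_gt.
  move=> [k _ /negP]; rewrite -leNgt => /le_lt_trans; apply.
  by rewrite ltrBlDr ltrDl invr_gt0.
rewrite (_ : [set w | _] = [set w | y - r < U i w] `&` [set w | U i w < y + r]).
  exact: generated_sigma_setI.
by apply/seteqP; split=> w /=; rewrite ltr_distl;
  [move=> /andP[]|move=> [-> ->]].
Qed.

(** The reindexing [I] lets the induction on the number of constraints run while [U] stays fixed. *)
Lemma generated_sigma_box m (I : 'I_m -> 'I_n) (V : 'I_m -> R) (r : R) :
  gen [set w | forall j, `|U (I j) w - V j| < r].
Proof.
elim: m I V => [|m IH] I V.
  rewrite (_ : [set w | _] = setT); first exact: generated_sigma_setT.
  by apply/seteqP; split=> // w _ [].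
rewrite (_ : [set w | _] = [set w | `|U (I ord0) w - V ord0| < r] `&`
    [set w | forall j, `|U (I (lift ord0 j)) w - V (lift ord0 j)| < r]).
  by apply: generated_sigma_setI;
    [exact: generated_sigma_ball|exact: (IH (fun j => I (lift ord0 j)) (fun j =>
      V (lift ord0 j)))].
apply/seteqP; split=> w /=; first by move=> h; split.
by move=> [h0 h] j; have [->//|j0] := eqVneq j ord0;
  case: (unliftP ord0 j) => [k ->|->].
Qed.

(** The sets with generated preimage form a sigma-algebra, so open sets suffice; an open set is the
    union of the boxes with rational centre and radius 1/(k+1) that it contains, a countable family
    enumerated by [unpickle]. *)
Lemma generated_sigma_preimage (B : set 'rV[R]_n) : <<s open >> B ->
  gen ((fun w => \row_i U i w) @^-1` B).
Proof.
have sa : sigma_algebra setT [set B | gen ((fun w => \row_i U i w) @^-1` B)].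
  split.
  - by rewrite /= preimage_set0; exact: sigma_algebra0.
  - by move=> A /= hA; rewrite setTD preimage_setC; exact: generated_sigma_setC.
  - by move=> F hF /=; rewrite preimage_bigcup; exact: generated_sigma_bigcup.
move=> hB; apply: (smallest_sub sa _ hB) => {hB} O oO /=.
pose box (p : nat * 'rV[rat]_n) : set 'rV[R]_n :=
  [set v | forall j, `|v ord0 j - ratr (p.2 ord0 j)| < p.1.+1%:R^-1].
pose F k := if unpickle k is Some p then
  if `[< box p `<=` O >] then (fun w => \row_i U i w) @^-1` box p else set0 else
    set0.
have -> : (fun w => \row_i U i w) @^-1` O = \bigcup_k F k.
  apply/seteqP; split=> w /=; last first.
    move=> [k _]; rewrite /F; case: (unpickle k) => [p|//].
    by case: asboolP => // bO; exact: bO.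
  move=> Ow; have [e /= e0 eO] := (nbhs_ballP _ _).1 (open_nbhs_nbhs (conj oO
    Ow)).
  (* Two radii must fit into e: one from [U w] to the rational centre, one from the centre to a
     point of the box. *)
  pose k := Num.truncn (2 / e).
  have ke : 2 / k.+1%:R < e.
    by rewrite ltr_pdivrMr// mulrC -ltr_pdivrMr// truncnS_gt.
  have h j : exists q : rat, `|U j w - ratr q| < k.+1%:R^-1.
    have [|q] := @rat_in_itvoo R (U j w - k.+1%:R^-1) (U j w + k.+1%:R^-1).
      by rewrite ltrD2l gtrN// invr_gt0.
    by rewrite in_itv/= -ltr_distl => hq; exists q; rewrite distrC.
  have [q hq] := choice h.
  exists (pickle (k, \row_j q j)) => //; rewrite /F pickleK.
  case: asboolP => [_|]; first by move=> j /=; rewrite !mxE.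
  case=> v hv; apply: eO; rewrite /ball/= /mx_ball; split=> // i j.
  rewrite (ord1 i) mxE /ball/=; have := hv j; have := hq j;
    rewrite /= mxE => h1 h2.
  apply: lt_trans ke; rewrite distrC in h2.
  have -> : U j w - v ord0 j = (U j w - ratr (q j)) + (ratr (q j) - v ord0 j) by
    ring.
  apply: le_lt_trans (ler_normD _ _) _.
  by rewrite (_ : 2 = 1 + 1 :> R)// mulrDl mul1r ltrD.
apply: generated_sigma_bigcup => k; rewrite /F; case: (unpickle k) => [p|];
  last exact: sigma_algebra0.
case: asboolP => _; last exact: sigma_algebra0.
have := @generated_sigma_box n id (fun j => ratr (p.2 ord0 j)) p.1.+1%:R^-1.
congr gen; apply/seteqP; split=> w /= h j; first by rewrite mxE.
by have := h j; rewrite mxE.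
Qed.

End generated_sigma_theory.

(** * Nondegenerate Gaussian vectors charge every box *)

Section full_support.
Context {d} {T : measurableType d} {R : realType} (P : probability T R).
Local Notation Ex := (Rintegral P setT).
Variables (X : Type) (u : X -> T -> R).
Hypothesis hu : forall (n : nat) (x : 'I_n -> X) (t : 'I_n -> R),
    gaussian_rv P (fun w => \sum_(i < n) t i * u (x i) w).
Local Notation gspace := (gspace P u).
Local Notation var := (var P).
Local Notation cov := (cov P).

Lemma covC Y Z : cov Y Z = cov Z Y.
Proof. by rewrite /cov innerC mulrC. Qed.

Lemma var_lincomb n (U : 'I_n -> T -> R) t : (forall i, square_integrable P (U
  i)) ->
  var (lincomb U t) = \sum_(i < n) t i * \sum_(j < n) t j * cov (U i) (U j).
Proof.
move=> sU; have sL : square_integrable P (lincomb U t).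
  by apply: square_integrable_sum => i; exact: square_integrable_scale.
rewrite -[var _]/(cov (lincomb U t) (lincomb U t)) cov_lincomb//.
by apply: eq_bigr => i _; rewrite covC cov_lincomb.
Qed.

(** A row vector killed by the covariance matrix is the coefficient vector of a combination of zero
    variance. *)
Lemma gram_unitmx n (U : 'I_n -> T -> R) : (forall i, square_integrable P (U i))
  ->
  (forall t, var (lincomb U t) = 0 -> forall i, t i = 0) ->
  (\matrix_(i, j) cov (U i) (U j) : 'M[R]_n) \in unitmx.
Proof.
move=> sU h; rewrite -row_free_unit; apply/inj_row_free => v /rowP v0.
apply/rowP => i; rewrite mxE; apply: (h (v ord0)); rewrite var_lincomb//.
apply: big1 => k _; have := v0 k; rewrite !mxE => vk.
rewrite [X in _ * X](_ : _ = 0) ?mulr0// -[RHS]vk.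
by apply: eq_bigr => j _; rewrite mxE covC.
Qed.

Lemma covBl Y1 Y2 Z : square_integrable P Y1 -> square_integrable P Y2 ->
  square_integrable P Z -> cov (fun w => Y1 w - Y2 w) Z = cov Y1 Z - cov Y2 Z.
Proof.
move=> s1 s2 sZ; rewrite /cov innerBl// Ex_sub; first by ring.
- exact: square_integrable_integrable.
- exact: square_integrable_integrable.
Qed.

(* Condition on all coordinates but the last: the last one is a linear form in
   the others plus an independent nondegenerate Gaussian residual. *)
Lemma gspace_full_support n (U : nat -> T -> R) (V : nat -> R) (r : R) :
  (forall i, gspace (U i)) ->
  (forall t : 'I_n -> R, var (lincomb (fun i : 'I_n => U i) t) = 0 -> forall i,
    t i = 0) ->
  0 < r -> 0 < Ex (\1_[set w | forall i : 'I_n, `|U i w - V i| < r]).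
Proof.
move=> gU; have sU i := gspace_sq (gU i).
(* [U] and [V] are indexed by [nat], so that dropping the last coordinate only changes the bound. *)
elim: n V r => [|n IH] V r nd r0.
  rewrite (_ : [set w | _] = setT);
    first by rewrite Ex_indic// probability_setT.
  by apply/seteqP; split=> // w _ [].
pose Un (i : 'I_n) := U i.
have gUn i : gspace (Un i) by exact: gU.
have sUn i := gspace_sq (gUn i).
have last_lin (t : 'I_n -> R) a w :
    lincomb (fun i : 'I_n.+1 => U i) (fun i => if unlift ord_max i is Some j
      then t j else a) w =
    lincomb Un t w + a * U n w.
  rewrite /lincomb big_ord_recr/= unlift_none; congr (_ + _).
  apply: eq_bigr => i _; rewrite (_ : widen_ord _ i = lift ord_max i) ?liftK//.
  by apply: val_inj; rewrite /= /bump leqNgt ltn_ord.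
have ndn t : var (lincomb Un t) = 0 -> forall i, t i = 0.
  move=> h i.
  have := nd (fun i => if unlift ord_max i is Some j then t j else 0).
  rewrite (_ : lincomb _ _ = lincomb Un t); last first.
    by apply/funext => w; rewrite last_lin mul0r addr0.
  by move=> /(_ h (lift ord_max i)); rewrite liftK.
have G := gram_unitmx sUn ndn; set M := (\matrix_(i, j) _) in G.
(* The solution of the normal equations c M = Cov(U n, U j), which makes the residual [Z]
   uncorrelated with the earlier coordinates. *)
pose c := (\row_j cov (U n) (U j)) *m invmx M : 'rV[R]_n.
pose Z w := U n w - lincomb Un (c ord0) w.
have gL := gspace_lincomb hu (c ord0) gUn.
have gZ : gspace Z by exact: gspace_sub.
have cZ j : cov Z (Un j) = 0.
  rewrite covBl//; last exact: gspace_sq gL.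
  rewrite [X in _ - X]covC cov_lincomb//.
  have : (c *m M) ord0 j = cov (U n) (Un j) by rewrite mulmxKV// mxE.
  rewrite mxE => <-; apply/eqP; rewrite subr_eq0; apply/eqP.
  by apply: eq_bigr => i _; congr (_ * _); rewrite [LHS]mxE covC.
(* [Z] is a combination of all [n.+1] variables with coefficient 1 on the last, so nondegeneracy
   excludes zero variance. *)
have vZ : 0 < var Z.
  rewrite lt_def var_ge0 ?andbT; last exact: gspace_sq gZ.
  apply/eqP => vZ0.
  have := nd (fun i => if unlift ord_max i is Some j then - c ord0 j else 1).
  rewrite (_ : lincomb _ _ = Z); last first.
    apply/funext => w; rewrite last_lin mul1r addrC /Z; congr (_ + _).
    by rewrite /lincomb -sumrN; apply: eq_bigr => i _; rewrite mulNr.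
  by move=> /(_ vZ0 ord_max) /eqP; rewrite unlift_none oner_eq0.
pose K := \sum_(i < n) `|c ord0 i|.
have K0 : 0 <= K by exact: sumr_ge0.
(* The tolerance r/2 on the last coordinate left by the residual must cover the errors of the
   others, which contribute at most r' K; dividing by K + 1 allows K = 0. *)
pose r' := Num.min r (r / 2 / (K + 1)).
have r'0 : 0 < r' by rewrite lt_min r0 !divr_gt0// ltr_wpDl.
have r'r : r' <= r by rewrite ge_min lexx.
have r'K : r' * K <= r / 2.
  apply: (@le_trans _ _ (r / 2 / (K + 1) * K)).
    by rewrite ler_wpM2r// ge_min lexx orbT.
  rewrite -mulrA ler_piMr ?divr_ge0 ?(ltW r0)//.
  by rewrite mulrC ler_pdivrMr ?ltr_wpDl// mul1r lerDl.
pose z0 := V n - \sum_(i < n) c ord0 i * V i.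
set A := [set w | forall i : 'I_n, `|U i w - V i| < r'].
set B := [set w | `|Z w - z0| < r / 2].
have hA : generated_sigma Un A by exact: (@generated_sigma_box _ _ _ Un n id
  (fun i => V i) r').
have hB : generated_sigma (fun _ : 'I_1 => Z) B.
  exact: (@generated_sigma_ball _ _ _ (fun _ : 'I_1 => Z) ord0 z0 (r / 2)).
have mA : measurable A.
  by apply: (generated_sigma_measurable P _ hA) => i; have [] := sUn i.
have mB : measurable B.
  by apply: (generated_sigma_measurable P _ hB) => i; have [[]] := gZ.
have PA : 0 < Ex (\1_A) by exact: IH.
have PB : 0 < Ex (\1_B) by apply: (gspace_interval_gt0 hu z0 gZ) => //;
  rewrite divr_gt0.
have PAB := gspace_indep_event hu gZ gUn cZ hA hB.
apply: (@lt_le_trans _ _ (Ex (fun w => \1_A w * \1_B w))).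
  by rewrite PAB mulr_gt0.
have mt : measurable [set w | forall i : 'I_n.+1, `|U i w - V i| < r].
  apply: (@generated_sigma_measurable _ _ _ P _ (fun i : 'I_n.+1 => U i)).
    by move=> i; have [] := sU i.
  exact: (@generated_sigma_box _ _ _ (fun i : 'I_n.+1 => U i) n.+1 id (fun i =>
    V i) r).
apply: le_Ex.
- apply: (@integrable_bounded _ _ _ _ _ 1).
    by apply: measurable_funM; exact: measurable_indic.
  move=> w; rewrite !indicE; case: (_ \in _); case: (_ \in _);
    by rewrite ?mulr1 ?mulr0 ?normr1 ?normr0.
- exact: integrable_indicator.
move=> w; rewrite !indicE.
have [/set_mem/= wA|_] := boolP (w \in A); last by rewrite mul0r.
have [/set_mem/= wB|_] := boolP (w \in B); last by rewrite mulr0.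
rewrite mem_set ?mulr1//= => i.
have [j ->|->] := unliftP ord_max i.
  rewrite (_ : lift ord_max j = j :> nat); first exact: lt_le_trans r'r.
  by rewrite /= /bump leqNgt ltn_ord.
have -> : U (ord_max : 'I_n.+1) w - V (ord_max : 'I_n.+1) =
    (Z w - z0) + \sum_(i < n) c ord0 i * (U i w - V i).
  rewrite /Z /z0 /lincomb /= (_ : \sum_(i < n) c ord0 i * (U i w - V i) =
    \sum_(i < n) c ord0 i * Un i w - \sum_(i < n) c ord0 i * V i);
      first by ring.
  by rewrite -sumrB; apply: eq_bigr => k _; rewrite mulrBr.
apply: le_lt_trans (ler_normD _ _) _; rewrite [ltRHS]splitr.
apply: ltr_leD => //; apply: le_trans r'K.
apply: le_trans (ler_norm_sum _ _ _) _.
rewrite /K mulr_sumr; apply: ler_sum => k _.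
by rewrite normrM mulrC ler_wpM2r// ltW.
Qed.

End full_support.

(** * Integrals against kernels *)

Section kernel.
Context {dX} {X : measurableType dX} {d} {T : measurableType d} {R : realType}.
Variables (dx : {sigma_finite_measure set X -> \bar R}) (P : probability T R).
Local Notation Ex := (Rintegral P setT).
Local Notation ig Y := (P.-integrable setT (EFin \o Y)).
Local Notation sq := (square_integrable P).
Local Notation nrm := (norm2 P).
Local Notation ip := (inner P).
Variable u : X -> T -> R.
Hypothesis um : measurable_fun setT (fun z : X * T => u z.1 z.2).
Hypothesis hu : forall (n : nat) (x : 'I_n -> X) (t : 'I_n -> R),
    gaussian_rv P (fun w => \sum_(i < n) t i * u (x i) w).
Local Notation gspace := (gspace P u).

Lemma gspace_gen x : gspace (u x).
Proof. exact/gspace_span/finite_span_gen. Qed.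

Let sqx x : sq (u x). Proof. exact: gspace_sq (gspace_gen x). Qed.

Lemma measurable_section w : measurable_fun setT (fun x => u x w).
Proof. exact: (measurableT_comp um (measurable_pair2 w)). Qed.

Lemma measurable_norm2_gen : measurable_fun setT (fun x => nrm (u x)).
Proof.
apply: (measurableT_comp (continuous_measurable_fun (@sqrt_continuous R))).
apply: (measurableT_comp (fine_measurable measurableT)) => //.
have m2 : measurable_fun setT (fun z : X * T => (u z.1 z.2 * u z.1 z.2)%:E).
  by apply/measurable_EFinP; exact: measurable_funM.
by apply: (measurable_fun_fubini_tonelli_F _ m2) => z;
  rewrite lee_fin -expr2 sqr_ge0.
Qed.

Variable h : X -> R.
Hypothesis mh : measurable_fun setT h.
Hypothesis ih : {ae P, forall w, dx.-integrable setT (fun x => (h x * u x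
  w)%:E)}.

Let F (z : X * T) : \bar R := (`|h z.1 * u z.1 z.2|)%:E.
Let F0 z : (0 <= F z)%E. Proof. by rewrite lee_fin. Qed.
Let mh1 : measurable_fun setT (fun z : X * T => h z.1).
Proof. exact: (measurableT_comp mh). Qed.
Let mF : measurable_fun setT F.
Proof.
by apply/measurable_EFinP; apply: measurableT_comp => //;
  exact: measurable_funM.
Qed.

Let Phi w : \bar R := (\int[dx]_x F (x, w))%E.
Let mPhi : measurable_fun setT Phi.
Proof. exact: measurable_fun_fubini_tonelli_G. Qed.
Let Phi0 w : (0 <= Phi w)%E. Proof. exact: integral_ge0. Qed.

Let mPhi_lt (k : \bar R) : measurable [set w | (k < Phi w)%E].
Proof.
by rewrite -[X in measurable X]setTI;
  exact: (emeasurable_fun_o_infty measurableT).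
Qed.

Let mPhi_infty : measurable [set w | Phi w = +oo%E].
Proof.
have := mPhi measurableT (emeasurable_set1 +oo%E).
by rewrite setTI.
Qed.

Let Phi_fin : P [set w | Phi w = +oo%E] = 0%E.
Proof.
have [N [mN N0 hN]] := ih.
apply: (subset_measure0 mPhi_infty mN _ N0).
move=> w /= Pw; apply: hN => /= /integrableP[_].
by rewrite -/(Phi w) Pw ltxx.
Qed.

(* [Phi] is finite almost everywhere, hence bounded with large probability *)
Let Phi_bounded : exists2 K : R, 0 <= K & Ex (\1_[set w | (K%:E < Phi w)%E]) <=
  16^-1.
Proof.
pose f (k : nat) : T -> R := \1_[set w | (k%:R%:E < Phi w)%E].
have mf k : measurable_fun setT (f k) by apply: measurable_indic;
  exact: mPhi_lt.
have cf w : f k w @[k --> \oo] --> (\1_[set w | Phi w = +oo%E] w : R).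
  apply: (@cvg_near_cst _ _ _ _ _ _); rewrite /f.
  case E : (Phi w) => [r| |].
  - near=> k; rewrite !indicE !memNset//=; first by rewrite E.
    rewrite E lte_fin; apply/negP; rewrite -leNgt.
    by near: k; exact: nbhs_infty_ger.
  - by apply: nearW => k; rewrite !indicE !mem_set//= E ltry.
  - by have := Phi0 w; rewrite E.
have df k w : `|f k w| <= 1.
  by rewrite /f indicE; case: (_ \in _); rewrite ?normr1 ?normr0.
have [_] := Ex_dominated mf cf (integrable_cst P 1) df.
rewrite (Ex_indic P mPhi_infty) Phi_fin/= => cE.
have : \forall k \near \oo, Ex (f k) < 16^-1 by apply: (cvgr_lt 0) => //;
  rewrite invr_gt0.
move=> [k _ /(_ k (leqnn k))] hk; exists k%:R => //; exact: ltW.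
Unshelve. all: end_near. Qed.

(* On the event [A] where the integral of |h u| is at most [K], the
   anticoncentration bound compares the L2 norm of [u x] with E[|u x|; A]. *)
Lemma integrable_kernel_norm2 : dx.-integrable setT (fun x => (`|h x| * nrm (u
  x))%:E).
Proof.
have mhn : measurable_fun setT (fun x => `|h x| * nrm (u x)).
  by apply: measurable_funM;
    [exact: measurableT_comp|exact: measurable_norm2_gen].
have [K K0 PK] := Phi_bounded; set N := [set w | _] in PK.
have mN : measurable N by exact: mPhi_lt.
pose A := ~` N; have mA : measurable A by exact: measurableC.
pose kap x := Ex (fun w => `|u x w| * \1_A w).
have iuA x : ig (fun w => `|u x w| * \1_A w).
  apply: integrable_mul_bounded; last exact: bounded_measurable_indic.
  exact/integrable_normr/square_integrable_integrable.
have kap0 x : 0 <= kap x by apply: Ex_ge0 => w; rewrite mulr_ge0.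
have rho_le x : nrm (u x) <= 160 * kap x.
  (* By Markov's inequality on the complement of [N], P(|u x| > dl) <= P(N) + kap x / dl <= 1/16 +
     1/16. The constant 160 is 10 times 16, and e / 10 keeps [dl] positive when [kap x] vanishes. *)
  apply/ler_addgt0Pr => e e0; pose dl := 16 * kap x + e / 10.
  have dl0 : 0 < dl by rewrite ltr_wpDl ?mulr_ge0 ?divr_gt0.
  have -> : 160 * kap x + e = 10 * dl by rewrite /dl; field.
  apply: (gspace_anticoncentration hu (gspace_gen x) dl0).
  have [mux _] := sqx x.
  have mB : measurable [set w | dl < `|u x w|].
    by apply: measurable_gt_set; exact: measurableT_comp.
  rewrite -Ex_indic//.
  have i1 := integrable_scale dl^-1 (iuA x).
  have i2 := integrable_indicator P mN.
  apply: (@le_trans _ _ (Ex (fun w => \1_N w + dl^-1 * (`|u x w| * \1_A w)))).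
    apply: le_Ex; [exact: integrable_indicator|exact: integrable_add|move=> w].
    rewrite (_ : \1_A w = 1 - \1_N w); last first.
      by rewrite !indicE in_setC; case: (w \in N); rewrite ?subrr ?subr0.
    rewrite !indicE; have [wN|wN] := boolP (w \in N).
      by rewrite subrr !mulr0 addr0; case: (_ \in _).
    rewrite subr0 mulr1 add0r.
    have [/set_mem/= wB|_] := boolP (w \in [set w | dl < `|u x w|]).
      by rewrite mulrC ler_pdivlMr// mul1r ltW.
    by rewrite mulr_ge0// invr_ge0 ltW.
  rewrite Ex_add// Ex_scale// -/(kap x).
  have : dl^-1 * kap x <= 16^-1.
    by rewrite mulrC ler_pdivrMr// /dl; lra.
  move: PK; lra.
have mG : measurable_fun setT
    (fun z : X * T => (`|h z.1 * u z.1 z.2| * \1_A z.2)%:E).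
  apply/measurable_EFinP; apply: measurable_funM; first exact/measurable_EFinP.
  have m1A : measurable_fun setT (\1_A : T -> R) by exact: measurable_indic.
  exact: (measurableT_comp m1A measurable_snd).
have G0 (z : X * T) : (0 <= (`|h z.1 * u z.1 z.2| * \1_A z.2)%:E)%E.
  by rewrite lee_fin mulr_ge0.
apply/integrableP; split; first exact/measurable_EFinP.
(* By Tonelli the integral of |h| [kap] is E[Phi; A], and Phi <= K on A. *)
apply: (@le_lt_trans _ _ (\int[dx]_x (160%:E * \int[P]_w (`|h x * u x w| * \1_A
  w)%:E))%E).
  apply: ge0_le_integral => //.
  - by apply/measurableT_comp => //; exact/measurable_EFinP.
  - apply: emeasurable_funM => //.
    exact: (measurable_fun_fubini_tonelli_F _ mG G0).
  move=> x _; rewrite abse_EFin ger0_norm ?mulr_ge0 ?norm2_ge0//.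
  rewrite (_ : (\int[P]_w _)%E = (`|h x| * kap x)%:E); last first.
    rewrite /kap -Ex_scale// EFin_Ex; last exact: integrable_scale.
    by apply: eq_integral => w _; rewrite normrM mulrA.
  by rewrite -EFinM lee_fin mulrCA ler_wpM2l.
rewrite ge0_integralZl//; last 2 first.
  - exact: (measurable_fun_fubini_tonelli_F _ mG G0).
  - by move=> x _; apply: integral_ge0 => w _; rewrite lee_fin mulr_ge0.
rewrite (fubini_tonelli _ mG G0).
apply: (@le_lt_trans _ _ (160%:E * \int[P]_w K%:E)%E); last first.
  by rewrite integral_cst//= probability_setT mule1 -EFinM ltry.
apply: lee_wpmul2l => //; apply: ge0_le_integral => //.
- by move=> w _; apply: integral_ge0 => x _; rewrite lee_fin mulr_ge0.
- exact: (measurable_fun_fubini_tonelli_G _ mG G0).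
move=> w _ /=; rewrite indicE in_setC.
have [wN|wN] := boolP (w \in N) => /=.
  by under eq_integral do rewrite mulr0; rewrite integral0 lee_fin.
under eq_integral do rewrite mulr1.
rewrite -/(Phi w) leNgt; apply/negP => hK; move/negP: wN; apply; exact/mem_set.
Qed.

Let I (w : T) : R := \int[dx]_x (h x * u x w).

Let C := fine (\int[dx]_x (`|h x| * nrm (u x))%:E)%E.

Let CE : (\int[dx]_x (`|h x| * nrm (u x))%:E)%E = C%:E.
Proof.
by rewrite /C fineK//; apply: integrable_fin_num => //;
  exact: integrable_kernel_norm2.
Qed.

Let C0 : 0 <= C.
Proof. by apply: Rintegral_ge0 => x _; rewrite mulr_ge0 ?norm2_ge0. Qed.

Lemma Ex_norm_mul_le (Y Z : T -> R) : sq Y -> sq Z ->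
  Ex (fun w => `|Y w * Z w|) <= nrm Y * nrm Z.
Proof.
have sqn V : sq V -> sq (fun w => `|V w|) /\ nrm (fun w => `|V w|) = nrm V.
  move=> [mV iV]; split.
    split; first exact: measurableT_comp.
    by apply: eq_integrable iV => // w _ /=; rewrite real_normK ?num_real.
  congr Num.sqrt; apply: eq_Rintegral => w _.
  by rewrite -!expr2 real_normK ?num_real.
move=> /sqn[sY <-] /sqn[sZ <-].
apply: le_trans (norm_inner_le sY sZ); rewrite (le_trans _ (ler_norm _))//.
rewrite le_eqVlt; apply/orP; left; apply/eqP.
by apply: eq_Rintegral => w _; rewrite normrM.
Qed.

(** The Cauchy-Schwarz inequality at each x; it gives the absolute integrability that Fubini's
    theorem requires of h u Z. *)
Let integral_kernel_mul_le Z : sq Z ->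
  (\int[dx]_x \int[P]_w (`|h x * u x w * Z w|)%:E <= (C * nrm Z)%:E)%E.
Proof.
move=> sZ; have [mZ _] := sZ.
have i1 := integrable_kernel_norm2.
apply: (@le_trans _ _ (\int[dx]_x ((`|h x| * nrm (u x))%:E * (nrm Z)%:E))%E);
  last first.
  by rewrite integralZr// CE EFinM.
apply: ge0_le_integral => //.
- by move=> x _; apply: integral_ge0 => w _; rewrite lee_fin.
- apply: (measurable_fun_fubini_tonelli_F (fun z : X * T => (`|h z.1 * u z.1 z.2
  * Z z.2|)%:E)) => //.
  apply/measurable_EFinP; apply: measurableT_comp => //; apply: measurable_funM.
    exact: measurable_funM.
  exact: (measurableT_comp mZ measurable_snd).
- by apply: emeasurable_funM => //; exact: (measurable_int _ i1).
move=> x _; have i2 := square_integrable_mul (sqx x) sZ.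
rewrite (_ : (\int[P]_w _)%E = (`|h x| * Ex (fun w => `|u x w * Z w|))%:E);
  last first.
  rewrite -Ex_scale; last exact: integrable_normr.
  rewrite EFin_Ex; last exact/integrable_scale/integrable_normr.
  by apply: eq_integral => w _; rewrite -normrM mulrA.
by rewrite -EFinM lee_fin -mulrA ler_wpM2l// Ex_norm_mul_le.
Qed.

Let integrable_kernel_mul Z : sq Z ->
  (dx \x P)%E.-integrable setT (fun z : X * T => (h z.1 * u z.1 z.2 * Z
    z.2)%:E).
Proof.
move=> sZ; have [mZ _] := sZ; apply/integrable12ltyP.
  apply/measurable_EFinP; apply: measurable_funM; first exact: measurable_funM.
  exact: (measurableT_comp mZ measurable_snd).
by apply: le_lt_trans (integral_kernel_mul_le sZ) _; rewrite ltry.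
Qed.

Let mI : measurable_fun setT I.
Proof.
apply: (measurableT_comp (fine_measurable measurableT)) => //.
have := measurable_fubini_G (integrable_kernel_mul (square_integrable_cst P 1)).
apply: eq_measurable_fun => w _; apply: eq_integral => x _.
by rewrite mulr1.
Qed.

Let norm_I_le w : ((`|I w|)%:E <= Phi w)%E.
Proof.
have [iw|niw] := pselect (dx.-integrable setT (EFin \o (fun x => h x * u x w))).
  by rewrite EFin_normr_Rintegral//; apply: le_abse_integral => //;
    exact: (measurable_int dx).
(* Where the section is not integrable, [Phi w] is infinite and the bound holds whatever default
   value [I w] takes. *)
suff -> : Phi w = +oo%E by rewrite leey.
apply/eqP; rewrite -leye_eq leNgt; apply/negP => hP; apply: niw.
apply/integrableP; split=> //.
by apply/measurable_EFinP; apply: measurable_funM => //;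
  exact: measurable_section.
Qed.

(** Minkowski's integral inequality in L2: Phi^2 is expanded into a double space integral, and
    E|u(x) u(y)| <= ||u(x)|| ||u(y)||. *)
Let integral_Phi2 : (\int[P]_w (Phi w * Phi w) <= (C * C)%:E)%E.
Proof.
have mFx w : measurable_fun setT (fun x => F (x, w)).
  exact: (measurableT_comp mF (measurable_pair2 w)).
have mFw x : measurable_fun setT (fun w => F (x, w)).
  exact: (measurableT_comp mF (measurable_pair1 x)).
have e1 : (\int[P]_w (Phi w * Phi w) = \int[P]_w \int[dx]_x (F (x, w) * Phi
  w))%E.
  by apply: eq_integral => w _; rewrite ge0_integralZr.
have m1 : measurable_fun setT (fun z : X * T => (F z * Phi z.2)%E).
  apply: emeasurable_funM => //.
  exact: (measurableT_comp mPhi measurable_snd).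
rewrite e1 -(fubini_tonelli (fun z => F z * Phi z.2)%E) => [|//|z];
  last by rewrite mule_ge0.
have i1 := integrable_kernel_norm2.
have m2 : measurable_fun setT (fun x => (`|h x| * nrm (u x))%:E) by exact:
  (measurable_int _ i1).
apply: (@le_trans _ _ (\int[dx]_x ((`|h x| * nrm (u x))%:E * C%:E))%E);
  last first.
  by rewrite integralZr// CE EFinM.
apply: ge0_le_integral => //.
- by move=> x _; apply: integral_ge0 => w _; rewrite mule_ge0.
- apply: (measurable_fun_fubini_tonelli_F _ m1) => z; by rewrite mule_ge0.
- exact: emeasurable_funM.
move=> x _ /=.
have e2 : (\int[P]_w (F (x, w) * Phi w) = \int[P]_w \int[dx]_y (F (x, w) * F (y,
  w)))%E.
  by apply: eq_integral => w _; rewrite ge0_integralZl.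
have m3 : measurable_fun setT (fun z : X * T => (F (x, z.2) * F z)%E).
  by apply: emeasurable_funM => //;
    exact: (measurableT_comp (mFw x) measurable_snd).
rewrite e2 -(fubini_tonelli (fun z => F (x, z.2) * F z)%E) => [|//|z];
  last by rewrite mule_ge0.
rewrite -CE -ge0_integralZl//; last 2 first.
- by move=> y _; rewrite lee_fin mulr_ge0 ?norm2_ge0.
- by rewrite lee_fin mulr_ge0 ?norm2_ge0.
apply: ge0_le_integral => //.
- by move=> y _; apply: integral_ge0 => w _; rewrite mule_ge0.
- apply: (measurable_fun_fubini_tonelli_F _ m3) => z; by rewrite mule_ge0.
- exact: emeasurable_funM.
move=> y _; have i2 := square_integrable_mul (sqx x) (sqx y).
rewrite (_ : (\int[P]_w _)%E = (`|h x| * `|h y| * Ex (fun w => `|u x w * u y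
  w|))%:E); last first.
  rewrite -Ex_scale; last exact: integrable_normr.
  rewrite EFin_Ex; last exact/integrable_scale/integrable_normr.
  apply: eq_integral => w _; rewrite -EFinM; congr EFin.
  by rewrite /= !normrM; ring.
rewrite -EFinM lee_fin (_ : _ * _ * (_ * _) = `|h x| * `|h y| * (nrm (u x) * nrm
  (u y))); last by ring.
by rewrite ler_wpM2l// Ex_norm_mul_le.
Qed.

Let sqI : sq I.
Proof.
split=> //; apply/integrableP; split.
  by apply/measurable_EFinP; exact: measurable_funX.
apply: le_lt_trans (le_lt_trans integral_Phi2 (ltry _)).
apply: ge0_le_integral => //.
- apply/measurable_EFinP; apply: measurableT_comp => //; exact: measurable_funX.
- exact: emeasurable_funM.
move=> w _; rewrite /= normrX expr2 EFinM.
by apply: lee_pmul => //; rewrite lee_fin.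
Qed.

Lemma kernel_inner Z : sq Z ->
  dx.-integrable setT (fun x => (h x * ip (u x) Z)%:E) /\
  ip I Z = \int[dx]_x (h x * ip (u x) Z).
Proof.
move=> sZ; have iz := integrable_kernel_mul sZ; have [mZ _] := sZ.
have e x : (\int[P]_w (h x * u x w * Z w)%:E = (h x * ip (u x) Z)%:E)%E.
  have i2 := square_integrable_mul (sqx x) sZ.
  rewrite -Ex_scale// EFin_Ex; last exact: integrable_scale.
  by apply: eq_integral => w _; rewrite mulrA.
split.
  have := integrable_fubini_F iz.
  by apply: eq_integrable => // x _; rewrite -e.
have := Fubini iz; rewrite /=.
under eq_integral do rewrite e.
move=> E; rewrite /Rintegral E /inner /Rintegral; congr fine.
have mIZ : measurable_fun setT (fun w => (I w * Z w)%:E).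
  by apply/measurable_EFinP; exact: measurable_funM.
apply: ae_eq_integral => //.
  exact: (measurable_fubini_G iz).
(* The factor Z w leaves the space integral only for realizations with an integrable section; the
   others form a null set. *)
have [N [mN N0 hN]] := ih; exists N; split=> // w /= nE; apply: hN => /= iw.
apply: nE => _; rewrite -/(I w).
have iw' : dx.-integrable setT (EFin \o (fun x => h x * u x w)) by [].
transitivity ((\int[dx]_x (h x * u x w)%:E) * (Z w)%:E)%E.
  by rewrite EFinM /I /Rintegral fineK//; exact: integrable_fin_num.
by rewrite -integralZr.
Qed.

(** The weak criterion replaces any approximation of the integral by sums: if |<e, u(x)>| <= eta
    ||u(x)|| for all x, then |<e, I>| <= eta times the integral of |h| ||u(x)||, which is C eta. *)
Lemma kernel_gspace : gspace I.
Proof.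
apply: (gspace_weakly_closed hu sqI C0) => e eta se eta0 he.
have [i1 ->] : dx.-integrable setT (fun x => (h x * ip (u x) e)%:E) /\
    ip e I = \int[dx]_x (h x * ip (u x) e).
  by have [? <-] := kernel_inner se; rewrite innerC.
have i2 := integrable_kernel_norm2.
have i3 : dx.-integrable setT (EFin \o (fun x => `|h x * ip (u x) e|)).
  exact: integrable_abse i1.
apply: le_trans (le_normr_Rintegral _ _) _ => //.
rewrite /C mulrC -[fine _]/(\int[dx]_x (`|h x| * nrm (u x))) -RintegralZl//.
apply: le_Rintegral => //.
  by have := integrableZl measurableT eta i2; apply: eq_integrable.
move=> x _; rewrite normrM mulrCA ler_wpM2l//.
by rewrite innerC he.
Qed.

End kernel.

(** * Almost sure limits in the Gaussian space are L2 limits *)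

Section ae_limit.
Context {d} {T : measurableType d} {R : realType} (P : probability T R).
Local Notation Ex := (Rintegral P setT).
Local Notation ig Y := (P.-integrable setT (EFin \o Y)).
Local Notation sq := (square_integrable P).
Local Notation nrm := (norm2 P).
Local Notation ip := (inner P).

(** The Cauchy criterion with countable quantifiers only, so that the convergence set is visibly
    measurable. *)
Lemma cvgn_cauchyE (a : R^nat) : cvgn a <->
  forall k : nat, exists m, forall n, `|a (m + n)%N - a m| <= k.+1%:R^-1.
Proof.
split=> [/cvg_cauchy/cauchy_ballP ca k|h].
  have k0 : 0 < (k.+1%:R^-1 : R) by rewrite invr_gt0.
  have := ca _ k0; rewrite near_map2 => -[[A B] /= [[m1 _ hA] [m2 _ hB]] AB].
  exists (maxn m1 m2) => n.
  have := AB ((maxn m1 m2 + n)%N, maxn m1 m2).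
  rewrite /ball/= => hh; apply/ltW/hh; split.
    by apply: hA => /=; rewrite (leq_trans (leq_maxl m1 m2))// leq_addr.
  by apply: hB => /=; exact: leq_maxr.
apply: cauchy_cvg; apply: cauchy_exP => e e0.
have [m hm] := h (Num.truncn e^-1).
exists (a m); exists m => // n /= mn; rewrite -(subnKC mn) /ball/= distrC.
apply: le_lt_trans (hm _) _; rewrite invf_plt ?posrE//.
exact: truncnS_gt.
Qed.

Variables (I_ : nat -> T -> R).
Hypothesis mI : forall n, measurable_fun setT (I_ n).
Let C := [set w | cvgn (I_ ^~ w)].
Let U w := limn (I_ ^~ w).

Lemma measurable_cvgn_set : measurable C.
Proof.
rewrite (_ : C = \bigcap_k \bigcup_m \bigcap_n
    [set w | `|I_ (m + n)%N w - I_ m w| <= k.+1%:R^-1]).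
  apply: bigcap_measurable => // k _; apply: bigcup_measurable => m _.
  apply: bigcap_measurable => // n _.
  rewrite (_ : [set w | _] = ~` [set w | k.+1%:R^-1 < `|I_ (m + n)%N w - I_ m
    w|]).
    apply/measurableC/measurable_gt_set; apply: measurableT_comp => //.
    exact: measurable_funB.
  by apply/seteqP; split=> w /=; [move=> h; apply/negP;
    rewrite -leNgt|move/negP; rewrite -leNgt].
apply/seteqP; split=> w /=.
  by move=> /cvgn_cauchyE h k _; have [m hm] := h k; exists m => // n _;
    exact: hm.
move=> h; apply/cvgn_cauchyE => k; have [m _ hm] := h k I.
by exists m => n; exact: hm.
Qed.

(* Off the convergence set [limn] is the junk value [point]. *)
Lemma measurable_limn : measurable_fun setT U.
Proof.
pose p : R := point.
apply: (@measurable_fun_cvg _ _ _ _ (fun n w => I_ n w * \1_C w + p * \1_(~` C)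
  w)).
  have mC := measurable_cvgn_set.
  move=> n; apply: measurable_funD; apply: measurable_funM => //;
    apply: measurable_indic => //.
  exact: measurableC.
move=> w _; rewrite !indicE in_setC; have [wC|wC] := boolP (w \in C) => /=.
  rewrite -[U w](_ : U w * 1 + p * 0 = U w); last by rewrite mulr1 mulr0 addr0.
  apply: cvgD; last exact: cvg_cst.
  by apply: cvgMl; move/set_mem: wC.
rewrite (_ : U w = p); last first.
  by apply: dvgP => cw; move/negP: wC; apply; apply/mem_set.
rewrite (_ : (fun n => _) = cst p); first exact: cvg_cst.
by apply/funext => n; rewrite mulr0 mulr1 add0r.
Qed.

Variables (X : Type) (u : X -> T -> R).
Hypothesis hu : forall (n : nat) (x : 'I_n -> X) (t : 'I_n -> R),
    gaussian_rv P (fun w => \sum_(i < n) t i * u (x i) w).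
Local Notation gspace := (gspace P u).
Hypothesis gI : forall n, gspace (I_ n).
Hypothesis cI : {ae P, forall w, cvgn (I_ ^~ w)}.

Let PC : P (~` C) = 0%E.
Proof.
have [N [mN N0 hN]] := cI.
by apply: (subset_measure0 _ mN _ N0) => //; apply: measurableC;
  exact: measurable_cvgn_set.
Qed.

(** Dominated convergence of the indicators on the convergence set, whose complement is null. The
    bound 1/16 is half the anticoncentration threshold. *)
Let cvg_in_probability e : 0 < e ->
  \forall n \near \oo, Ex (\1_[set w | e < `|I_ n w - U w|]) <= 16^-1.
Proof.
move=> e0; have mC := measurable_cvgn_set; have mU := measurable_limn.
have mE n : measurable [set w | e < `|I_ n w - U w|].
  by apply: measurable_gt_set; apply: measurableT_comp => //;
    exact: measurable_funB.
pose f n w : R := \1_C w * \1_[set w | e < `|I_ n w - U w|] w.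
have mf n : measurable_fun setT (f n).
  by apply: measurable_funM; exact: measurable_indic.
have cf w : f n w @[n --> \oo] --> (0 : R).
  rewrite /f indicE; have [/set_mem wC|_] := boolP (w \in C); last first.
    by under eq_fun do rewrite mul0r; exact: cvg_cst.
  apply: (@cvg_near_cst _ _ _ _ _ _).
  have /cvgrPdist_le/(_ _ e0) : I_ n w @[n --> \oo] --> U w by [].
  apply: filterS => n hn; rewrite indicE memNset ?mulr0//= distrC.
  by apply/negP; rewrite -leNgt.
have df n w : `|f n w| <= 1.
  by rewrite /f !indicE; case: (_ \in _); case: (_ \in _);
     rewrite ?mulr1 ?mulr0 ?normr1 ?normr0.
have [_] := Ex_dominated mf cf (integrable_cst P 1) df.
rewrite Ex_cst => cE.
have : \forall n \near \oo, Ex (f n) < 16^-1 by apply: (cvgr_lt 0) => //;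
  rewrite invr_gt0.
apply: filterS => n hn; apply: le_trans (ltW hn).
have if_ : ig (f n) by exact: integrable_bounded (mf n) (df n).
have iC := integrable_indicator P (measurableC mC).
apply: (@le_trans _ _ (Ex (fun w => f n w + \1_(~` C) w))).
  apply: le_Ex; [exact: integrable_indicator|exact: integrable_add|move=> w].
  rewrite /f !indicE in_setC; case: (w \in C); case: (_ \in _) => //=;
  by rewrite ?mulr1 ?mulr0 ?addr0 ?add0r ?lexx.
by rewrite Ex_add// (Ex_indic P (measurableC mC)) PC addr0.
Qed.

(** If I_m and I_n are both within e of the limit, they are within 2 e of each other; the
    exceptional probability is at most 1/16 + 1/16, and anticoncentration at 2 e gives 10 (2 e). *)
Let norm2_cauchy e : 0 < e -> \forall n \near \oo, forall m, (n <= m)%N ->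
  nrm (fun w => I_ m w - I_ n w) <= 20 * e.
Proof.
move=> e0; have [N _ hN] := cvg_in_probability e0.
exists N => // n /= Nn m nm.
have mU := measurable_limn.
have mE k : measurable [set w | e < `|I_ k w - U w|].
  by apply: measurable_gt_set; apply: measurableT_comp => //;
    exact: measurable_funB.
rewrite (_ : 20 * e = 10 * (2 * e)); last by ring.
apply: (gspace_anticoncentration hu); first exact: gspace_sub.
  by rewrite mulr_gt0.
have mE2 : measurable [set w | 2 * e < `|I_ m w - I_ n w|].
  by apply: measurable_gt_set; apply: measurableT_comp => //;
    exact: measurable_funB.
rewrite -Ex_indic//.
have i1 := integrable_indicator P (mE m);
  have i2 := integrable_indicator P (mE n).
apply: (@le_trans _ _ (Ex (fun w => \1_[set w | e < `|I_ m w - U w|] w +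
    \1_[set w | e < `|I_ n w - U w|] w))).
  apply: le_Ex; [exact: integrable_indicator|exact: integrable_add|move=> w].
  rewrite !indicE.
  have [/set_mem/= h|_] := boolP (w \in [set w | 2 * e < `|I_ m w - I_ n w|]);
    last first.
    by rewrite addr_ge0.
  have [|h1] := boolP (w \in [set w | e < `|I_ m w - U w|]);
    first by rewrite lerDl.
  rewrite add0r mem_set//= ltNge; apply/negP => h2.
  move: h; rewrite ltNge; apply/negP/negPn.
  have {}h1 : `|I_ m w - U w| <= e.
    by rewrite leNgt; apply/negP => h; move/negP: h1; apply; exact/mem_set.
  rewrite (_ : I_ m w - I_ n w = (I_ m w - U w) - (I_ n w - U w)); last by ring.
  by apply: le_trans (ler_normB _ _) _; lra.
rewrite Ex_add//; have := hN m (leq_trans Nn nm); have := hN n Nn => /=; lra.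
Qed.

(** Fatou's lemma in m, with n fixed, carries the Cauchy bound to the limit; square integrability of
    the limit is part of the outcome. *)
Let norm2_limit e : 0 < e -> \forall n \near \oo,
  sq (fun w => U w - I_ n w) /\ nrm (fun w => U w - I_ n w) <= 20 * e.
Proof.
move=> e0; have mC := measurable_cvgn_set; have mU := measurable_limn.
apply: filterS (norm2_cauchy e0) => n hn.
(* The factor [\1_C] makes the sequence converge at every w, including those where [U] is a default
   value. *)
pose f m w := (\1_C w * (I_ m w - I_ n w) ^+ 2)%:E.
have mf m : measurable_fun setT (f m).
  apply/measurable_EFinP; apply: measurable_funM; first exact: measurable_indic.
  by apply: measurable_funX; exact: measurable_funB.
have f0 m w : setT w -> (0 <= f m w)%E by move=> _;
  rewrite lee_fin mulr_ge0 ?sqr_ge0.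
have := fatou P measurableT mf f0.
have mUI : measurable_fun setT (fun w => U w - I_ n w) by exact:
  measurable_funB.
have sqD m : sq (fun w => I_ m w - I_ n w).
  by apply: square_integrable_sub; exact: gspace_sq (gI _).
have -> : (\int[P]_w limn_einf (f ^~ w) = \int[P]_w ((U w - I_ n w) ^+ 2)%:E)%E.
  transitivity (\int[P]_w (\1_C w * (U w - I_ n w) ^+ 2)%:E)%E.
    apply: eq_integral => w _.
    suff cw : f m w @[m --> \oo] --> (\1_C w * (U w - I_ n w) ^+ 2)%:E.
      rewrite is_cvg_limn_einfE; last by apply/cvg_ex; eexists; exact: cw.
      exact/cvg_lim.
    apply: cvg_EFin; first exact: nearW.
    rewrite /comp/= indicE; have [/set_mem wC|_] := boolP (w \in C); last first.
      by under eq_fun do rewrite mul0r; rewrite mul0r; exact: cvg_cst.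
    apply: cvgMr; rewrite expr2; under eq_fun do rewrite expr2.
    by apply: cvgM; apply: cvgB => //; exact: cvg_cst.
  apply: ae_eq_integral => //.
  - apply/measurable_EFinP; apply: measurable_funM;
    first exact: measurable_indic.
    exact: measurable_funX.
  - by apply/measurable_EFinP; exact: measurable_funX.
  exists (~` C); split=> //; first exact: measurableC.
  move=> w /= h wC; apply: h => _.
  by rewrite indicE mem_set// mul1r.
move=> fat.
have bnd : (\int[P]_w ((U w - I_ n w) ^+ 2)%:E <= ((20 * e) ^+ 2)%:E)%E.
  rewrite limn_einf_lim in fat; apply: (le_trans fat); apply: lime_le;
    first exact: is_cvg_einfs.
  (* Every tail contains the index max (k, n), to which the Cauchy bound applies. *)
  apply: nearW => k; apply: le_trans (ereal_inf_lbound _) _.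
    by exists (maxn k n) => //=; exact: leq_maxl.
  rewrite /f; apply: (@le_trans _ _ (\int[P]_w ((I_ (maxn k n) w - I_ n w) ^+
    2)%:E)%E).
    apply: ge0_le_integral => //.
    - by move=> w _; rewrite lee_fin mulr_ge0 ?sqr_ge0.
    - exact: mf.
    - by have [? /measurable_int] := sqD (maxn k n).
    move=> w _; rewrite lee_fin indicE; case: (w \in C);
      by rewrite ?mul1r ?mul0r ?sqr_ge0.
  have [_ i2] := sqD (maxn k n).
  have /= <- := @EFin_Ex _ _ _ P (fun w => (I_ (maxn k n) w - I_ n w) ^+ 2) i2.
  rewrite lee_fin.
  have sqe0 : 20 * e \is Num.nneg by rewrite nnegrE mulr_ge0// ltW.
  under eq_Rintegral do rewrite expr2.
  rewrite -/(ip _ _) -sqr_norm2 ler_sqr ?nnegrE ?norm2_ge0//.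
  exact: hn (leq_maxr k n).
have sD : sq (fun w => U w - I_ n w).
  split=> //; apply/integrableP; split.
    by apply/measurable_EFinP; exact: measurable_funX.
  apply: le_lt_trans (le_lt_trans bnd (ltry _)).
  rewrite le_eqVlt; apply/orP; left; apply/eqP; apply: eq_integral => w _.
  by rewrite abse_EFin ger0_norm ?sqr_ge0.
split=> //; rewrite -ler_sqr ?nnegrE ?norm2_ge0 ?mulr_ge0 ?(ltW e0)//.
have [_ i2] := sD; move: bnd.
have /= <- := @EFin_Ex _ _ _ P (fun w => (U w - I_ n w) ^+ 2) i2.
rewrite lee_fin sqr_norm2.
apply: le_trans; rewrite le_eqVlt; apply/orP; left; apply/eqP.
by apply: eq_Rintegral => w _; rewrite expr2.
Qed.

Lemma gspace_ae_limit : gspace U /\ nrm (fun w => U w - I_ n w) @[n --> \oo] -->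
  0.
Proof.
have sqU : sq U.
  have [n _ /(_ n (leqnn n))[sD _]] := norm2_limit ltr01.
  have := square_integrable_add sD (gspace_sq (gI n)).
  by congr (sq _); apply/funext => w; rewrite subrK.
split; last first.
  apply/cvgr0Pnorm_le => e e0; have e20 : 0 < e / 20 by rewrite divr_gt0.
  apply: filterS (norm2_limit e20) => n [_].
  by rewrite mulrC divfK// ger0_norm ?norm2_ge0.
apply: gspace_closed => // e e0; have e20 : 0 < e / 40 by rewrite divr_gt0.
have [n _ /(_ n (leqnn n))[_ hn]] := norm2_limit e20.
exists (I_ n) => //; apply: le_lt_trans hn _; lra.
Qed.

End ae_limit.

(** * Conditioning on collective variables *)

Section collective_variables.
Context {dX} {X : measurableType dX} {d} {T : measurableType d} {R : realType}.
Variables (dx : {sigma_finite_measure set X -> \bar R}) (P : probability T R).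
Local Notation Ex := (Rintegral P setT).
Local Notation ig Y := (P.-integrable setT (EFin \o Y)).
Local Notation sq := (square_integrable P).
Local Notation nrm := (norm2 P).
Local Notation ip := (inner P).
Local Notation cov := (cov P).
Variable u : X -> T -> R.
Hypothesis gu : gaussian_random_function P u.
Local Notation gspace := (gspace P u).

Let um := gu.1.
Let hu := gu.2.

Lemma inner_cstl (a : R) Y : sq Y -> ip (fun=> a) Y = a * Ex Y.
Proof. by move=> sY; exact/Ex_scale/square_integrable_integrable. Qed.

Lemma cov_centered Y Z : sq Y -> sq Z -> ip Y (fun w => Z w - Ex Z) = cov Y Z.
Proof.
move=> sY sZ; rewrite innerBr//; last exact: square_integrable_cst.
by rewrite (innerC _ Y (fun=> Ex Z)) inner_cstl// mulrC.
Qed.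

Lemma cov_sqr_le Y Z : sq Y -> sq Z -> cov Y Z ^+ 2 <= var P Y * var P Z.
Proof.
move=> sY sZ.
have sqc V : sq V -> sq (fun w => V w - Ex V).
  by move=> sV; apply: square_integrable_sub => //;
    exact: square_integrable_cst.
rewrite !varE//; suff -> : cov Y Z = ip (fun w => Y w - Ex Y) (fun w => Z w - Ex
  Z).
  by apply: inner_sqr_le; exact: sqc.
have Z0 : Ex (fun w => Z w - Ex Z) = 0.
  rewrite Ex_sub ?Ex_cst ?subrr//; first exact: square_integrable_integrable.
  exact: integrable_cst.
rewrite (innerBl sY (square_integrable_cst P _) (sqc _ sZ)) cov_centered//.
by rewrite (inner_cstl _ (sqc _ sZ)) Z0 mulr0 subr0.
Qed.

Section one_kernel.
Variable g : gen_fun X R.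
Hypothesis hg : admissible_kernel dx P u g.
Let U w := gen_int dx g (u^~ w).

Let smooth n w := \int[dx]_x (g n x * u x w).

Let smooth_int n : {ae P, forall w, dx.-integrable setT (fun x => (g n x * u x
  w)%:E)}.
Proof. by case: hg => _; apply: filterS => w [h _]; exact: h. Qed.

Let smooth_gspace n : gspace (smooth n).
Proof. by have [mg _] := hg; apply: kernel_gspace. Qed.

Let smooth_cvg : gspace U /\ nrm (fun w => U w - smooth n w) @[n --> \oo] --> 0.
Proof.
apply: (gspace_ae_limit _ hu smooth_gspace).
- by move=> n; have [[]] := smooth_gspace n.
- by case: hg => _; apply: filterS => w [_ h]; exact: h.
Qed.

Lemma gen_int_gspace : gspace U.
Proof. by have [] := smooth_cvg. Qed.

(** Exchanges the generalized integral with the expectation: Fubini's theorem handles each ordinary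
    kernel [g n], and L2 convergence of the smoothed variables handles the limit. *)
Lemma gen_int_inner Z : sq Z -> gen_int dx g (fun x => ip (u x) Z) = ip U Z.
Proof.
move=> sZ; have [gU cU] := smooth_cvg.
have sS n := gspace_sq (smooth_gspace n).
have [_ h _ _] := norm2_cvg0 (gspace_sq gU) sS cU.
rewrite /gen_int (_ : (fun n => _) = (fun n => ip (smooth n) Z)).
  by apply/cvg_lim => //; exact: h.
apply/funext => n; have [mg _] := hg.
by have [_ ->] := kernel_inner um hu (mg n) (smooth_int n) sZ.
Qed.

End one_kernel.

Lemma integral_setE (Y : T -> R) (A : set T) : ig Y -> measurable A ->
  (\int[P]_(w in A) (Y w)%:E)%E = (Ex (fun w => Y w * \1_A w))%:E.
Proof.
move=> iY mA; rewrite integral_mkcond EFin_Ex.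
  apply: eq_integral => w _; rewrite patchE indicE.
  by case: (w \in A); rewrite ?mulr1 ?mulr0.
apply: integrable_mul_bounded => //; exact: bounded_measurable_indic.
Qed.

(** * The regression formula and uniqueness of the continuous version *)

Section conditioning.
Variables (N : nat) (U : 'I_N -> T -> R).
Hypothesis gU : forall i, gspace (U i).
Let M : 'M[R]_N := \matrix_(i, j) cov (U i) (U j).
Hypothesis uM : M \in unitmx.
Let Uvec (w : T) : 'rV[R]_N := \row_i U i w.
Let sU i := gspace_sq (gU i).
Let mU i : measurable_fun setT (U i). Proof. by have [] := sU i. Qed.

(** By the Cauchy-Schwarz inequality a combination of zero variance is uncorrelated with every
    [U j], that is, t M = 0. *)
Lemma nondegenerate_lincomb t : var P (lincomb U t) = 0 -> forall i, t i = 0.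
Proof.
move=> v0.
have gL := gspace_lincomb hu t gU.
have h j : cov (U j) (lincomb U t) = 0.
  apply/eqP; rewrite -sqrf_eq0 eq_le sqr_ge0 andbT.
  by rewrite (le_trans (cov_sqr_le _ (gspace_sq gL)))// v0 mulr0.
have : (\row_i t i) *m M = 0.
  apply/rowP => j; rewrite !mxE -[RHS](h j) cov_lincomb//.
  by apply: eq_bigr => i _; rewrite !mxE covC.
move/(congr1 (mulmx^~ (invmx M))); rewrite mulmxK// mul0mx => /rowP t0 i.
by have := t0 i; rewrite !mxE.
Qed.

Lemma collective_full_support (V : 'rV[R]_N) (r : R) : 0 < r ->
  0 < Ex (\1_[set w | forall i, `|U i w - V ord0 i| < r]).
Proof.
move=> r0.
(* Extension by zero beyond [N], to fit the statement indexed by [nat]. *)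
pose U' (k : nat) : T -> R := if insub k is Some i then U i else fun=> 0.
pose V' (k : nat) : R := if insub k is Some i then V ord0 i else 0.
have U'E (i : 'I_N) : U' i = U i by rewrite /U' valK.
have V'E (i : 'I_N) : V' i = V ord0 i by rewrite /V' valK.
have gU' k : gspace (U' k).
  by rewrite /U'; case: insub => [i|];
    [exact: gU|exact/gspace_span/finite_span0].
have := @gspace_full_support _ _ _ P X u hu N U' V' r gU'.
rewrite (_ : (fun i : 'I_N => U' i) = U); last by apply/funext => i;
  rewrite U'E.
move=> /(_ nondegenerate_lincomb r0).
rewrite (_ : [set w | _] = [set w | forall i, `|U i w - V ord0 i| < r])//.
by apply/seteqP; split=> w /= h i; have := h i; rewrite U'E V'E.
Qed.

Lemma preimage_generated (B : set 'rV[R]_N) : <<s open >> B ->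
  generated_sigma U (Uvec @^-1` B).
Proof. exact: generated_sigma_preimage. Qed.

(** If phi1 exceeded phi2 at V, the difference would exceed half its value at V on an open set B
    around V. Both versions have the same integral over the event U in B, so this event would be
    null, against full support. *)
Lemma continuous_cond_version_le (O : T -> R) (phi1 phi2 : 'rV[R]_N -> R) V :
  continuous_cond_version P Uvec O phi1 -> continuous_cond_version P Uvec O phi2
    ->
  phi1 V <= phi2 V.
Proof.
move=> [c1 i1 h1] [c2 i2 h2]; rewrite leNgt; apply/negP => lt12.
pose psi v := phi1 v - phi2 v.
have cpsi : continuous psi by move=> v; exact: (cvgB (c1 v) (c2 v)).
have D0 : 0 < psi V / 2 by rewrite divr_gt0// subr_gt0.
pose B := [set v | psi V / 2 < psi v].
have oB : open B by exact: (open_comp (fun v _ => cpsi v) (@open_gt R (psi V /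
  2))).
have BV : B V by rewrite /B/= ltr_pdivrMr// ltr_pMr ?subr_gt0// ltr1n.
have sB : <<s open >> B by exact: sub_gen_smallest.
have mA : measurable (Uvec @^-1` B).
  exact: (generated_sigma_measurable P mU (preimage_generated sB)).
set A := Uvec @^-1` B in mA.
have iA := integrable_indicator P mA.
have := h1 _ sB; rewrite (h2 _ sB) -/A.
rewrite (integral_setE i1 mA) (integral_setE i2 mA) => -[E].
have bA : bounded_measurable (\1_A : T -> R)
  by exact: bounded_measurable_indic.
have j1 := integrable_mul_bounded i1 bA.
have j2 := integrable_mul_bounded i2 bA.
have : psi V / 2 * Ex (\1_A) <= 0.
  rewrite -(subrr (Ex (fun w => phi1 (Uvec w) * \1_A w))) -{2}E -Ex_sub//.
  rewrite -Ex_scale//; apply: le_Ex;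
    [exact: integrable_scale|exact: integrable_sub|].
  move=> w; rewrite -mulrBl indicE.
  have [/set_mem wA|_] := boolP (w \in A); last by rewrite !mulr0.
  by rewrite !mulr1 ltW.
rewrite pmulr_rle0// leNgt => /negP; apply.
have [e /= e0 eB] := (nbhs_ballP _ _).1 (open_nbhs_nbhs (conj oB BV)).
apply: lt_le_trans (collective_full_support V e0) _.
apply: le_Ex => //.
  apply: integrable_indicator; apply: (generated_sigma_measurable P mU _).
  exact: (@generated_sigma_box _ _ _ U N id (fun i => V ord0 i) e).
move=> w; rewrite !indicE.
have [/set_mem/= h|_] := boolP (w \in [set w | forall i, `|U i w - V ord0 i| <
  e]); last by [].
rewrite mem_set//; apply: eB; rewrite /ball/= /mx_ball; split=> // i j.
by rewrite (ord1 i) mxE /ball/= distrC.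
Qed.

Variable O : T -> R.
Hypothesis gO : gspace O.
Let sO := gspace_sq gO.
Let c j := \sum_(i < N) cov O (U i) * invmx M i j.
Let phi (V : 'rV[R]_N) := Ex O + \sum_(j < N) c j * (V ord0 j - Ex (U j)).

Let Z w := O w - lincomb U c w.

Let gZ : gspace Z.
Proof. by apply: gspace_sub => //; exact: gspace_lincomb. Qed.

Let cov_Z i : cov Z (U i) = 0.
Proof.
have gL := gspace_lincomb hu c gU.
rewrite covBl//; last exact: gspace_sq gL.
rewrite [X in _ - X]covC cov_lincomb//.
have : ((\row_i cov O (U i)) *m invmx M *m M) ord0 i = cov O (U i) by rewrite
  mulmxKV// mxE.
rewrite mxE => <-; apply/eqP; rewrite subr_eq0; apply/eqP.
apply: eq_bigr => j _; rewrite [X in _ * X]mxE covC; congr (_ * _).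
by rewrite mxE; apply: eq_bigr => k _; rewrite mxE.
Qed.

(** Writes the regression as [O] minus the centred residual, so that the defining property of a
    conditional version becomes [gspace_indep_mean]. *)
Let phiE w : phi (Uvec w) = O w - (Z w - Ex Z).
Proof.
have iU i := square_integrable_integrable (sU i).
have iL : ig (lincomb U c) by apply: integrable_fun_sum => i;
  exact: integrable_scale.
rewrite /phi /Z Ex_sub//; last exact: square_integrable_integrable.
rewrite /lincomb Ex_sum; last by move=> i; exact: integrable_scale.
rewrite (_ : \sum_(j < N) c j * (Uvec w ord0 j - Ex (U j)) =
  \sum_(j < N) c j * U j w - \sum_(j < N) Ex (fun w => c j * U j w));
    first by ring.
by rewrite -sumrB; apply: eq_bigr => j _; rewrite mxE Ex_scale// mulrBr.
Qed.

Lemma regression_cond_version : continuous_cond_version P Uvec O phi.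
Proof.
have iO := square_integrable_integrable sO.
have iZ := square_integrable_integrable (gspace_sq gZ).
have iZc : ig (fun w => Z w - Ex Z) by apply: integrable_sub => //;
  exact: integrable_cst.
have iphi : ig (fun w => phi (Uvec w)).
  by rewrite (funext phiE); exact: integrable_sub.
split=> //.
  move=> V; rewrite /phi; have FV : Filter (nbhs V) by exact: nbhs_filter.
  apply: (@cvgD _ _ _ (nbhs V) FV); first exact: cvg_cst.
  apply: (cvg_big _ (F := nbhs V)) => [|j _]; first exact: add_continuous.
  apply: cvgMr; apply: cvgB; last exact: cvg_cst.
  exact: coord_continuous.
move=> B sB; have hA := preimage_generated sB.
have mA := generated_sigma_measurable P mU hA.
rewrite (integral_setE iO mA) (integral_setE iphi mA); congr EFin.
have bA : bounded_measurable (\1_(Uvec @^-1` B) : T -> R)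
  by exact: bounded_measurable_indic.
apply/eqP; rewrite -subr_eq0 -Ex_sub; [|exact: integrable_mul_bounded..].
rewrite -[X in _ == X](gspace_indep_mean hu gZ gU cov_Z hA).
by apply/eqP; apply: eq_Rintegral => w _; rewrite phiE; ring.
Qed.

Lemma regression_cond_version_unique psi :
  continuous_cond_version P Uvec O psi -> psi = phi.
Proof.
move=> h; apply/funext => V; apply/eqP; rewrite eq_le.
by rewrite !(continuous_cond_version_le (O := O))//;
  exact: regression_cond_version.
Qed.

End conditioning.

End collective_variables.

Theorem lemma1 (R : realType)
    (dX : measure_display) (X : measurableType dX)
    (dx : {sigma_finite_measure set X -> \bar R})
    (d : measure_display) (T : measurableType d) (P : probability T R)
    (u : X -> T -> R) (ainv : X -> X -> R)
    (N : nat) (g : 'I_N -> gen_fun X R)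
    (hu : gaussian_random_function P u)
    (hcov : forall x y : X, covariance P (u x) (u y) = (ainv x y)%:E)
    (hg : forall alpha : 'I_N, admissible_kernel dx P u (g alpha)) :
  let mean (Y : T -> R) : R := fine (expectation P Y) in
  let U (alpha : 'I_N) (w : T) : R := gen_int dx (g alpha) (u^~ w) in
  let M : 'M[R]_N :=
    \matrix_(beta, alpha) fine (covariance P (U beta) (U alpha)) in
  let c (alpha : 'I_N) (x : X) : R :=
    \sum_(beta < N)
      gen_int dx (g beta) (fun y => ainv x y) * invmx M beta alpha in
  let Uvec (w : T) : 'rV[R]_N := \row_alpha U alpha w in
  M \in unitmx ->
  (forall beta alpha : 'I_N,
     covariance P (U beta) (U alpha) =
     (gen_int dx (g beta)
        (fun x => gen_int dx (g alpha) (fun y => ainv x y)))%:E) /\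
  (forall x : X,
     (exists! phi : 'rV[R]_N -> R,
        continuous_cond_version P Uvec (u x) phi) /\
     (forall V : 'rV[R]_N,
        cond_avg P Uvec (u x) V =
        mean (u x) + \sum_(alpha < N) c alpha x * (V ord0 alpha - mean (U alpha)))).
Proof.
move=> mean U M c Uvec uM.
have meanE Y : mean Y = Rintegral P setT Y by rewrite /mean unlock.
have sqx x : square_integrable P (u x).
  exact: gspace_sq (gspace_span hu.2 (finite_span_gen u x)).
have gU a : gspace P u (U a) by exact: gen_int_gspace.
have sU a := gspace_sq (gU a).
have ainvE x y : ainv x y = cov P (u x) (u y).
  by have := hcov x y; rewrite covariance_inner// => -[].
have sc Y : square_integrable P Y ->
    square_integrable P (fun w => Y w - Rintegral P setT Y).
  by move=> sY; apply: square_integrable_sub => //;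
    exact: square_integrable_cst.
(* Testing against the centred variable turns the inner product formula into one for covariances. *)
have covg a Y : square_integrable P Y ->
    gen_int dx (g a) (fun x => cov P (u x) Y) = cov P (U a) Y.
  move=> sY; rewrite -cov_centered// -(gen_int_inner hu (hg a) (sc _ sY)).
  by congr gen_int; apply/funext => x; rewrite cov_centered.
have covx a x : gen_int dx (g a) (fun y => ainv x y) = cov P (u x) (U a).
  rewrite covC -covg//; congr gen_int; apply/funext => y.
  by rewrite ainvE covC.
have ME : M = \matrix_(i, j) cov P (U i) (U j).
  by apply/matrixP => i j; rewrite !mxE covariance_inner.
rewrite ME in uM.
split=> [b a|x].
  (* The inner generalized integral is Cov(u(x), U a); integrating it against [g b] gives Cov(U b, U
     a). *)
  rewrite covariance_inner//; congr EFin; rewrite -[LHS]covg//; congr gen_int.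
  by apply/funext => x; rewrite covx.
have phiE V : mean (u x) + \sum_(a < N) c a x * (V ord0 a - mean (U a)) =
    Rintegral P setT (u x) + \sum_(a < N)
      (\sum_(b < N) cov P (u x) (U b) * invmx (\matrix_(i, j) cov P (U i) (U j))
        b a) *
      (V ord0 a - Rintegral P setT (U a)).
  rewrite meanE; congr (_ + _); apply: eq_bigr => a _; rewrite meanE;
    congr (_ * _).
  by rewrite /c ME; apply: eq_bigr => b _; rewrite covx.
have gx : gspace P u (u x) by exact: (gspace_span hu.2 (finite_span_gen u x)).
have h := regression_cond_version hu gU uM gx.
have huniq := regression_cond_version_unique hu gU uM gx.
split; first by eexists; split; [exact: h|move=> psi /huniq ->].
move=> V; rewrite phiE /cond_avg.
(* Existence guarantees that the choice in [cond_avg] is a genuine continuous version, and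
   uniqueness identifies it with the regression. *)
by rewrite (huniq _ (xgetPex (fun=> 0) (ex_intro _ _ h))).
Qed.
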